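(* Let $n\geq 1$ and $k\geq 1$ be integers. If $k$ is a power of $2$, or $k=3$, or $n$ is odd and $k=p$ is a prime, then $$\mathrm{secat}(\pi^n_k)=\mathrm{cat}(B(\mathbb{R}^n,k))=(k-1)\cdot(n-1).$$ Moreover, for every $k\geq 1$, $\mathrm{cat}(B(\mathbb{R}^2,k))=k-1$.
   Context: $F(\mathbb{R}^n,k)=\{(x_1,\dots,x_k)\in (\mathbb{R}^n)^k : x_i\neq x_j \text{ for } i\neq j\}$, $B(\mathbb{R}^n,k)=F(\mathbb{R}^n,k)/\Sigma_k$ with $\Sigma_k$ acting freely by permuting coordinates, and $\pi^n_k\colon F(\mathbb{R}^n,k)\to B(\mathbb{R}^n,k)$ is the quotient covering. $\mathrm{secat}(p)$ of a fibration $p\colon E\to B$ is the least $m$ such that $B$ can be covered by $m+1$ open sets each admitting a local section of $p$. $\mathrm{cat}(X)$ is the least $m$ such that $X$ can be covered by $m+1$ open sets each contractible in $X$. *)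

(* Defs.v *)
From Stdlib Require Import Reals ZArith Znumtheory Arith.
Open Scope R_scope.

Record space := Space { pt : Type; is_open : (pt -> Prop) -> Prop }.

Definition cont_on (X Y : space) (A : pt X -> Prop) (f : pt X -> pt Y) : Prop :=
  forall O, is_open Y O ->
    exists O', is_open X O' /\ forall x, A x -> (O (f x) <-> O' x).

Definition R_space : space :=
  Space R (fun O => forall t, O t -> exists e, 0 < e /\
             forall s, Rabs (s - t) < e -> O s).

Definition prod_space (X Y : space) : space :=
  Space (pt X * pt Y)%type (fun W => forall z, W z ->
    exists U V, is_open X U /\ is_open Y V /\ U (fst z) /\ V (snd z) /\
      forall a b, U a -> V b -> W (a, b)).

Definition idx (m : nat) := {i : nat | (i < m)%nat}.
Definition vec (n : nat) := idx n -> R.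

Definition config (n k : nat) :=
  {c : idx k -> vec n | forall i j, c i = c j -> i = j}.

Definition F_open (n k : nat) (O : config n k -> Prop) : Prop :=
  forall c, O c -> exists e, 0 < e /\
    forall d : config n k,
      (forall j i, Rabs (proj1_sig d j i - proj1_sig c j i) < e) -> O d.

Definition F_space (n k : nat) : space := Space (config n k) (F_open n k).

Definition same_orbit (n k : nat) (c d : config n k) : Prop :=
  exists s : idx k -> idx k,
    (exists g : idx k -> idx k, (forall i, g (s i) = i) /\ (forall i, s (g i) = i)) /\
    forall j, proj1_sig d j = proj1_sig c (s j).

(* Unordered configuration space B(R^n,k) = F(R^n,k)/Sigma_k (points = orbits). *)
Definition unordered (n k : nat) :=
  {P : config n k -> Prop | exists c, P = same_orbit n k c}.

Definition pi_conf (n k : nat) (c : config n k) : unordered n k :=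
  exist _ (same_orbit n k c) (ex_intro _ c eq_refl).

Definition B_space (n k : nat) : space :=
  Space (unordered n k) (fun U => F_open n k (fun c => U (pi_conf n k c))).

Definition secat_le (E B : space) (p : pt E -> pt B) (m : nat) : Prop :=
  exists U : nat -> pt B -> Prop,
    (forall i, (i <= m)%nat -> is_open B (U i)) /\
    (forall b, exists i, (i <= m)%nat /\ U i b) /\
    (forall i, (i <= m)%nat -> exists s : pt B -> pt E,
        cont_on B E (U i) s /\ forall b, U i b -> p (s b) = b).

Definition contractible_in (X : space) (U : pt X -> Prop) : Prop :=
  exists (H : pt X * R -> pt X) (x0 : pt X),
    cont_on (prod_space X R_space) X
      (fun z => U (fst z) /\ 0 <= snd z <= 1) H /\
    forall x, U x -> H (x, 0) = x /\ H (x, 1) = x0.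

Definition cat_le (X : space) (m : nat) : Prop :=
  exists U : nat -> pt X -> Prop,
    (forall i, (i <= m)%nat -> is_open X (U i)) /\
    (forall x, exists i, (i <= m)%nat /\ U i x) /\
    (forall i, (i <= m)%nat -> contractible_in X (U i)).

Definition is_least (P : nat -> Prop) (m : nat) : Prop :=
  P m /\ forall m', P m' -> (m <= m')%nat.

(* Main.v *)
(** Upper bounds: the strata of configurations, sorted lexicographically, by the first coordinate
    in which consecutive points differ have codimensions 0, ..., (k-1)(n-1). Strata of equal
    codimension have disjoint neighbourhoods, on which the quotient map has a section whose values
    contract to one configuration along straight lines. A contraction of an open set of B lifts to
    the covering F, hence secat <= cat.

    Lower bound for secat, k a power of a prime p: (k-1)(n-1) open sets with sections give as many
    equivariant, locally constant choices of a point of the configuration. The cup product of the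
    cocycles that record how these choices jump vanishes on small simplices, and it is cohomologous
    to the (n-1)-th power of the Euler class of the standard representation. That class takes a
    unit value on an explicit chain, the simplices of the product of n-1 Coxeter fans lifted to F
    by a last coordinate; modulo the symmetric group the boundary of this chain is a combination of
    binomial coefficients C(k,i), 0 < i < k, so it vanishes mod p.

    Lower bound for cat B(R^2,k): on the torus x_0 = 0, |x_j| = j, a contractible open set carries
    continuous square roots of the differences x_j - x_0; the product of the k-1 classes mod 2 that
    obstruct these roots is the fundamental class of the torus. *)

Require Import Defs.
From Stdlib Require Import Reals ZArith Znumtheory Arith.
From Stdlib Require Lra Lia Psatz List.
From Stdlib Require Classical_Prop ClassicalEpsilon FunctionalExtensionality.
From Stdlib Require PropExtensionality.
From mathcomp Require all_boot all_algebra all_fingroup ring zify.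

(** No homology groups are built. Cochains are arbitrary functions on finite lists of points, and a
    label is an arbitrary equivariant function, so a choice made by a section over one open set may
    be extended to all configurations with no regard to continuity. The prism between two labellings
    then shows that the value on the chain depends on equivariance alone, and it can be computed
    from the lexicographically smallest point. Continuity enters only at the end, through a limit
    point instead of a Lebesgue number: nested simplices of iterated subdivisions on which the
    cochain stays nonzero shrink to a point where all labels jump at once, although one of them is
    constant around it. The obstacle is that points may collide in a barycenter of configurations;
    simplices are therefore kept in sets of configurations that are closed under barycenters. The
    same argument runs on the torus, with translations of R^k and labels mod 2. For configurations
    the code has [k.+1] points and [m.+1] coordinates, so that the bound reads [m * k]. *)

Module Cochains.

Import all_boot all_algebra ring.
Set Implicit Arguments. Unset Strict Implicit.
Import GRing.Theory.
Local Open Scope ring_scope.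

Section Cochains.
Variable F : comNzRingType.

(** * Cochains on lists of points and barycentric subdivision *)

Section Lists.
Variable X : Type.
Implicit Types (c : seq X -> F) (l : seq X).

Fixpoint cobd c l : F :=
  if l is x :: l' then c l' - cobd (fun t => c (x :: t)) l' else 0.

Lemma eq_cobd_size m c c' l : size l = m.+1 ->
  (forall t, size t = m -> c t = c' t) -> cobd c l = cobd c' l.
Proof.
elim: l m c c' => [//|x l IH] m c c' /= [sl] e.
rewrite e //; congr (_ - _).
case: m sl e => [/size0nil -> //|m] sl e.
by apply: (IH m) => // t st; apply: e; rewrite /= st.
Qed.

Lemma eq_cobd c c' l : c =1 c' -> cobd c l = cobd c' l.
Proof.
elim: l c c' => [//|x l IH] c c' /= e; rewrite e; congr (_ - _).
by apply: IH => t; rewrite e.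
Qed.

Lemma cobdB c c' l : cobd (fun t => c t - c' t) l = cobd c l - cobd c' l.
Proof.
elim: l c c' => [|x l IH] c c' /=; first by rewrite subr0.
by rewrite (IH (fun t => c (x :: t)) (fun t => c' (x :: t))); ring.
Qed.

Lemma cobd0 l : cobd (fun=> 0) l = 0.
Proof. by elim: l => [//|x l /= ->]; rewrite subr0. Qed.

Lemma cobdK c l : cobd (cobd c) l = 0.
Proof.
elim: l c => [//|x l IH] c /=.
by rewrite cobdB IH subr0 subrr.
Qed.

Definition del i l := take i l ++ drop i.+1 l.

Lemma cobd_sum c l : cobd c l = \sum_(i < size l) (-1) ^+ i * c (del i l).
Proof.
elim: l c => [|x l IH] c /=; first by rewrite big_ord0.
rewrite big_ord_recl /= expr0 mul1r /del /= drop0; congr (_ + _).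
rewrite IH -sumrN; apply: eq_bigr => i _.
by rewrite /bump /= add1n exprS mulN1r mulNr.
Qed.

Variable bar : seq X -> X.

(* [subd] and [subdH] are dual to barycentric subdivision and to its chain homotopy with the
   identity, both built by coning from the barycenter [bar l]; the empty list plays the role of
   the augmentation. *)
Fixpoint subd m c l : F :=
  if m is m'.+1 then cobd (subd m' (fun s => c (bar l :: s))) l else c l.

Fixpoint subdH m c l : F :=
  if m is m'.+1 then c (bar l :: l) - cobd (subdH m' (fun s => c (bar l :: s))) l
  else 0.

Lemma eq_subd_size m c c' l : size l = m ->
  (forall t, size t = m -> c t = c' t) -> subd m c l = subd m c' l.
Proof.
elim: m c c' l => [|m IH] c c' l sl e /=; first exact: e.
by apply: (eq_cobd_size sl) => t st; apply: IH => // s ss; apply: e; rewrite /= ss.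
Qed.

Lemma subdB m c c' l : subd m (fun t => c t - c' t) l = subd m c l - subd m c' l.
Proof.
elim: m c c' l => [//|m IH] c c' l /=.
by rewrite -cobdB; apply: eq_cobd => t; rewrite -IH.
Qed.

Lemma eq_subdH_size m c c' l : size l = m ->
  (forall t, size t = m.+1 -> c t = c' t) -> subdH m c l = subdH m c' l.
Proof.
elim: m c c' l => [//|m IH] c c' l sl e /=.
rewrite e /= ?sl //; congr (_ - _).
by apply: (eq_cobd_size sl) => t st; apply: IH => // s ss; apply: e; rewrite /= ss.
Qed.

Lemma subdHB m c c' l : subdH m (fun t => c t - c' t) l = subdH m c l - subdH m c' l.
Proof.
elim: m c c' l => [|m IH] c c' l /=; first by rewrite subr0.
rewrite (@eq_cobd _ (fun t => subdH m (fun s => c (bar l :: s)) t - subdH m (fun s => c' (bar l :: s)) t)).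
  by rewrite cobdB; ring.
by move=> t; rewrite -IH.
Qed.

Lemma subdH0 m l : subdH m (fun=> 0) l = 0.
Proof.
elim: m l => [//|m IH] l /=.
by rewrite (@eq_cobd _ (fun=> 0)) ?cobd0 ?subr0 // => t; apply: IH.
Qed.

Lemma subd_cobd m c l : size l = m.+1 -> subd m.+1 (cobd c) l = cobd (subd m c) l.
Proof.
elim: m c l => [|m IH] c l sl.
  by case: l sl => [|x []] //= _; rewrite !subr0.
have -> : subd m.+2 (cobd c) l = cobd (subd m.+1 (fun s => c s - cobd (fun t => c (bar l :: t)) s)) l by [].
rewrite (@eq_cobd _ (fun t => subd m.+1 c t - subd m.+1 (cobd (fun t => c (bar l :: t))) t)); last first.
  by move=> t; rewrite subdB.
rewrite cobdB [X in _ - X](_ : _ = 0) ?subr0 //.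
rewrite (@eq_cobd_size m.+1 _ (cobd (subd m (fun t => c (bar l :: t))))) ?cobdK //.
by move=> t st; rewrite IH.
Qed.

Lemma subdH_cobd m c l : size l = m.+1 ->
  subdH m.+1 (cobd c) l + cobd (subdH m c) l = c l - subd m.+1 c l.
Proof.
elim: m c l => [|m IH] c l sl.
  case: l sl => [|x []] //= _.
  by rewrite !subr0 addr0.
set cb := fun t => c (bar l :: t).
have -> : subdH m.+2 (cobd c) l = c l - cobd cb l
   - cobd (subdH m.+1 (fun s => c s - cobd cb s)) l by [].
rewrite (@eq_cobd (subdH m.+1 (fun s => c s - cobd cb s)) (fun t => subdH m.+1 c t - subdH m.+1 (cobd cb) t)); last by move=> t; rewrite subdHB.
rewrite cobdB.
rewrite (@eq_cobd_size m.+1 (subdH m.+1 (cobd cb)) (fun t => (cb t - subd m.+1 cb t) - cobd (subdH m cb) t)) //; last first.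
  by move=> t st; rewrite -IH // addrK.
rewrite !cobdB cobdK subr0 /=.
by ring.
Qed.

Lemma subd0 m l : subd m (fun=> 0) l = 0.
Proof.
elim: m l => [//|m IH] l /=.
by rewrite (@eq_cobd _ (fun=> 0)) ?cobd0 // => t; apply: IH.
Qed.

Definition subdn m M c := iter M (subd m) c.

Lemma cobd_subdn m M c :
  (forall l, size l = m.+2 -> cobd c l = 0) ->
  forall l, size l = m.+2 -> cobd (subdn m.+1 M c) l = 0.
Proof.
move=> cc; elim: M => [//|M IH] l sl.
rewrite /subdn iterS -subd_cobd // (@eq_subd_size _ _ (fun=> 0)) ?subd0 //.
Qed.

Inductive in_subd : nat -> seq X -> seq X -> Prop :=
| in_subd0 l : in_subd 0 l l
| in_subdS m l i s : (i < size l)%N -> in_subd m (del i l) s ->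
    in_subd m.+1 l (bar l :: s).

Lemma del_map_iota (f : nat -> X) n i : (i <= n)%N ->
  del i [seq f j | j <- iota 0 n.+1] = [seq f j | j <- iota 0 i ++ iota i.+1 (n - i)].
Proof.
move=> le_in; rewrite /del -map_take -map_drop -map_cat; congr map.
have -> : iota 0 n.+1 = iota 0 i ++ i :: iota i.+1 (n - i).
  by rewrite -{1}(subnKC le_in) -addnS iotaD add0n.
by rewrite take_size_cat ?size_iota // -cat_rcons drop_size_cat // size_rcons size_iota.
Qed.

Lemma size_del i l : (i < size l)%N -> size (del i l) = (size l).-1.
Proof.
move=> il; rewrite /del size_cat size_take size_drop il.
by case: (size l) il => // n; rewrite ltnS subSS => /subnKC.
Qed.

Lemma size_in_subd m l s : in_subd m l s -> size l = m -> size s = m.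
Proof.
elim=> {m l s} [//|m l i s il _ IH sl] /=.
by rewrite IH // size_del // sl.
Qed.

Definition often (P : nat -> Prop) := forall N, exists2 M, (N <= M)%N & P M.

(** Infinite pigeonhole principle, by excluded middle: finitely many bounded sets of indices have a
    bounded union. *)
Lemma often_bigor n (P : nat -> nat -> Prop) :
  often (fun M => exists2 i, (i < n)%N & P i M) ->
  exists2 i, (i < n)%N & often (P i).
Proof.
elim: n => [|n IH] H; first by have [M _ []] := H 0%N.
case: (Classical_Prop.classic (often (P n))) => [|nP]; first by exists n.
have [N HN] : exists N, forall M, (N <= M)%N -> ~ P n M.
  apply: Classical_Prop.NNPP => nE; apply: nP => N.
  apply: Classical_Prop.NNPP => nM; apply: nE; exists N => M NM PM.
  by apply: nM; exists M.
have [|i lt_in oi] := IH; last by exists i => //; rewrite ltnS ltnW.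
move=> N'; have [M leM [i]] := H (maxn N N').
move: leM; rewrite geq_max => /andP[NM N'M].
rewrite ltnS leq_eqVlt => /predU1P[->|lt_in] PM; last by exists M => //; exists i.
by have := HN M NM PM.
Qed.

Lemma cobd_neq0 c l : cobd c l <> 0 ->
  exists2 i, (i < size l)%N & c (del i l) <> 0.
Proof.
move=> nz; apply: Classical_Prop.NNPP => nE; apply: nz.
rewrite cobd_sum big1 // => i _; case: (c (del i l) =P 0) => [->|ne]; first by rewrite mulr0.
by case: nE; exists i.
Qed.

(** One step of a compactness argument in the style of König: the cochain varies with [M], so that a
    single simplex of the first subdivision serves infinitely many numbers of remaining
    subdivisions. *)
Lemma often_subd (c : nat -> seq X -> F) m l : size l = m ->
  often (fun M => subd m (c M) l <> 0) ->
  exists2 s, in_subd m l s & often (fun M => c M s <> 0).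
Proof.
elim: m c l => [|m IH] c l sl H; first by exists l => //; constructor.
have [|i il oi] := @often_bigor (size l)
  (fun i M => subd m (fun s => c M (bar l :: s)) (del i l) <> 0).
  by move=> N; have [M NM /cobd_neq0 nz] := H N; exists M.
have [|s ss os] := IH (fun M s => c M (bar l :: s)) (del i l) _ oi.
  by rewrite size_del // sl.
by exists (bar l :: s) => //; apply: in_subdS ss.
Qed.

(** The substitute for convexity on a bare type with barycenters; it is what keeps iterated
    subdivisions of a simplex of [C] inside [C]. *)
Definition barconvex (C : X -> Prop) :=
  forall l, l <> [::] -> List.Forall C l -> C (bar l).

Lemma Forall_del C i l : List.Forall C l -> List.Forall C (del i l).
Proof.
move=> H; rewrite /del; elim: H i => [|x l' Cx Cl IH] [|i] //=.
  by rewrite drop0.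
by constructor => //; apply: IH.
Qed.

Lemma Forall_in_subd C m l s : barconvex C -> in_subd m l s -> List.Forall C l ->
  List.Forall C s.
Proof.
move=> cC; elim=> {m l s} [//|m l i s il _ IH Cl].
constructor; last by apply/IH/Forall_del.
by apply: cC => // l0; rewrite l0 in il.
Qed.

Lemma subd_neq0 c m l : size l = m -> subd m c l <> 0 -> exists2 s, in_subd m l s & c s <> 0.
Proof.
move=> sl nz; have [|s ss os] := @often_subd (fun=> c) m l sl; first by move=> N; exists N.
by exists s => //; have [] := os 0%N.
Qed.

Lemma subdn_neq0 c m M l : size l = m -> subdn m M c l <> 0 ->
  exists s, [/\ size s = m, c s <> 0 &
    forall C, barconvex C -> List.Forall C l -> List.Forall C s].
Proof.
elim: M l => [|M IH] l sl nz; first by exists l.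
have [s ss nz'] := subd_neq0 sl nz.
have [s' [s1 s2 s3]] := IH s (size_in_subd ss sl) nz'.
by exists s'; split=> // C cC Cl; apply: s3 => //; apply: Forall_in_subd ss Cl.
Qed.

End Lists.

(** * The prism homotopy between two maps *)

Section Prism.
Variables X L : Type.
Variables f g : X -> L.

(** Unfolded, the alternating sum of the values of [c] on the lists f x_0, ..., f x_i, g x_i, ..., g
    x_n. *)
Fixpoint prism (c : seq L -> F) (l : seq X) : F :=
  if l is x :: l' then c (f x :: g x :: map g l') - prism (fun s => c (f x :: s)) l'
  else 0.

Lemma eq_prism_size m c c' l : size l = m ->
  (forall t, size t = m.+1 -> c t = c' t) -> prism c l = prism c' l.
Proof.
elim: l m c c' => [//|x l IH] [|m] c c' //= [sl] e.
rewrite e /= ?size_map ?sl //; congr (_ - _).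
by apply: (IH m) => // s ss; apply: e; rewrite /= ss.
Qed.

Lemma prismB c c' l : prism (fun t => c t - c' t) l = prism c l - prism c' l.
Proof.
elim: l c c' => [|x l IH] c c' /=; first by rewrite subr0.
rewrite (IH (fun t => c (f x :: t)) (fun t => c' (f x :: t))).
by ring.
Qed.

Lemma prism0 l : prism (fun=> 0) l = 0.
Proof. by elim: l => [//|x l /= ->]; rewrite subr0. Qed.

Lemma cobd_map (h : X -> L) c l : cobd c (map h l) = cobd (fun t => c (map h t)) l.
Proof. by elim: l c => [//|x l IH] c /=; rewrite IH. Qed.

Lemma prism_cobd c l :
  prism (cobd c) l + cobd (prism c) l = c (map g l) - c (map f l).
Proof.
elim: l c => [|x l IH] c /=; first by rewrite subrr addr0.
rewrite (prismB c (cobd (fun t => c (f x :: t)))).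
rewrite (cobdB (fun t => c (f x :: g x :: map g t)) (prism (fun s => c (f x :: s)))).
have /= e := IH (fun t => c (f x :: t)).
move/(canRL (addrK _)): e => ->.
rewrite -(cobd_map g (fun t => c (f x :: g x :: t))).
set A := cobd _ (map g l). set B := prism c l. set C := cobd _ l.
set u := c (g x :: _). set v := c (f x :: map g l). set w := c (f x :: map f l).
by rewrite /=; ring.
Qed.
End Prism.

(** * Evaluation of an equivariant label cocycle on a chain closed modulo an action *)

Section Machine.
Variables X L G : Type.
Variable bar : seq X -> X.
Variables (distinct : X -> Prop) (act_pt : G -> X -> X) (aL : G -> L -> L) (chi : G -> F).
Hypothesis bar_act : forall g l, l <> [::] -> bar (map (act_pt g) l) = act_pt g (bar l).

(* Equivariance is only asked on lists contained in a barycentrically closed part of [distinct]: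
   those are the lists whose iterated subdivisions stay in [distinct]. *)
Definition equivariant m (c : seq X -> F) :=
  forall C, barconvex bar C -> (forall x, C x -> distinct x) ->
  forall g l, size l = m -> List.Forall C l -> c (map (act_pt g) l) = chi g * c l.

(** Two cochains are needed for the induction: the recursion on the list turns them into their
    slices at [x] and at [act_pt g x]. *)
Lemma cobd_act m C g a c c' l : size l = m.+1 -> List.Forall C l ->
  (forall t, size t = m -> List.Forall C t -> c' (map (act_pt g) t) = a * c t) ->
  cobd c' (map (act_pt g) l) = a * cobd c l.
Proof.
elim: l m c c' => [//|x l IH] m c c' /= [sl] Cl e.
inversion_clear Cl; rewrite e // mulrBr; congr (_ - _).
case: m sl e => [|m] sl e; first by rewrite (size0nil sl) /= mulr0.
apply: (IH m) => // t st Ct; rewrite -e //= ?st //.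
by constructor.
Qed.

Lemma subd_act m C g a c c' l : barconvex bar C -> size l = m -> List.Forall C l ->
  (forall t, size t = m -> List.Forall C t -> c' (map (act_pt g) t) = a * c t) ->
  subd bar m c' (map (act_pt g) l) = a * subd bar m c l.
Proof.
move=> cC; elim: m c c' l => [|m IH] c c' l sl Cl e /=; first exact: e.
apply: (@cobd_act m C) => // t st Ct; apply: IH => // s ss Cs.
have l0 : l <> [::] by move=> l0; rewrite l0 in sl.
by rewrite bar_act // -e //= ?ss //; constructor => //; apply: cC.
Qed.

Lemma subdH_act m C g a c c' l : barconvex bar C -> size l = m -> List.Forall C l ->
  (forall t, size t = m.+1 -> List.Forall C t -> c' (map (act_pt g) t) = a * c t) ->
  subdH bar m c' (map (act_pt g) l) = a * subdH bar m c l.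
Proof.
move=> cC; elim: m c c' l => [|m IH] c c' l sl Cl e /=; first by rewrite mulr0.
have l0 : l <> [::] by move=> l0; rewrite l0 in sl.
have Cb : C (bar l) by apply: cC.
rewrite mulrBr; congr (_ - _).
  by rewrite bar_act // -e //= ?sl //; constructor.
apply: (@cobd_act m C) => // t st Ct; apply: IH => // s ss Cs.
by rewrite bar_act // -e //= ?ss //; constructor.
Qed.

Lemma equivariant_subdn m M c : equivariant m c -> equivariant m (subdn bar m M c).
Proof.
move=> ec; elim: M => [//|M IH] C cC Cd g l sl Cl.
by apply: (@subd_act m C) => // t st Ct; apply: IH Ct.
Qed.

Lemma equivariant_subdH m c : equivariant m.+1 c -> equivariant m (subdH bar m c).
Proof.
by move=> ec C cC Cd g l sl Cl; apply: (@subdH_act m C) => // t st Ct; apply: ec Ct.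
Qed.

Variables (D : nat) (cL : seq L -> F).
Hypothesis cL_cocycle : forall l, size l = D.+2 -> cobd cL l = 0.
Hypothesis cL_act : forall g l, size l = D.+1 -> cL (map (aL g) l) = chi g * cL l.

Definition label_act (E : X -> L) := forall g x, distinct x -> E (act_pt g x) = aL g (E x).

Lemma map_label_act E g C l : label_act E -> (forall x, C x -> distinct x) ->
  List.Forall C l -> map E (map (act_pt g) l) = map (aL g) (map E l).
Proof.
move=> eE Cd; elim=> [//|x l' Cx _ IH] /=.
by rewrite IH eE //; apply: Cd.
Qed.

Lemma equivariant_label E : label_act E -> equivariant D.+1 (fun l => cL (map E l)).
Proof.
move=> eE C cC Cd g l sl Cl.
by rewrite (map_label_act g eE Cd Cl) cL_act ?size_map.
Qed.

Lemma prism_act E E' C g a c c' l m : label_act E -> label_act E' ->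
  (forall x, C x -> distinct x) -> size l = m -> List.Forall C l ->
  (forall t, size t = m.+1 -> c' (map (aL g) t) = a * c t) ->
  prism E E' c' (map (act_pt g) l) = a * prism E E' c l.
Proof.
move=> eE eE' Cd; elim: l m c c' => [|x l IH] m c c' sl Cl e /=; first by rewrite mulr0.
case: m sl e => // m /= [sl] e.
inversion_clear Cl; rewrite mulrBr; congr (_ - _).
  rewrite (map_label_act g eE' Cd) // eE ?eE' //; try exact: Cd.
  by rewrite -e //= size_map sl.
apply: (IH m) => // t st; rewrite eE; last exact: Cd.
by rewrite -(e (E x :: t)) //= st.
Qed.

Variable z : seq (F * seq X).
Definition ceval (c : seq X -> F) := \sum_(t <- z) t.1 * c t.2.
Hypothesis size_z : forall t, List.In t z -> size t.2 = D.+1.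
(** The chain [z] is closed only in the quotient by the action, with coefficients twisted by [chi];
    hence the test on equivariant cochains. *)
Hypothesis z_cycle : forall c, equivariant D c -> ceval (cobd c) = 0.

Lemma eq_ceval c c' : (forall l, size l = D.+1 -> c l = c' l) -> ceval c = ceval c'.
Proof.
move=> e; rewrite /ceval; elim: z size_z => [|t z' IH] sz; first by rewrite !big_nil.
by rewrite !big_cons e ?IH //; [move=> u uz; apply: sz; right | apply: sz; left].
Qed.

Lemma cevalB c c' : ceval (fun l => c l - c' l) = ceval c - ceval c'.
Proof. by rewrite /ceval -sumrB; apply: eq_bigr => t _; rewrite mulrBr. Qed.

Lemma ceval_subdivision E M : label_act E ->
  ceval (subdn bar D.+1 M (fun l => cL (map E l))) = ceval (fun l => cL (map E l)).
Proof.
move=> eE; elim: M => [//|M <-].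
set a := subdn _ _ M _; apply/esym/eqP; rewrite -subr_eq0 -cevalB.
rewrite (@eq_ceval _ (cobd (subdH bar D a))).
  rewrite z_cycle //; apply: equivariant_subdH; apply: equivariant_subdn.
  exact: equivariant_label.
move=> l sl; rewrite -(subdH_cobd bar a sl) (@eq_subdH_size _ _ _ _ (fun=> 0)) ?subdH0 ?add0r //.
move=> t st; apply: cobd_subdn => // s ss.
by rewrite -cobd_map cL_cocycle ?size_map.
Qed.

(** The prism of an equivariant cochain between two equivariant labellings is again equivariant, so
    its coboundary evaluates to 0. Neither labelling has to be continuous: the labels coming from
    sections can be traded for any labelling that is easy to evaluate. *)
Lemma ceval_label E E' : label_act E -> label_act E' ->
  ceval (fun l => cL (map E' l)) = ceval (fun l => cL (map E l)).
Proof.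
move=> eE eE'; apply/eqP; rewrite -subr_eq0 -cevalB.
rewrite (@eq_ceval _ (cobd (prism E E' cL))).
  rewrite z_cycle // => C cC Cd g l sl Cl.
  by apply: (prism_act eE eE' Cd sl Cl) => t; apply: cL_act.
move=> l sl; rewrite -(prism_cobd E E' cL l) (@eq_prism_size _ _ _ _ D.+1 _ (fun=> 0)) ?prism0 ?add0r //.
Qed.

Theorem often_subdivision E E' : label_act E -> label_act E' ->
  ceval (fun l => cL (map E' l)) <> 0 ->
  exists2 t, List.In t z & often (fun M => subdn bar D.+1 M (fun l => cL (map E l)) t.2 <> 0).
Proof.
move=> eE eE' nz.
have {nz} nz M : ceval (subdn bar D.+1 M (fun l => cL (map E l))) <> 0.
  by rewrite ceval_subdivision // -(@ceval_label E E').
have [|i iz oi] := @often_bigor (size z) (fun i M =>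
   subdn bar D.+1 M (fun l => cL (map E l)) (nth (0, [::]) z i).2 <> 0).
  move=> M; exists M => //; apply: Classical_Prop.NNPP => nE; apply: (nz M).
  rewrite /ceval (big_nth (0, [::])) big_nat big1 // => i /= iz.
  case: (subdn bar D.+1 M (fun l => cL (map E l)) (nth (0, [::]) z i).2 =P 0) => [->|ne]; first by rewrite mulr0.
  by case: nE; exists i.
exists (nth (0, [::]) z i) => //.
elim: (z) i iz {oi} => // t z' IH [|i] /= iz; first by left.
by right; apply: IH.
Qed.

End Machine.
End Cochains.

End Cochains.

(** * Mesh of iterated subdivisions and limits of nested simplices *)

Module Barycenters.

Import Reals Lra Lia.
Import List ClassicalEpsilon.
Import all_boot all_algebra.
Import Cochains.
Set Implicit Arguments. Unset Strict Implicit.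
Local Open Scope R_scope.

Lemma Rabs_le_bounds a b : Rabs a <= b -> - b <= a <= b.
Proof. by move: (Rle_abs a) (Rle_abs (- a)); rewrite Rabs_Ropp; lra. Qed.

Section Barycenters.
Variable I : Type.
Notation pnt := (I -> R).
Implicit Types (x y : pnt) (l s : seq pnt).

Definition avg (f : pnt -> R) l := foldr (fun x a => f x + a) 0 l / INR (size l).
Definition bary l : pnt := fun i => avg (fun x => x i) l.

Lemma INR_size_gt0 l : l <> [::] -> 0 < INR (size l).
Proof. by case: l => // x l _; apply: lt_0_INR => /=; lia. Qed.

Lemma avg_ge f a l : l <> [::] -> List.Forall (fun x => a <= f x) l -> a <= avg f l.
Proof.
move=> l0 H; have p := INR_size_gt0 l0.
apply: (Rmult_le_reg_r (INR (size l))) => //.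
rewrite /avg /Rdiv Rmult_assoc Rinv_l ?Rmult_1_r; last lra.
elim: H {l0 p} => [|x l' ax _ IH]; first by rewrite /=; lra.
change (INR (size (x :: l'))) with (INR (S (size l'))); rewrite S_INR /=; lra.
Qed.

Lemma avgN f l : avg (fun x => - f x) l = - avg f l.
Proof.
rewrite /avg /Rdiv Ropp_mult_distr_l; congr (_ * _).
by elim: l => [|x l /= ->]; rewrite /=; lra.
Qed.

Lemma barconvex_box x d : barconvex bary (fun y => forall i, Rabs (y i - x i) <= d).
Proof.
move=> l l0 H i; rewrite /bary.
apply: Rabs_le; split.
  suff: x i - d <= avg (fun y => y i) l by lra.
  apply: avg_ge => //; apply: Forall_impl H => y /(_ i) /Rabs_le_bounds; lra.
suff: - (x i + d) <= avg (fun y => - y i) l by rewrite avgN; lra.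
apply: avg_ge => //; apply: Forall_impl H => y /(_ i) /Rabs_le_bounds; lra.
Qed.

Definition diam d l := forall x y i, List.In x l -> List.In y l -> Rabs (x i - y i) <= d.

(** The difference is the mean of the [f x - f y], and the term of [x] itself is 0: this is the gain
    [d / INR (size l)]. *)
Lemma sub_avg_le f d x l : List.In x l -> 0 <= d ->
  (forall y, List.In y l -> Rabs (f x - f y) <= d) ->
  Rabs (f x - avg f l) <= d - d / INR (size l).
Proof.
move=> xl d0 H.
have l0 : l <> [::] by move=> l0; rewrite l0 in xl.
have p := INR_size_gt0 l0.
have e : f x - avg f l = foldr (fun y a => (f x - f y) + a) 0 l / INR (size l).
  have -> : foldr (fun y a => (f x - f y) + a) 0 l = INR (size l) * f x - foldr (fun y a => f y + a) 0 l.
    elim: (l) => [|y l' IH]; first by rewrite /=; lra.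
    by change (INR (size (y :: l'))) with (INR (S (size l'))); rewrite S_INR /= IH; lra.
  by rewrite /avg; field; lra.
have b : Rabs (foldr (fun y a => (f x - f y) + a) 0 l) <= INR (size l) * d - d.
  have aux : forall l', (forall y, List.In y l' -> Rabs (f x - f y) <= d) ->
      Rabs (foldr (fun y a => (f x - f y) + a) 0 l') <= INR (size l') * d.
    elim=> [|y l' IH] h; first by rewrite /= Rabs_R0; lra.
    change (INR (size (y :: l'))) with (INR (S (size l'))); rewrite S_INR /=.
    have h1 := h y (or_introl erefl).
    have h2 := IH (fun y' yl => h y' (or_intror yl)).
    have := Rabs_triang (f x - f y) (foldr (fun y a => (f x - f y) + a) 0 l'); lra.
  elim: (l) xl H {l0 p e} => [//|y l' IH] xl h.
  change (INR (size (y :: l'))) with (INR (S (size l'))); rewrite S_INR /=.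
  have h1 := h y (or_introl erefl).
  case: xl => [->|xl].
    have := aux l' (fun y' yl => h y' (or_intror yl)).
    by rewrite Rminus_diag Rplus_0_l; lra.
  have h2 := IH xl (fun y' yl => h y' (or_intror yl)).
  have := Rabs_triang (f x - f y) (foldr (fun y a => (f x - f y) + a) 0 l'); lra.
rewrite e /Rdiv Rabs_mult (Rabs_pos_eq (/ _)); last by apply: Rlt_le; apply: Rinv_0_lt_compat.
apply: Rle_trans (Rmult_le_compat_r _ _ _ _ b) _; first by apply: Rlt_le; apply: Rinv_0_lt_compat.
by apply: Req_le; field; lra.
Qed.

Lemma Forall_In (T : Type) (P : T -> Prop) (l : seq T) : (forall t : T, List.In t l -> P t) -> List.Forall P l.
Proof. by move/Forall_forall. Qed.

Lemma diam_del d i l : diam d l -> diam d (del i l).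
Proof.
have h y : List.In y (del i l) -> List.In y l.
  suff /Forall_forall H : List.Forall (fun y => List.In y l) (del i l) by apply: H.
  by apply: Forall_del; apply: Forall_In.
by move=> H x y j xl yl; apply: H; apply: h.
Qed.

(** The ratio is written with a fixed [N] because the induction runs through faces of all smaller
    sizes, whose own ratios are better. *)
Lemma mesh N d m l s : (m <= N)%N -> 0 <= d -> in_subd bary m l s -> size l = m -> diam d l ->
  diam ((1 - / INR N) * d) s.
Proof.
move=> mN d0 H; elim: H mN => {m l s} [l _ /size0nil -> _ x y i [] //|m l i s il H IH mN sl dl].
have l0 : l <> [::] by move=> l0; rewrite l0 in sl.
have pl := INR_size_gt0 l0.
have ple : / INR N <= / INR (size l).
  apply: Rinv_le_contravar => //; apply: le_INR; apply/leP; by rewrite sl.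
have near : List.Forall (fun y => forall i, Rabs (y i - bary l i) <= (1 - / INR N) * d) (bary l :: s).
  have C : List.Forall (fun y => forall i, Rabs (y i - bary l i) <= (1 - / INR N) * d) l.
    apply: Forall_In => x xl j.
    apply: Rle_trans (@sub_avg_le (fun y => y j) d x l xl d0 _) _; first by move=> y yl; apply: dl.
    rewrite /Rdiv; nra.
  apply: (Forall_in_subd (@barconvex_box (bary l) _) (m := m.+1) (l := l)) => //.
  exact: in_subdS H.
have near' x j : List.In x (bary l :: s) -> Rabs (x j - bary l j) <= (1 - / INR N) * d.
  by move/Forall_forall: near => near /near.
have IH' := IH (ltnW mN) _ (diam_del (i := i) dl).
move=> x y j [<-|xs] [<-|ys].
- by apply: near'; left.
- by rewrite Rabs_minus_sym; apply: near'; right.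
- by apply: near'; right.
- by apply: IH' => //; rewrite size_del // sl.
Qed.

Section Limit.
Variables (F : comNzRingType) (c : seq pnt -> F) (D : nat).

Definition alive l := size l = D.+1 /\ often (fun M => subdn bary D.+1 M c l <> GRing.zero).

Lemma alive_step l : alive l -> exists s, alive s /\ in_subd bary D.+1 l s.
Proof.
move=> [sl H].
have [|s ss os] := @often_subd F _ bary (fun M => subdn bary D.+1 M c) D.+1 l sl.
  (* Asking for a number beyond [N.+1] makes it a successor, so that one subdivision can be peeled
     off. *)
  by move=> N; have [[|M] NM nz] := H N.+1; [by []|exists M].
by exists s; split=> //; split=> //; apply: size_in_subd ss sl.
Qed.

Definition next (a : {l | alive l}) : {l | alive l} :=
  let: exist l al := a in
  let h := constructive_indefinite_description _ (alive_step al) in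
  exist _ (proj1_sig h) (proj1 (proj2_sig h)).

Lemma next_in_subd (a : {l | alive l}) : in_subd bary D.+1 (proj1_sig a) (proj1_sig (next a)).
Proof. by case: a => l al /=; case: constructive_indefinite_description => s []. Qed.

(** Dependent choice gives simplices [u n], each in the subdivision of the preceding one. A box is
    closed under barycenters, so all later simplices stay in a box around any vertex of [u n], whose
    size decreases geometrically; the heads [h n] therefore converge. *)
Theorem limit_point t d : alive t -> diam d t ->
  exists x : pnt, forall eta, 0 < eta -> exists s,
    [/\ size s = D.+1, c s <> GRing.zero,
        forall y i, List.In y s -> Rabs (y i - x i) <= eta &
        forall C, barconvex bary C -> List.Forall C t -> List.Forall C s].
Proof.
move=> al dt.
pose u n := proj1_sig (iter n next (exist _ t al)).
have alu n : alive (u n) by apply: (proj2_sig (iter n next (exist _ t al))).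
have stp n : in_subd bary D.+1 (u n) (u n.+1) by rewrite /u iterS; apply: next_in_subd.
pose th := 1 - / INR D.+1.
have thb : 0 <= th < 1.
  have h : 1 <= INR D.+1 by rewrite S_INR; have := pos_INR D; lra.
  have h1 : 0 < / INR D.+1 by apply: Rinv_0_lt_compat; lra.
  have : / INR D.+1 <= / 1 by apply: Rinv_le_contravar; lra.
  by rewrite /th; lra.
have [t0 [t1 et]] : exists x l', t = x :: l'.
  by case: (t) (proj1 al) => // x l' _; exists x, l'.
(* Without coordinates [d] may be negative, but every estimate is then empty and any simplex with a
   nonzero value will do. *)
case: (Classical_Prop.classic (inhabited I)) => [[i0]|noI]; last first.
  exists (fun=> 0) => eta _; have [st H] := al; have [M _ nz] := H 0%N.
  have [s [h1 h2 h3]] := subdn_neq0 st nz.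
  by exists s; split=> // y i; case: noI; constructor.
have d0 : 0 <= d.
  by have := dt t0 t0 i0; rewrite et => h; have := h (or_introl erefl) (or_introl erefl); rewrite Rminus_diag Rabs_R0.
have du n : diam (th ^ n * d) (u n).
  elim: n => [|n IH]; first by rewrite Rmult_1_l; apply: dt.
  have := @mesh D.+1 (th ^ n * d) D.+1 (u n) (u n.+1) (leqnn _) _ (stp n) (proj1 (alu n)) IH.
  rewrite -/th -tech_pow_Rmult Rmult_assoc; apply.
  by apply: Rmult_le_pos => //; apply: pow_le; lra.
have sub C n m : barconvex bary C -> List.Forall C (u n) -> List.Forall C (u (n + m)%N).
  move=> cC Cn; elim: m => [|m IH]; first by rewrite addn0.
  by rewrite addnS; apply: Forall_in_subd (stp _) IH.
pose h n := head t0 (u n).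
have hu n : List.In (h n) (u n).
  by rewrite /h; case: (u n) (proj1 (alu n)) => // x l' _; left.
have close n m x i : List.In x (u n) -> Rabs (h (n + m)%N i - x i) <= th ^ n * d.
  move=> xu; have : List.Forall (fun y => forall i, Rabs (y i - x i) <= th ^ n * d) (u (n + m)%N).
    apply: sub; first exact: barconvex_box.
    by apply: Forall_In => y yu j; apply: du.
  by move/Forall_forall => /(_ _ (hu _)).
have small eta : 0 < eta -> exists n, th ^ n * d < eta.
  move=> e0; have ht : Rabs th < 1 by rewrite Rabs_pos_eq; lra.
  have hp : 0 < eta / (d + 1) by apply: Rdiv_lt_0_compat; lra.
  have [N hN] := pow_lt_1_zero th ht _ hp.
  exists N; have := hN N (le_n _).
  rewrite Rabs_pos_eq; last by apply: pow_le; lra.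
  move=> h1; have h2 : 0 <= th ^ N by apply: pow_le; lra.
  have : th ^ N * (d + 1) < eta / (d + 1) * (d + 1) by apply: Rmult_lt_compat_r; lra.
  have -> : eta / (d + 1) * (d + 1) = eta by field; lra.
  nra.
have cau i : Cauchy_crit (fun n => h n i).
  move=> eps e0; have [N hN] := small (eps / 2) ltac:(lra).
  exists N => n m nN mN.
  have en : n = (N + (n - N))%N by rewrite subnKC //; apply/leP.
  have em : m = (N + (m - N))%N by rewrite subnKC //; apply/leP.
  rewrite /R_dist en em.
  have a1 := close N (n - N)%N (h N) i (hu N).
  have a2 := close N (m - N)%N (h N) i (hu N).
  have -> : h (N + (n - N))%N i - h (N + (m - N))%N i = (h (N + (n - N))%N i - h N i) - (h (N + (m - N))%N i - h N i) by ring.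
  have := Rabs_triang (h (N + (n - N))%N i - h N i) (- (h (N + (m - N))%N i - h N i)).
  by rewrite Rabs_Ropp /Rdist /Rminus; rewrite /Rminus in a1 a2; lra.
pose x i := proj1_sig (R_complete _ (cau i)).
have cx n y i : List.In y (u n) -> Rabs (y i - x i) <= th ^ n * d.
  move=> yu; apply: Rnot_lt_le => gt.
  have := proj2_sig (R_complete _ (cau i)); rewrite -/(x i) => cv.
  have [N hN] := cv (Rabs (y i - x i) - th ^ n * d) ltac:(lra).
  have := hN (n + N)%N; rewrite /Rdist => h1.
  have {h1} := h1 ltac:(apply/leP; apply: leq_addl).
  have := close n N y i yu.
  have -> : y i - x i = (h (n + N)%N i - x i) - (h (n + N)%N i - y i) by ring.
  have := Rabs_triang (h (n + N)%N i - x i) (- (h (n + N)%N i - y i)).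
  by rewrite Rabs_Ropp /Rminus; lra.
exists x => eta e0; have [n hn] := small eta e0.
have [su H] := alu n; have [M _ nz] := H 0%N.
have [s [h1 h2 h3]] := subdn_neq0 su nz.
exists s; split=> //.
  move=> y i ys; have : List.Forall (fun y => forall i, Rabs (y i - x i) <= th ^ n * d) s.
    apply: h3; first exact: barconvex_box.
    by apply: Forall_In => w wu j; apply: cx.
  by move/Forall_forall => /(_ _ ys) /(_ i); lra.
by move=> C cC Ct; apply: h3 => //; apply: (sub C 0%N n).
Qed.
End Limit.
End Barycenters.

End Barycenters.

(** * The determinantal cup product of label jumps *)

Module LabelCocycle.

Import all_boot all_algebra all_fingroup zify.
Import Cochains.
Set Implicit Arguments. Unset Strict Implicit.
Import GRing.Theory.
Local Open Scope ring_scope.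

Section LabelCocycle.
Variables (F : fieldType) (k m : nat).
Local Notation D := (m * k)%N.
Local Notation row := 'rV[F]_k.+1.
Local Notation lab := (nat -> 'I_k.+1).

Definition unit_row (a : 'I_k.+1) : row := locked (delta_mx 0 a).
Lemma unit_rowE a j : unit_row a 0 j = (j == a)%:R.
Proof. by rewrite /unit_row -lock mxE. Qed.
Definition lblock (w : nat -> row) (r : nat) : 'M[F]_k.+1 :=
  \matrix_(i, j) (if (i < k)%N then w (r * k + i)%N 0 j else unit_row ord0 0 j).
Definition blockdet (w : nat -> row) : F := \prod_(r < m) \det (lblock w r).

Lemma lblock_idx r i : (r < m -> i < k -> r * k + i < D)%N.
Proof.
move=> rm ik; apply: (@leq_trans (r.+1 * k)); last by rewrite leq_mul2r rm orbT.
by rewrite mulSn addnC ltn_add2r.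
Qed.

Lemma eq_blockdet w w' : (forall j, (j < D)%N -> w j = w' j) -> blockdet w = blockdet w'.
Proof.
move=> e; apply: eq_bigr => r _; congr (\det _); apply/matrixP => i j; rewrite !mxE.
by case: ltnP => // ik; rewrite e // lblock_idx.
Qed.

Lemma blockdetD j0 w w1 w2 : (j0 < D)%N -> w j0 = w1 j0 + w2 j0 ->
  (forall j, j != j0 -> w j = w1 j /\ w j = w2 j) -> blockdet w = blockdet w1 + blockdet w2.
Proof.
move=> jD e0 e.
have k0 : (0 < k)%N by case: (k) jD => //; rewrite muln0.
have rm : (j0 %/ k < m)%N by rewrite ltn_divLR.
pose r0 := Ordinal rm.
rewrite /blockdet !(bigD1 r0 (P := predT)) //=.
have oth (w' : nat -> row) : (forall j, j != j0 -> w j = w' j) ->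
   \prod_(i < m | i != r0) \det (lblock w i) = \prod_(i < m | i != r0) \det (lblock w' i).
  move=> e'; apply: eq_bigr => r rr0; congr (\det _); apply/matrixP => i j; rewrite !mxE.
  case: ltnP => // ik; rewrite e' //; apply: contra_neq rr0 => je.
  by apply: val_inj; rewrite /= -je divnMDl // divn_small ?addn0.
rewrite -(oth w1); last by move=> j /e [].
rewrite -(oth w2); last by move=> j /e [].
rewrite -mulrDl; congr (_ * _).
have ik : (j0 %% k < k.+1)%N by rewrite ltnS ltnW // ltn_mod.
pose i0 := Ordinal ik.
have j0E : (j0 %/ k * k + j0 %% k)%N = j0 by rewrite -divn_eq.
rewrite (@determinant_multilinear _ _ _ (lblock w1 (j0 %/ k)) (lblock w2 (j0 %/ k)) i0 1 1).
- by rewrite !mul1r.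
- by apply/rowP => j; rewrite !mxE /= ltn_mod k0 j0E e0 !mxE !mul1r.
- apply/matrixP => i j; rewrite !mxE; case: ltnP => // lik.
  case: (e (j0 %/ k * k + lift i0 i)%N) => [|-> _ //]; rewrite -{2}j0E eqn_add2l.
  by have := neq_lift i0 i; apply: contra_neq => h; apply: val_inj.
- apply/matrixP => i j; rewrite !mxE; case: ltnP => // lik.
  case: (e (j0 %/ k * k + lift i0 i)%N) => [|_ -> //]; rewrite -{2}j0E eqn_add2l.
  by have := neq_lift i0 i; apply: contra_neq => h; apply: val_inj.
Qed.

Definition lab0 : lab := fun=> ord0.
Definition lstep (ls : seq lab) (j : nat) : row :=
  unit_row (nth lab0 ls j.+1 j) - unit_row (nth lab0 ls j j).
(* A cup product of 1-cocycles, contracted blockwise by determinants on sum-zero vectors (the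
   last row [unit_row ord0] of a block realises that determinant). Slot [j] only reads the label
   in slot [j], so the value is 0 as soon as one of the [m * k] labels is constant on the list;
   when all slots agree it is the [m]-th power of the Euler class of the standard
   representation. *)
Definition lcochain (ls : seq lab) : F := blockdet (lstep ls).

Lemma nth_del (T : Type) (x0 : T) i l j : (i < size l)%N ->
  nth x0 (del i l) j = nth x0 l (if (j < i)%N then j else j.+1).
Proof.
move=> il; rewrite /del nth_cat size_take il; case: ltnP => ij; first by rewrite nth_take.
by rewrite nth_drop; congr nth; lia.
Qed.

Lemma alternating_telescope (Q : nat -> F) N (t : nat -> F) :
  t 0%N = Q 0%N -> t N.+1 = Q N ->
  (forall i, (i < N)%N -> t i.+1 = Q i + Q i.+1) ->
  \sum_(i < N.+2) (-1) ^+ i * t i = 0.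
Proof.
move=> t0 tN tS.
rewrite (eq_bigr (fun i : 'I_N.+2 => (-1) ^+ i * (if (i : nat) is i'.+1 then Q i' else 0)
   + (-1) ^+ i * (if (i <= N)%N then Q i else 0))); last first.
  move=> [[|i] ii] _ /=; first by rewrite t0 mulr0 add0r.
  rewrite -mulrDr; congr (_ * _).
  move: ii; rewrite !ltnS leq_eqVlt => /predU1P[->|ii]; first by rewrite ltnn addr0.
  by rewrite ii tS.
rewrite big_split /= big_ord_recl /= mulr0 add0r [X in _ + X]big_ord_recr /= ltnn mulr0 addr0.
rewrite -big_split big1 // => i _ /=.
by rewrite /bump /= add1n exprS -ltnS ltn_ord mulN1r mulNr addNr.
Qed.

(** Deleting vertex i + 1 merges two consecutive steps in slot i and in no other slot. Additivity in
    that row splits the face as [Q i + Q i.+1], where [Q i] takes the step from j to j + 1 in the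
    slots before i and the step from j + 1 to j + 2 in the others; the alternating sum
    telescopes. *)
Lemma lcochain_cocycle ls : size ls = D.+2 -> cobd lcochain ls = 0.
Proof.
move=> sls; rewrite cobd_sum sls.
pose low j : row := unit_row (nth lab0 ls j.+1 j) - unit_row (nth lab0 ls j j).
pose high j : row := unit_row (nth lab0 ls j.+2 j) - unit_row (nth lab0 ls j.+1 j).
pose Q i := blockdet (fun j => if (j < i)%N then low j else high j).
apply: (@alternating_telescope Q D (fun i => lcochain (del i ls))).
- by apply: eq_blockdet => j _; rewrite /lstep !nth_del ?sls.
- by apply: eq_blockdet => j jD; rewrite /lstep !nth_del ?sls // ltnS jD ltnW // ltnS.
- move=> i iD; rewrite addrC.
  apply: (@blockdetD i) => //.
    rewrite /lstep !nth_del ?sls //; try lia.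
    by rewrite !ltnS ltnn leqnn /low /high [RHS]addrC subrKA.
  move=> j ji; rewrite /lstep !nth_del ?sls //; try lia.
  rewrite !ltnS /low /high.
  case: (ltngtP j i) ji => //= _ _; split=> //.
Qed.

Lemma det_rows_sum0 (A : 'M[F]_k.+1) : (forall i, \sum_j A i j = 0) -> \det A = 0.
Proof.
move=> e; apply/eqP; rewrite -det_tr; apply/det0P; exists (const_mx 1).
  by apply/eqP => /rowP /(_ ord0) /eqP; rewrite !mxE oner_eq0.
apply/rowP => i; rewrite !mxE -[RHS](e i); apply: eq_bigr => j _.
by rewrite !mxE mul1r.
Qed.

Lemma unit_row_sum a : \sum_j unit_row a 0 j = 1.
Proof.
rewrite (bigD1 a) //= big1 ?addr0; first by rewrite unit_rowE eqxx.
by move=> j ja; rewrite unit_rowE (negPf ja).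
Qed.

Lemma unit_row_perm (t : 'S_k.+1) a j : unit_row (t a) 0 j = unit_row a 0 (t^-1 j)%g.
Proof. by rewrite !unit_rowE (can2_eq (permKV t) (permK t)). Qed.

Definition act_lab (g : nat -> 'S_k.+1) (l : lab) : lab := fun j => g (j %/ k)%N (l j).
Definition lsign (g : nat -> 'S_k.+1) : F := \prod_(r < m) (-1) ^+ (g r : bool).

(** Permuting labels permutes the columns of a block, except in its last row, which remains
    [unit_row ord0]. The correction [B0] has all row sums equal to 0 and is singular, so only the
    sign of the permutation remains. *)
Lemma lcochain_act g ls : size ls = D.+1 -> lcochain (map (act_lab g) ls) = lsign g * lcochain ls.
Proof.
move=> sls; rewrite /lcochain /blockdet /lsign -big_split /=; apply: eq_bigr => r _.
set t := g r.
pose B := \matrix_(i, j) (lblock (lstep ls) r) i ((t^-1)%g j).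
have detB : \det B = (-1) ^+ t * \det (lblock (lstep ls) r).
  rewrite (_ : B = col_perm (t^-1)%g (lblock (lstep ls) r)); last by apply/matrixP => i j; rewrite !mxE.
  by rewrite col_permE det_mulmx det_perm invgK mulrC.
rewrite -detB.
pose B0 := \matrix_(i, j) (if (i < k)%N then B i j else unit_row ord0 0 j - unit_row (t ord0) 0 j).
rewrite (@determinant_multilinear _ _ _ B B0 ord_max 1 1).
- rewrite !mul1r [\det B0](_ : _ = 0) ?addr0 //.
  apply: det_rows_sum0 => i.
  rewrite (eq_bigr (fun j => if (i < k)%N then B i j else unit_row ord0 0 j - unit_row (t ord0) 0 j)); last by move=> j _; rewrite mxE.
  case: ltnP => ik; last by rewrite sumrB !unit_row_sum subrr.
  rewrite (eq_bigr (fun j => lblock (lstep ls) r i ((t^-1)%g j))); last by move=> j _; rewrite mxE.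
  rewrite (reindex_inj (@perm_inj _ t)) /=.
  rewrite (eq_bigr (fun j => unit_row (nth lab0 ls (r * k + i).+1%N (r * k + i)%N) 0 j - unit_row (nth lab0 ls (r * k + i)%N (r * k + i)%N) 0 j)).
    by rewrite sumrB !unit_row_sum subrr.
  by move=> j _; rewrite permK !mxE ik ?mxE.
- apply/rowP => j; rewrite !mxE ltnn !mul1r -!unit_row_perm.
  by rewrite addrC subrK.
- apply/matrixP => i j; rewrite !mxE.
  have ik : (lift ord_max i < k)%N by rewrite lift_max.
  rewrite ik /lstep /act_lab.
  have a1 : ((r * k + lift ord_max i).+1 < size ls)%N by rewrite sls ltnS lblock_idx.
  have k0 : (0 < k)%N by apply: leq_ltn_trans ik.
  rewrite !(nth_map lab0) //; last by apply: ltnW.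
  rewrite divnMDl // divn_small // addn0 -/t.
  by rewrite ?mxE !unit_row_perm.
- apply/matrixP => i j; rewrite !mxE.
  have ik : (lift ord_max i < k)%N by rewrite lift_max.
  rewrite ik /lstep /act_lab.
  have a1 : ((r * k + lift ord_max i).+1 < size ls)%N by rewrite sls ltnS lblock_idx.
  have k0 : (0 < k)%N by apply: leq_ltn_trans ik.
  rewrite !(nth_map lab0) //; last by apply: ltnW.
  rewrite divnMDl // divn_small // addn0 -/t.
  by rewrite ?mxE !unit_row_perm.
Qed.

Lemma lcochain_neq0 ls j : lcochain ls <> 0 -> (j < D)%N -> nth lab0 ls j.+1 j <> nth lab0 ls j j.
Proof.
move=> nz jD e; apply: nz; apply/eqP.
have k0 : (0 < k)%N by case: (k) jD => //; rewrite muln0.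
have rm : (j %/ k < m)%N by rewrite ltn_divLR.
apply/prodf_eq0; exists (Ordinal rm) => //; apply/det0P.
have ik : (j %% k < k.+1)%N by rewrite ltnS ltnW // ltn_mod.
exists (delta_mx 0 (Ordinal ik)).
  by apply/eqP => /rowP /(_ (Ordinal ik)) /eqP; rewrite !mxE !eqxx oner_eq0.
apply/rowP => a; rewrite -rowE !mxE /= ltn_mod k0 -divn_eq.
by rewrite e subrr.
Qed.

Definition stepmx (h : nat -> 'I_k.+1) : 'M[F]_k.+1 :=
  \matrix_(i, j) (if (i < k)%N then (unit_row (h i.+1) - unit_row (h i)) 0 j else unit_row ord0 0 j).

(** If the two values agreed, the rows from [a] to [b - 1] would telescope to 0. *)
Lemma stepmx_inj h a b : \det (stepmx h) <> 0 -> (a < b)%N -> (b <= k)%N -> h a <> h b.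
Proof.
move=> nz ab bk e; apply: nz; apply/eqP/det0P.
have ak : (a < k.+1)%N by rewrite ltnS ltnW // (leq_trans ab).
exists (\row_i (if (a <= i < b)%N then 1 else 0)).
  by apply/eqP => /rowP /(_ (Ordinal ak)) /eqP; rewrite !mxE /= leqnn ab oner_eq0.
apply/rowP => j; rewrite !mxE.
pose f i := unit_row (h i) 0 j.
rewrite (eq_bigr (fun i : 'I_k.+1 => if (a <= i < b)%N then f i.+1 - f i else 0)); last first.
  move=> i _; rewrite mxE; case: ifP => [/andP[_ ib]|_]; last by rewrite mul0r.
  by rewrite mul1r mxE (leq_trans ib) //  !mxE.
rewrite -(big_mkord predT (fun i => if (a <= i < b)%N then f i.+1 - f i else 0)).
rewrite -big_mkcond /= (big_cat_nat (n := b)) //=; last by rewrite ltnW.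
rewrite [X in _ + X]big1_seq ?addr0; last first.
  by move=> i /andP[/andP[_ ib]]; rewrite mem_index_iota leqNgt ib.
rewrite (big_cat_nat (n := a)) //=; last by rewrite ltnW.
rewrite big1_seq ?add0r; last first.
  by move=> i /andP[/andP[ai _]]; rewrite mem_index_iota /= ltnNge ai.
rewrite big_nat_cond (eq_bigl (fun i => (a <= i < b)%N && true)); last by move=> i; rewrite andbb andbT.
by rewrite -big_nat_cond telescope_sumr ?(ltnW ab) // /f e subrr.
Qed.

(** A vector orthogonal to all rows is constant along [h], hence constant since [h] is onto, and the
    last row makes it 0. *)
Lemma stepmx_neq0 h : (forall a b, (a < b)%N -> (b <= k)%N -> h a <> h b) ->
  \det (stepmx h) <> 0.
Proof.
move=> hi /eqP; rewrite -det_tr => /det0P[v v0 e].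
have hj : injective (fun i : 'I_k.+1 => h i).
  move=> a b hab; apply: val_inj; case: (ltngtP a b) => // lt.
    by case: (hi _ _ lt); rewrite // -ltnS.
  by case: (hi _ _ lt); rewrite // -ltnS.
have step i : (i < k)%N -> v 0 (h i.+1) = v 0 (h i).
  move=> ik; have ik' : (i < k.+1)%N by rewrite ltnW // ltnS.
  move/rowP: e => /(_ (Ordinal ik')); rewrite !mxE.
  rewrite (eq_bigr (fun j => v 0 j * (unit_row (h i.+1) 0 j) - v 0 j * unit_row (h i) 0 j)); last first.
    by move=> j _; rewrite !mxE ik -mulrBr.
  have ee a : \sum_j v 0 j * unit_row a 0 j = v 0 a.
    rewrite (bigD1 a) //= big1 ?addr0; first by rewrite unit_rowE eqxx mulr1.
    by move=> j ja; rewrite unit_rowE (negPf ja) mulr0.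
  by rewrite sumrB !ee => /eqP; rewrite subr_eq0 => /eqP.
have const i : (i <= k)%N -> v 0 (h i) = v 0 (h 0%N).
  by elim: i => // i IH ik; rewrite step // IH // ltnW.
have z : v 0 ord0 = 0.
  move/rowP: e => /(_ ord_max); rewrite !mxE (bigD1 ord0) //= big1 ?addr0.
    by rewrite !mxE ltnn unit_rowE eqxx mulr1.
  by move=> j j0; rewrite !mxE ltnn unit_rowE (negPf j0) mulr0.
move/eqP: v0; apply; apply/rowP => j; rewrite mxE.
have all_h a : v 0 a = v 0 (h 0%N).
  have /codomP [i ->] : a \in codom (fun i : 'I_k.+1 => h i).
    by apply: inj_card_onto.
  by rewrite const // -ltnS.
by rewrite all_h -(all_h ord0) z.
Qed.

Lemma lcochain_const (h : nat -> 'I_k.+1) ls :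
  (forall l j, (l <= D)%N -> nth lab0 ls l j = h l) ->
  lcochain ls = \prod_(r < m) \det (stepmx (fun i => h (r * k + i)%N)).
Proof.
move=> e; apply: eq_bigr => r _; congr (\det _); apply/matrixP => i j; rewrite !mxE.
case: ltnP => // ik; rewrite !e ?addnS //.
  exact: ltnW (lblock_idx _ _).
exact: lblock_idx.
Qed.

End LabelCocycle.

End LabelCocycle.

(** * The chain of flags of a product of Coxeter fans, and its boundary *)

Module Flags.

Import all_boot all_algebra all_fingroup zify.
Import Cochains LabelCocycle.
Set Implicit Arguments. Unset Strict Implicit.
Import GRing.Theory.
Local Open Scope group_scope.
Local Open Scope nat_scope.

Section Flags.
Variables (k m' : nat).
Local Notation m := m'.+1.
Local Notation D := (m * k).
Local Notation pt := 'I_k.+1.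
Local Notation sigT := {ffun 'I_m -> 'S_k.+1}.
Implicit Types (s : sigT) (A : {set 'I_D}) (a b : pt) (rho : 'S_D) (t : 'S_k.+1).

Definition famperm s r : 'S_k.+1 := s (inord r).
Definition frank s r a : nat := (famperm s r)^-1 a.
(* The ray [j = r * k + i] is the indicator, in coordinate [r], of the complement of the set of
   the [i + 1] points that come first in the [r]-th permutation. A vertex is indexed by the set
   of rays spanning its cone; its last coordinate ranks the points that these rays leave
   together. That coordinate makes the points distinct, and it is equivariant under every
   permutation that is monotone on the unseparated classes. *)
Definition below s (j : nat) a := frank s (j %/ k) a <= j %% k.
Definition unsep s A a b := [forall j in A, below s j a == below s j b].
Definition vcoord s A a (i : nat) : nat :=
  if i < m then #|[set j in A | (j %/ k == i) && ~~ below s j a]|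
  else #|[set b : pt | (b < a) && unsep s A a b]|.
Definition raysleft rho l : {set 'I_D} := [set j : 'I_D | l <= rho^-1 j].

Definition relabel t s : sigT := [ffun r => (s r * t)%g].

Lemma frank_relabel t s r a : frank (relabel t s) r (t a) = frank s r a.
Proof. by rewrite /frank /famperm ffunE invMg permM permK. Qed.

Lemma below_relabel t s j a : below (relabel t s) j (t a) = below s j a.
Proof. by rewrite /below frank_relabel. Qed.

Lemma unsep_relabel t s A a b : unsep (relabel t s) A (t a) (t b) = unsep s A a b.
Proof. by apply: eq_forallb => j; rewrite !below_relabel. Qed.

Definition monotone_on t (S : {set pt}) :=
  forall a b, (a \in S) = (b \in S) -> a < b -> t a < t b.

Lemma monotone_on_lt t S a b : monotone_on t S -> (a \in S) = (b \in S) -> (t a < t b) = (a < b).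
Proof.
move=> mt e; case: (ltngtP a b) => h; first by rewrite mt.
  by have := mt b a (esym e) h; lia.
by rewrite (val_inj h) ltnn.
Qed.

Lemma vcoord_relabel t s A (j : 'I_D) a i : j \in A -> monotone_on t [set a | below s j a] ->
  vcoord (relabel t s) A (t a) i = vcoord s A a i.
Proof.
move=> jA mt; rewrite /vcoord; case: ifP => _.
  by congr #|pred_of_set _|; apply/setP => u; rewrite !inE below_relabel.
rewrite -[RHS](card_imset _ (@perm_inj _ t)).
congr #|pred_of_set _|; apply/setP => b; rewrite -[b](permKV t) !inE.
rewrite mem_imset ?inE; last exact: perm_inj.
rewrite unsep_relabel; case sab: (unsep s A a _); rewrite ?andbF // !andbT.
move/forallP: sab => /(_ j); rewrite jA /= => /eqP e.
by rewrite (monotone_on_lt mt) // !inE e.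
Qed.

Lemma exists_shuffle (S : {set pt}) :
  exists2 t, monotone_on t S & forall a, (t a < #|S|) = (a \in S).
Proof.
pose f a := if a \in S then #|[set b in S | b < a]| else #|S| + #|[set b in ~: S | b < a]|.
have up (U : {set pt}) a b : a \in U -> a < b -> #|[set c in U | c < a]| < #|[set c in U | c < b]|.
  move=> aU ab; apply: proper_card; apply/properP; split.
    by apply/subsetP => c; rewrite !inE => /andP[-> /ltn_trans]; apply.
  by exists a; rewrite !inE aU ?ab // ltnn.
have le (U : {set pt}) a : a \in U -> #|[set c in U | c < a]| < #|U|.
  move=> aU; apply: proper_card; apply/properP; split.
    by apply/subsetP => c; rewrite !inE => /andP[].
  by exists a; rewrite // !inE aU ltnn.
have fS a : (f a < #|S|) = (a \in S).
  by rewrite /f; case: ifP => aS; [apply: le|rewrite ltnNge leq_addr].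
have fm a b : (a \in S) = (b \in S) -> a < b -> f a < f b.
  rewrite /f => <- ab; case: ifP => aS; first exact: up.
  by rewrite ltn_add2l up // inE aS.
have fk a : f a < k.+1.
  have cS := cardsC S; rewrite card_ord in cS.
  rewrite /f; case: ifP => aS; first by have := le S a aS; lia.
  by have := le (~: S) a; rewrite inE aS => /(_ isT); lia.
have fi : injective (fun a => Ordinal (fk a)).
  move=> a b [e]; apply: val_inj.
  have eS : (a \in S) = (b \in S) by rewrite -!fS e.
  case: (ltngtP a b) => // h; first by have := fm a b eS h; lia.
  by have := fm b a (esym eS) h; lia.
exists (perm fi) => [a b eS ab|a]; rewrite !permE /=; first exact: fm.
exact: fS.
Qed.

(** Stage i + 1 is the only one that tells which of the two rays goes first. *)
Lemma raysleft_tperm rho (i l : nat) (h1 : i.+1 < D) (h0 : i < D) : l != i.+1 ->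
  raysleft (tperm (Ordinal h0) (Ordinal h1) * rho)%g l = raysleft rho l.
Proof.
move=> li; apply/setP => j; rewrite !inE invMg tpermV permM.
case: tpermP => [->|->|//] /=; lia.
Qed.

(** Exchanging the points of ranks i and i + 1 changes a single initial segment of the permutation,
    the one of i + 1 points, which defines the ray [j0]. *)
Lemma below_tperm s (j0 j : 'I_D) : j != j0 ->
  let t := tperm (inord (j0 %% k) : pt) (inord (j0 %% k).+1) in
  let s' : sigT := [ffun r => if r == inord (j0 %/ k) then (t * s r)%g else s r] in
  forall a, below s' j a = below s j a.
Proof.
move=> jj t s' a; rewrite /below /frank /famperm ffunE.
have k0 : 0 < k by case: (k) (j) => // -[?]; rewrite muln0.
have lm (u : 'I_D) : u %/ k < m by rewrite ltn_divLR.
case: eqP => // e.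
have e' : j %/ k = j0 %/ k by move/(congr1 (@nat_of_ord _)): e; rewrite !inordK.
have ne : j %% k != j0 %% k.
  apply: contra_neq jj => h; apply: val_inj.
  by rewrite /= (divn_eq j k) (divn_eq j0 k) e' h.
rewrite invMg tpermV permM; set b := _ a.
have j0k : j0 %% k < k by rewrite ltn_mod.
have jk : j %% k < k by rewrite ltn_mod.
rewrite /t; case: tpermP => [->|->|//]; rewrite !inordK; lia.
Qed.

Lemma vcoord_ext s s' A a i : (forall (j : 'I_D) a, j \in A -> below s' j a = below s j a) ->
  vcoord s' A a i = vcoord s A a i.
Proof.
move=> e; rewrite /vcoord; case: ifP => _; congr #|pred_of_set _|; apply/setP => u; rewrite !inE.
  by case uA: (u \in A) => //=; rewrite e.
congr (_ && _); apply: eq_forallb => j.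
by case jA: (j \in A) => //=; rewrite !e.
Qed.

Section Cycle.
Variables (F : fieldType) (V : Type) (X : sigT -> {set 'I_D} -> V).
Hypothesis X_ext : forall s s' A,
  (forall (j : 'I_D) a, j \in A -> below s' j a = below s j a) -> X s' A = X s A.
Variable aV : 'S_k.+1 -> V -> V.
Hypothesis X_relabel : forall t s A (j : 'I_D), j \in A -> monotone_on t [set a | below s j a] ->
  X (relabel t s) A = aV t (X s A).

Local Open Scope ring_scope.
Definition famsign s : F := \prod_r (-1) ^+ (odd_perm (s r)).
Definition flag s rho := [seq X s (raysleft rho l) | l <- iota 0 D.+1].
Definition flagcycle : seq (F * seq V) :=
  [seq (famsign u.1 * (-1) ^+ (odd_perm u.2), flag u.1 u.2) | u : sigT * 'S_D <- enum {: (sigT * 'S_D)%type}].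

Lemma ceval_flagcycle c : ceval flagcycle c = \sum_s \sum_(rho : 'S_D) famsign s * (-1) ^+ (odd_perm rho) * c (flag s rho).
Proof.
rewrite /ceval big_map big_enum /= pair_bigA /=.
by apply: eq_bigr => -[s rho].
Qed.

Lemma sum_rho_odd i (G : 'S_D -> F) (h0 : (i < D)%N) (h1 : (i.+1 < D)%N) :
  (forall rho, G (tperm (Ordinal h0) (Ordinal h1) * rho)%g = G rho) ->
  \sum_(rho : 'S_D) (-1) ^+ (odd_perm rho) * G rho = 0.
Proof.
move=> e; rewrite (bigID (fun rho : 'S_D => odd_perm rho)) /=.
rewrite [X in X + _](reindex_inj (mulgI (tperm (Ordinal h0) (Ordinal h1)))) /=.
have ne : Ordinal h0 != Ordinal h1 by apply/eqP => /(congr1 val) /=; lia.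
rewrite [X in X + _](eq_bigl (fun rho : 'S_D => ~~ odd_perm rho)); last first.
  by move=> rho; rewrite odd_permM odd_tperm ne.
rewrite -big_split big1 //= => rho nr.
by rewrite e odd_permM odd_tperm ne (negPf nr) /= expr1 expr0 mulN1r mul1r addNr.
Qed.

Definition swapat (r0 : 'I_m) t s : sigT := [ffun r => if r == r0 then (t * s r)%g else s r].

Lemma sum_s_odd (r0 : 'I_m) (a b : pt) (G : sigT -> F) : a != b ->
  (forall s, G (swapat r0 (tperm a b) s) = G s) -> \sum_s famsign s * G s = 0.
Proof.
move=> ab e; rewrite (bigID (fun s : sigT => odd_perm (s r0))) /=.
have inj : injective (swapat r0 (tperm a b)).
  move=> s s' /ffunP h; apply/ffunP => r; have := h r; rewrite !ffunE.
  by case: eqP => // _ /mulgI.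
rewrite [X in X + _](reindex_inj inj) /=.
rewrite [X in X + _](eq_bigl (fun s : sigT => ~~ odd_perm (s r0))); last first.
  by move=> s; rewrite ffunE eqxx odd_permM odd_tperm ab.
rewrite -big_split big1 //= => s nr.
rewrite e -mulrDl /famsign !(bigD1 r0 (P := predT)) //= ffunE eqxx odd_permM odd_tperm ab (negPf nr).
rewrite (eq_bigr (fun r => (-1) ^+ (odd_perm (s r)))); last first.
  by move=> r rr0; rewrite ffunE (negPf rr0).
by rewrite expr1 expr0 -mulrDl addNr !mul0r.
Qed.

Lemma famsign_relabel t s : famsign (relabel t s) = lsign F m (fun=> t) * famsign s.
Proof.
rewrite /famsign /lsign -big_split; apply: eq_bigr => r _.
by rewrite ffunE odd_permM /= signr_addb mulrC.
Qed.

Lemma lsign_sqr t : lsign F m (fun=> t) * lsign F m (fun=> t) = 1.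
Proof.
rewrite /lsign -big_split big1 // => r _ /=.
by rewrite -signr_addb addbb.
Qed.

Lemma card_below s (j : 'I_D) : #|[set a | below s j a]| = (j %% k).+1.
Proof.
have k0 : (0 < k)%N by case: (k) (j) => // -[?]; rewrite muln0.
have jk : (j %% k < k.+1)%N by rewrite ltnS ltnW // ltn_mod.
set t := famperm s (j %/ k).
have -> : [set a | below s j a] = t @: [set a : pt | (a < (j %% k).+1)%N].
  apply/setP => a; rewrite !inE -[a in RHS](permKV t) mem_imset ?inE ?ltnS //.
  exact: perm_inj.
rewrite card_imset; last exact: perm_inj.
by rewrite -sum1dep_card (big_ord_narrow jk) sum1_card card_ord.
Qed.

Hypothesis bin0 : forall i, (0 < i < k.+1)%N -> ('C(k.+1, i))%:R = 0 :> F.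

(* Interior faces cancel in pairs. A face opposite to the apex has a last ray, separating some
   [S] from its complement, and the shuffle sorting [S] first identifies it with a face that only
   depends on the cardinal of [S]: binomial coefficients appear. *)
Lemma ceval_flagcycle_cobd c : (0 < k)%N ->
  (forall t s rho l, l = [seq X s (raysleft rho i) | i <- iota 0 D] ->
     c (map (aV t) l) = lsign F m (fun=> t) * c l) ->
  ceval flagcycle (cobd c) = 0.
Proof.
move=> k0 ec.
have D0 : (0 < D)%N by rewrite muln_gt0.
rewrite ceval_flagcycle.
under eq_bigr => s _ do under eq_bigr => rho _ do rewrite cobd_sum size_map size_iota big_distrr /=.
under eq_bigr => s _ do rewrite exchange_big /=.
rewrite exchange_big big1 //= => -[i iD] _ /=.
under eq_bigr => s _ do under eq_bigr => rho _ do rewrite del_map_iota //.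
rewrite ltnS in iD.
have [i0|ip] := posnP i.
  rewrite i0 exchange_big big1 //= => rho _.
  (* Without the vertex of the full cone, the flag lies in the wall opposite to the ray [j0] that is
     removed first; the cone on the other side of this wall has the same face with the opposite
     sign. *)
  pose j0 := rho (Ordinal D0).
  pose G s := (-1) ^+ (odd_perm rho) * ((-1) ^+ 0 * c [seq X s (raysleft rho l) | l <- iota 1 (D - 0)]).
  rewrite (eq_bigr (fun s => famsign s * G s)); last by move=> s _; rewrite -mulrA.
  have j0k : (j0 %% k < k)%N by rewrite ltn_mod.
  apply: (@sum_s_odd (inord (j0 %/ k)) (inord (j0 %% k)) (inord (j0 %% k).+1)).
    by apply/eqP => /(congr1 val); rewrite /= !inordK; lia.
  move=> s; rewrite /G; congr (_ * (_ * c _)); apply/eq_in_map => l.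
  rewrite mem_iota => /andP[l1 _]; apply: X_ext => j a; rewrite inE => lj.
  apply: (@below_tperm s j0 j); apply/eqP => e.
  by move: lj; rewrite e permK /= leqNgt l1.
move: iD; rewrite leq_eqVlt => /predU1P[iD|iD]; last first.
  rewrite big1 //= => s _.
  pose G rho := famsign s * ((-1) ^+ i * c [seq X s (raysleft rho l) | l <- iota 0 i ++ iota i.+1 (D - i)]).
  rewrite (eq_bigr (fun rho : 'S_D => (-1) ^+ (odd_perm rho) * G rho)); last first.
    by move=> rho _; rewrite /G [famsign s * _]mulrC -mulrA.
  have h0 : (i.-1 < D)%N by lia.
  have h1 : (i.-1.+1 < D)%N by lia.
  apply: (@sum_rho_odd i.-1 G h0 h1) => rho; rewrite /G; congr (_ * (_ * c _)).
  apply/eq_in_map => l; rewrite mem_cat !mem_iota => hl.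
  by rewrite raysleft_tperm //; apply/eqP; lia.
rewrite iD subnn /= cats0 exchange_big big1 //= => rho _.
have hD : (D.-1 < D)%N by lia.
(* The ray removed last belongs to the set of rays of every vertex of this face, so one shuffle
   relabels all of them. *)
pose jl := rho (Ordinal hD).
pose L s := [seq X s (raysleft rho l) | l <- iota 0 D].
rewrite (eq_bigr (fun s => (-1) ^+ (odd_perm rho) * (-1) ^+ D * (famsign s * c (L s)))); last first.
  by move=> s _; rewrite /L [famsign s * _]mulrC -!mulrA; congr (_ * _); rewrite mulrCA.
rewrite -big_distrr /= [X in _ * X](_ : _ = 0) ?mulr0 //.
pose i1 := (jl %% k).+1.
have i1k : (0 < i1 < k.+1)%N by rewrite /i1 /= ltnS ltn_mod.
have Lmul t s : monotone_on t [set a | below s jl a] -> L (relabel t s) = map (aV t) (L s).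
  move=> mt; rewrite /L -map_comp; apply/eq_in_map => l; rewrite mem_iota /= add0n => lD.
  by apply: X_relabel mt; rewrite inE permK /=; lia.
pose S0 : {set pt} := [set a : pt | (a < i1)%N].
pose K := \sum_(s | [set a | below s jl a] == S0) famsign s * c (L s).
rewrite (partition_big (fun s => [set a | below s jl a]) (fun S => #|S| == i1)) /=; last first.
  by move=> s _; rewrite card_below.
rewrite (eq_bigr (fun=> K)); last first.
  move=> S /eqP cS; have [t mt tS] := exists_shuffle S.
  have linj : injective (relabel t).
    by move=> s s' /ffunP h; apply/ffunP => r; have := h r; rewrite !ffunE => /mulIg.
  rewrite /K [RHS](reindex_inj linj) /=.
  have eqS s : ([set a | below (relabel t s) jl a] == S0) = ([set a | below s jl a] == S).
    apply/eqP/eqP => /setP h; apply/setP => a.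
      by have := h (t a); rewrite !inE below_relabel -cS tS.
    have := h ((t^-1)%g a); rewrite !inE -(below_relabel t) permKV => ->.
    by rewrite -tS permKV cS.
  rewrite [RHS](eq_bigl _ _ eqS); apply: eq_bigr => s /eqP sS.
  rewrite Lmul ?sS // (ec t s rho) // famsign_relabel.
  by rewrite mulrACA lsign_sqr mul1r.
rewrite sumr_const -[#|_|]/#|[pred S : {set pt} | #|S| == i1]|.
have -> : #|[pred S : {set pt} | #|S| == i1]| = 'C(k.+1, i1).
  rewrite -[in RHS](card_ord k.+1) -card_draws -[RHS]cardsE.
  by apply: eq_card => S; rewrite !inE.
by rewrite -mulr_natr bin0 // mulr0.
Qed.

End Cycle.
End Flags.

End Flags.

(** * Evaluation of the label cocycle on the chain of flags *)

Module FlagEvaluation.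

Import all_boot all_algebra all_fingroup zify.
Import LabelCocycle Flags.
Set Implicit Arguments. Unset Strict Implicit.
Import GRing.Theory.
Local Open Scope nat_scope.

Section Evaluation.
Variables (k m' : nat).
Local Notation m := m'.+1.
Local Notation D := (m * k).
Local Notation pt := 'I_k.+1.
Local Notation sigT := {ffun 'I_m -> 'S_k.+1}.
Implicit Types (s : sigT) (A : {set 'I_D}) (a b : pt) (rho : 'S_D).
Hypothesis k0 : 0 < k.

Definition lexltn s A a b := exists2 i, i <= m &
  vcoord s A a i < vcoord s A b i /\ forall i', i' < i -> vcoord s A a i' = vcoord s A b i'.

Lemma lexltn_asym s A a b : lexltn s A a b -> lexltn s A b a -> False.
Proof.
move=> [i _ [l1 e1]] [i' _ [l2 e2]]; case: (ltngtP i i') => h.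
- by have := e2 _ h; lia.
- by have := e1 _ h; lia.
- by move: l2; rewrite -h; lia.
Qed.

Lemma vcoord_eq0 s A a i : i < m -> (forall j : 'I_D, j \in A -> j %/ k = i -> below s j a) -> vcoord s A a i = 0.
Proof.
move=> im h; rewrite /vcoord im; apply: eq_card0 => j; rewrite !inE.
by apply/negP => /and3P[jA /eqP ji]; rewrite h.
Qed.

Lemma vcoord_gt0 s A a (j : 'I_D) : j \in A -> ~~ below s j a -> 0 < vcoord s A a (j %/ k).
Proof.
move=> jA nT; rewrite /vcoord ltn_divLR // ltn_ord.
by apply/card_gt0P; exists j; rewrite !inE jA eqxx nT.
Qed.

Definition raysfrom l : {set 'I_D} := [set j : 'I_D | l <= j].

Lemma raysleft1 l : raysleft 1%g l = raysfrom l.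
Proof. by apply/setP => j; rewrite !inE invg1 perm1. Qed.

Section From.
Variables (s : sigT) (r i : nat).
Hypotheses (rm : r < m) (ik : i <= k).
Let A := raysfrom (r * k + i).

Lemma from_divn (j : 'I_D) : j \in A -> r <= j %/ k.
Proof. by rewrite inE => h; rewrite leq_divRL //; lia. Qed.

Lemma from_mod (j : 'I_D) : j \in A -> j %/ k = r -> i <= j %% k.
Proof. by rewrite inE => h e; have := divn_eq j k; rewrite e; lia. Qed.

Lemma vcoord_from_lt a i' : i' < r -> vcoord s A a i' = 0.
Proof.
move=> h; apply: vcoord_eq0 => [|j jA e]; first lia.
by have := from_divn jA; lia.
Qed.

Lemma vcoord_from_eq a : frank s r a <= i -> vcoord s A a r = 0.
Proof.
move=> h; apply: vcoord_eq0 => // j jA e; rewrite /below e.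
by apply: leq_trans h _; apply: from_mod.
Qed.

Lemma vcoord_from_gt a : i < frank s r a -> 0 < vcoord s A a r.
Proof.
move=> h; have pk : frank s r a < k.+1 by apply: ltn_ord.
have ik' : i < k by lia.
have jD : r * k + i < D by apply: lblock_idx.
have e : (r * k + i) %/ k = r by rewrite divnMDl // divn_small ?addn0.
have := @vcoord_gt0 s A a (Ordinal jD); rewrite /= e; apply.
  by rewrite inE /=.
by rewrite /below /= e modnMDl modn_small // -ltnNge.
Qed.

(** No ray of coordinate r + 1 has been removed yet, and the initial segments missing [a] are
    exactly the first [frank s r.+1 a] ones. *)
Lemma vcoord_from_next a : r.+1 < m -> vcoord s A a r.+1 = frank s r.+1 a.
Proof.
move=> r1; rewrite /vcoord r1.
have pk : frank s r.+1 a <= k by rewrite -ltnS; apply: ltn_ord.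
have im (x : 'I_k) : r.+1 * k + x < D by apply: lblock_idx.
pose f (x : 'I_k) : 'I_D := Ordinal (im x).
have fi : injective f by move=> x y [/addnI] /val_inj.
rewrite (_ : [set j in A | _] = f @: [set x : 'I_k | x < frank s r.+1 a]).
  by rewrite card_imset // -sum1dep_card (big_ord_narrow pk) sum1_card card_ord.
apply/setP => j; rewrite !inE; apply/idP/imsetP.
  move=> /and3P[_ /eqP e nT]; exists (Ordinal (ltn_pmod j k0)).
    by rewrite inE /=; move: nT; rewrite /below e -ltnNge.
  by apply: val_inj; rewrite /= {1}(divn_eq j k) e.
move=> [x]; rewrite inE => xp ->; rewrite /f /=.
have e : (r.+1 * k + x) %/ k = r.+1 by rewrite divnMDl // divn_small ?addn0.
rewrite e eqxx /= /below /= e modnMDl modn_small // -ltnNge xp andbT.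
by rewrite mulSn; lia.
Qed.

Lemma unsep_from a b : r.+1 = m -> frank s r a <= i -> frank s r b <= i -> unsep s A a b.
Proof.
move=> rm1 pa pb; apply/forallP => j; apply/implyP => jA; apply/eqP.
have e : j %/ k = r.
  have := from_divn jA; have : j %/ k < m by rewrite ltn_divLR.
  by lia.
have := from_mod jA e => h.
by rewrite /below e (leq_trans pa h) (leq_trans pb h).
Qed.

Lemma unsep_trans B a b c : unsep s B a b -> unsep s B a c = unsep s B b c.
Proof.
move=> /forallP h; apply: eq_forallb => j; case jB : (j \in B) => //=.
by have := h j; rewrite jB => /eqP ->.
Qed.

Lemma unsep_sym B a b : unsep s B a b = unsep s B b a.
Proof. by apply: eq_forallb => j; rewrite eq_sym. Qed.

Lemma vcoord_unsep_lt B a b : unsep s B a b -> a < b -> vcoord s B a m < vcoord s B b m.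
Proof.
move=> sab ab; rewrite /vcoord ltnn; apply: proper_card; apply/properP; split.
  apply/subsetP => c; rewrite !inE (unsep_trans _ sab) => /andP[ca ->].
  by rewrite (ltn_trans ca ab).
exists a; rewrite !inE ?ab ?ltnn //= -(unsep_trans _ sab).
by apply/forallP => j; rewrite eqxx implybT.
Qed.

(** After the last permutation comes the natural order of the points, which the last coordinate of
    [vcoord] ranks. *)
Definition nextrank r a : nat := if r < m then frank s r a else a.

Lemma vcoord_from_cmp a b : frank s r a <= i -> frank s r b <= i ->
  (lexltn s A a b <-> nextrank r.+1 a < nextrank r.+1 b).
Proof.
move=> pa pb; rewrite /nextrank.
have low i' : i' <= r -> vcoord s A a i' = vcoord s A b i'.
  rewrite leq_eqVlt => /predU1P[->|h]; first by rewrite !vcoord_from_eq.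
  by rewrite !vcoord_from_lt.
case: ifP => r1.
  have inj : frank s r.+1 a = frank s r.+1 b -> a = b by move=> /val_inj /perm_inj.
  split.
    move=> [i1 _ [lt e]]; case: (ltngtP i1 r.+1) => h.
    - by have := low i1; lia.
    - have := e _ h; rewrite !vcoord_from_next // => /inj ab.
      by move: lt; rewrite ab ltnn.
    - by move: lt; rewrite h !vcoord_from_next.
  move=> h; exists r.+1; first exact: ltnW.
  by split=> [|i' h']; [rewrite !vcoord_from_next|apply: low].
have rm1 : r.+1 = m by lia.
have sab := unsep_from rm1 pa pb.
split.
  move=> [i1 i1m [lt e]]; have : i1 = m by case: (ltngtP i1 m) i1m => // h _; have := low i1; lia.
  move=> i1E; rewrite i1E in lt; case: (ltngtP a b) => // h.
    by have := @vcoord_unsep_lt A b a; rewrite unsep_sym => /(_ sab h); lia.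
  by rewrite (val_inj h) ltnn in lt.
move=> ab; exists m => //; split; first exact: vcoord_unsep_lt.
by move=> i' h; apply: low; lia.
Qed.
End From.

Variable h : sigT -> {set 'I_D} -> pt.
Hypothesis hP : forall s A b, b != h s A -> lexltn s A (h s A) b.

(** Otherwise the point of rank 0 in the permutation of [j], all of whose coordinates up to that one
    vanish, would be lexicographically smaller. *)
Lemma h_below s A (j : 'I_D) : j \in A -> (forall j' : 'I_D, j' \in A -> j %/ k <= j' %/ k) ->
  below s j (h s A).
Proof.
move=> jA mn; apply/negPn/negP => nT.
set r := j %/ k in mn *; set b := famperm s r ord0.
have rm : r < m by rewrite ltn_divLR.
have pb : frank s r b = 0 by rewrite /frank permK.
have bh : b != h s A by apply: contraNneq nT => <-; rewrite /below -/r pb.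
have [i im [lt e]] := hP bh.
case: (ltngtP i r) => ir.
- have : vcoord s A b i = 0; last lia.
  by apply: vcoord_eq0 => [|j' j'A e']; [lia | have := mn _ j'A; lia].
- have := e _ ir; rewrite [RHS]vcoord_eq0 //; last by move=> j' _ e'; rewrite /below e' pb.
  by have := vcoord_gt0 jA nT; rewrite -/r; lia.
- have : vcoord s A b r = 0; last by rewrite ir in lt; lia.
  by apply: vcoord_eq0 => // j' _ e'; rewrite /below e' pb.
Qed.

Variable F : fieldType.
Definition flag_labels s rho : seq (nat -> pt) :=
  [seq (fun=> h s (raysleft rho l)) | l <- iota 0 D.+1].

Lemma lcochain_flag_labels s rho : lcochain F m (flag_labels s rho) =
  (\prod_(r < m) \det (stepmx F (fun i => h s (raysleft rho (r * k + i)))))%R.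
Proof.
apply: (@lcochain_const F k m (fun l => h s (raysleft rho l))) => l j lD.
by rewrite (nth_map 0) ?size_iota // nth_iota.
Qed.

(* A flag contributes only if each block shows all labels: this forces the rays to be removed in
   their natural order and each permutation to be the reverse of the next one, so that a single
   flag survives. *)
Section Nonzero.
Variables (s : sigT) (rho : 'S_D).
Hypothesis nz : lcochain F m (flag_labels s rho) <> 0%R.
Let H l := h s (raysleft rho l).

Lemma H_inj r (a b : nat) : r < m -> a < b -> b <= k -> H (r * k + a) <> H (r * k + b).
Proof.
move=> rm ab bk; apply: (@stepmx_inj F k (fun i => H (r * k + i))) => // e.
apply: nz; rewrite lcochain_flag_labels; apply/eqP/prodf_eq0.
by exists (Ordinal rm) => //; apply/eqP.
Qed.

Lemma rho_id_prefix l : (forall j : 'I_D, j < l -> rho j = j) ->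
  forall l', l' <= l -> raysleft rho l' = raysfrom l'.
Proof.
move=> fx l' l'l; apply/setP => j; rewrite !inE.
have e : rho (rho^-1%g j) = j by rewrite permKV.
case: (ltnP j l) => jl.
  by rewrite -{1}(fx j jl) permK.
have : l <= rho^-1%g j; last lia.
by rewrite leqNgt; apply/negP => h'; have := fx _ h'; rewrite e => ej; move: h'; rewrite -ej; lia.
Qed.

Lemma rho_id : rho = 1%g.
Proof.
apply/permP => j; rewrite perm1.
have [l] := ubnP (j : nat); elim: l j => // l IH j; rewrite ltnS leq_eqVlt => /predU1P[jl|]; last exact: IH.
apply/eqP/negPn/negP => ne.
have pre := @rho_id_prefix l IH.
have jD := ltn_ord j.
set r := j %/ k; set i := j %% k.
have jE : (j : nat) = r * k + i by rewrite -divn_eq.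
have rm : r < m by rewrite ltn_divLR.
have ik : i < k by rewrite ltn_mod.
have j1 : j \in raysleft rho (r * k + i.+1).
  rewrite inE addnS -jE.
  have : j \in raysleft rho j by rewrite pre; [rewrite inE | rewrite jl].
  rewrite inE leq_eqVlt => /predU1P[e|//].
  have {}e : j = rho^-1%g j by apply: val_inj.
  by case/eqP: ne; rewrite {1}e permKV.
have sub (j' : 'I_D) : j' \in raysleft rho (r * k + i.+1) -> r <= j' %/ k.
  rewrite inE => h'; have : j' \in raysleft rho l by rewrite inE; lia.
  rewrite pre // inE => h2; rewrite leq_divRL //; lia.
(* If [j] is not removed in its turn, it still bounds the next label: the labels of i + 2
   consecutive stages have only i + 1 possible ranks, although they are distinct. *)
have bnd x : x < i.+2 -> frank s r (H (r * k + x)) < i.+1.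
  rewrite ltnS leq_eqVlt => /predU1P[->|xi].
    by have := @h_below s _ j j1 sub; rewrite /below -/r -/i ltnS.
  have xD : r * k + x < D by apply: lblock_idx => //; lia.
  have xk : x < k by lia.
  have e : (r * k + x) %/ k = r by rewrite divnMDl // divn_small // addn0.
  have := @h_below s (raysleft rho (r * k + x)) (Ordinal xD).
  rewrite pre; last lia.
  rewrite inE /below /= e modnMDl modn_small; last lia.
  rewrite /H pre; last lia.
  move=> h'; rewrite ltnS; apply: (@leq_trans x); last lia.
  by apply: h' => [//|j' j'A]; apply: (from_divn rm (ltnW xk) j'A).
pose f (x : 'I_i.+2) : 'I_i.+1 := Ordinal (bnd x (ltn_ord x)).
have fi : injective f.
  move=> x y [/val_inj/perm_inj e]; apply: val_inj.
  have [xi yi] := (ltn_ord x, ltn_ord y).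
  case: (ltngtP x y) => // xy; first by case: (@H_inj r x y rm xy _ e); lia.
  by case: (@H_inj r y x rm xy _ (esym e)); lia.
by have := leq_card f fi; rewrite !card_ord ltnn.
Qed.

Lemma H_famperm r i : r < m -> i <= k -> H (r * k + i) = famperm s r (inord i).
Proof.
move=> rm ik.
have sm x : x <= k -> frank s r (H (r * k + x)) <= x.
  rewrite leq_eqVlt => /predU1P[->|xk]; first by rewrite -ltnS; apply: ltn_ord.
  have xD : r * k + x < D by apply: lblock_idx.
  have e : (r * k + x) %/ k = r by rewrite divnMDl // divn_small ?addn0.
  have := @h_below s (raysfrom (r * k + x)) (Ordinal xD).
  rewrite inE /below /= e modnMDl modn_small //.
  rewrite /H rho_id raysleft1; apply=> // j' j'A; exact: (from_divn rm (ltnW xk) j'A).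
have : frank s r (H (r * k + i)) = i.
  have [l] := ubnP i; elim: l i ik => // l IH x xk; rewrite ltnS => xl.
  have := sm x xk; rewrite leq_eqVlt => /predU1P[//|lt].
  set y := frank s r (H (r * k + x)) in lt *.
  have := IH y _ _; move/(_ ltac:(lia) ltac:(lia)); rewrite {2}/y => /val_inj/perm_inj e.
  by have := @H_inj r y x rm lt xk.
move=> e; have -> : inord i = (famperm s r)^-1%g (H (r * k + i)).
  by apply: val_inj; rewrite /= inordK // -[RHS]/(frank _ _ _) e.
by rewrite permKV.
Qed.

(** The points of rank at most [i] tie in the coordinates up to [r], and the label of this stage is
    the point of rank [i]; being the lexicographic minimum, it precedes the others in the next
    order. *)
Lemma famperm_next r (i i' : pt) : r < m -> i' < i -> nextrank s r.+1 (famperm s r i) < nextrank s r.+1 (famperm s r i').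
Proof.
move=> rm ii.
have ik : i <= k by rewrite -ltnS.
have := @vcoord_from_cmp s r i rm ik (famperm s r i) (famperm s r i').
rewrite /frank !permK => /(_ (leqnn _) (ltnW ii)) <-.
have e := H_famperm rm ik; rewrite inord_val /H rho_id raysleft1 in e.
rewrite -{1}e; apply: hP; rewrite e.
by apply/eqP => /perm_inj e'; rewrite e' ltnn in ii.
Qed.
End Nonzero.

Definition revperm : 'S_k.+1 := perm (@rev_ord_inj k.+1).
(** The last permutation reverses the natural order and each other one reverses its successor, so
    that reversal and identity alternate. *)
Definition altfam : sigT := [ffun r : 'I_m => (revperm ^+ (m - r))%g].

Lemma famperm_altfam r : r < m -> famperm altfam r = (revperm ^+ (m - r))%g.
Proof. by move=> rm; rewrite /famperm ffunE inordK. Qed.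

Lemma decreasing_rev (g : pt -> nat) : (forall x, g x <= k) ->
  (forall i i' : pt, i' < i -> g i < g i') -> forall i : pt, g i = k - i.
Proof.
move=> gk dec i.
have up x : x <= k -> g (inord x) + x <= k.
  elim: x => [_|x IH xk]; first by rewrite addn0.
  have := dec (inord x.+1) (inord x); rewrite !inordK //; last exact: ltnW.
  by have := IH (ltnW xk); lia.
have dn x : x <= k -> x <= g (inord (k - x)).
  elim: x => [//|x IH xk].
  have l1 : k - x < k.+1 by lia.
  have l2 : k - x.+1 < k.+1 by lia.
  have := dec (inord (k - x)) (inord (k - x.+1)); rewrite !inordK //.
  by have := IH (ltnW xk); lia.
have ik : i <= k by rewrite -ltnS.
have := up i ik; have := dn (k - i) (leq_subr _ _); rewrite subKn // inord_val; lia.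
Qed.

Lemma s_is_altfam s rho : lcochain F m (flag_labels s rho) <> 0%R -> s = altfam.
Proof.
move=> nz; apply/ffunP => r.
suff H e : e < m -> famperm s (m - e.+1) = (revperm ^+ e.+1)%g.
  have rm := ltn_ord r; have := H (m - r.+1) ltac:(lia).
  have -> : m - (m - r.+1).+1 = r by lia.
  have -> : (m - r.+1).+1 = m - r by lia.
  by rewrite /famperm inord_val ffunE.
elim: e => [|e IH] em.
  apply/permP => i; rewrite expg1 permE; apply: val_inj => /=.
  have r1 : m - 1 < m by lia.
  have e1 : (m - 1).+1 = m by lia.
  rewrite (@decreasing_rev (fun i => famperm s (m - 1) i)) //.
    by move=> x; rewrite -ltnS.
  by move=> x y xy; have := famperm_next nz r1 xy; rewrite e1 /nextrank ltnn.
apply/permP => i; rewrite expgS permM permE.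
have r1 : m - e.+2 < m by lia.
have e1 : (m - e.+2).+1 = m - e.+1 by lia.
have e2 : m - e.+1 < m by lia.
have : frank s (m - e.+1) (famperm s (m - e.+2) i) = k - i.
  apply: (@decreasing_rev (fun i => frank s (m - e.+1) (famperm s (m - e.+2) i))).
    by move=> x; rewrite -ltnS; apply: ltn_ord.
  by move=> x y xy; have := famperm_next nz r1 xy; rewrite e1 /nextrank e2.
rewrite /frank IH ?(ltnW em) // => h'.
apply: (@perm_inj _ (revperm ^+ e.+1)^-1%g); rewrite permK; apply: val_inj; rewrite /= h'; lia.
Qed.

Lemma h_altfam r i : r < m -> i <= k -> h altfam (raysleft 1%g (r * k + i)) = famperm altfam r (inord i).
Proof.
move=> rm ik; rewrite raysleft1; set a := famperm _ _ _; apply/eqP/negPn/negP => ne.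
have := hP (s := altfam) (A := raysfrom (r * k + i)) (b := a); rewrite eq_sym => /(_ ne).
set b := h _ _ in ne *; move/lexltn_asym; apply.
set y := frank altfam r b.
have bE : b = famperm altfam r (inord y) by rewrite /y /frank inord_val permKV.
have pa : frank altfam r a = i by rewrite /frank permK inordK.
have yi : y != i by apply: contra_neq ne => yi; rewrite bE yi.
case: (ltngtP y i) yi => // yi _.
  apply/(vcoord_from_cmp rm ik); rewrite ?pa //; first exact: ltnW.
  have yk : y < k.+1 by apply: ltn_ord.
  have rpE (x : nat) : x <= k -> revperm (inord x) = inord (k - x) :> pt.
    by move=> xk; apply: val_inj; rewrite permE /= !inordK //; lia.
  rewrite /nextrank; case: ifP => r1.
    rewrite /frank famperm_altfam // bE /a famperm_altfam //.
    have -> : m - r = (m - r.+1).+1 by lia.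
    by rewrite expgS !permM !permK !rpE ?inordK //; lia.
  rewrite bE /a famperm_altfam //; have -> : m - r = 1 by lia.
  by rewrite expg1 !rpE ?inordK //; lia.
exists r; first exact: ltnW; split.
  by rewrite (vcoord_from_eq rm) ?pa //; apply: vcoord_from_gt.
by move=> i' h'; rewrite !(vcoord_from_lt _ rm).
Qed.

Lemma lcochain_altfam : lcochain F m (flag_labels altfam 1%g) <> 0%R.
Proof.
rewrite lcochain_flag_labels; apply/eqP/prodf_neq0 => r _; apply/eqP.
apply: stepmx_neq0 => a b ab bk.
have rm := ltn_ord r.
rewrite !h_altfam //; last lia.
by move=> /perm_inj /(congr1 (@nat_of_ord _)); rewrite !inordK; lia.
Qed.

Lemma sum_flag_labels_neq0 :
  (\sum_s \sum_(rho : 'S_D) famsign F s * (-1) ^+ (odd_perm rho) * lcochain F m (flag_labels s rho) <> 0)%R.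
Proof.
rewrite (bigD1 altfam) //= [X in (_ + X)%R]big1 ?addr0; last first.
  move=> s /eqP ns; apply: big1 => rho _.
  case: (lcochain F m (flag_labels s rho) =P 0%R) => [->|nz]; first by rewrite mulr0.
  by case: ns; apply: s_is_altfam nz.
rewrite (bigD1 1%g) //= [X in (_ + X)%R]big1 ?addr0; last first.
  move=> rho /eqP nr.
  case: (lcochain F m (flag_labels altfam rho) =P 0%R) => [->|nz]; first by rewrite mulr0.
  by case: nr; apply: rho_id nz.
apply/eqP; rewrite !mulf_neq0 ?signr_eq0 //; last by apply/eqP; apply: lcochain_altfam.
by apply/prodf_neq0 => r _; rewrite signr_eq0.
Qed.
End Evaluation.

End FlagEvaluation.

(** * Equivariant labels on points in real coordinates *)

Module PointLabels.

Import Reals Lra.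
Import List ClassicalEpsilon FunctionalExtensionality.
Import all_boot all_algebra all_fingroup.
Import Cochains Barycenters LabelCocycle Flags FlagEvaluation.
Set Implicit Arguments. Unset Strict Implicit.
Local Open Scope R_scope.

Section Configurations.
Variables (k m : nat).
Notation I := ('I_k.+1 * 'I_m.+1)%type.
Notation pnt := (I -> R).
Implicit Types (x y : pnt) (a b : 'I_k.+1) (t : 'S_k.+1).

Definition distinct x := forall a b, a <> b -> exists i, x (a, i) <> x (b, i).
Definition act_pt t x : pnt := fun u => x (t^-1%g u.1, u.2).

Definition lexlt x a b := exists i : 'I_m.+1, x (a, i) < x (b, i) /\
  forall i' : 'I_m.+1, (i' < i)%N -> x (a, i') = x (b, i').

Lemma lexlt_asym x a b : lexlt x a b -> ~ lexlt x b a.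
Proof.
move=> [i [l1 e1]] [i' [l2 e2]]; case: (ltngtP i i') => h.
- by have := e2 _ h; lra.
- by have := e1 _ h; lra.
- by rewrite -(val_inj h) in l2; lra.
Qed.

Lemma lexlt_trans x a b c : lexlt x a b -> lexlt x b c -> lexlt x a c.
Proof.
move=> [i [l1 e1]] [i' [l2 e2]]; case: (ltngtP i i') => h.
- exists i; split; first by rewrite -(e2 _ h).
  by move=> u ui; rewrite e1 // e2 // (ltn_trans ui).
- exists i'; split; first by rewrite (e1 _ h).
  by move=> u ui; rewrite e1 ?e2 // (ltn_trans ui).
- rewrite -(val_inj h) in l2 e2; exists i; split; first lra.
  by move=> u ui; rewrite e1 ?e2.
Qed.

Lemma lexlt_total x a b : distinct x -> a <> b -> lexlt x a b \/ lexlt x b a.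
Proof.
move=> dx /dx [i0 ne].
pose P i := ~~ (Req_dec_T (x (a, i)) (x (b, i)) : bool).
have P0 : P i0 by rewrite /P; case: Req_dec_T.
case: (arg_minnP (fun i : 'I_m.+1 => i : nat) P0) => i Pi mn.
have e (i' : 'I_m.+1) : (i' < i)%N -> x (a, i') = x (b, i').
  move=> lt; apply: NNPP => ne'.
  have : P i' by rewrite /P; case: Req_dec_T.
  by move/mn; rewrite leqNgt lt.
have nei : x (a, i) <> x (b, i) by move: Pi; rewrite /P; case: Req_dec_T.
case: (Rtotal_order (x (a, i)) (x (b, i))) => [lt|[//|gt]].
  by left; exists i.
by right; exists i; split=> // i' /e.
Qed.

Lemma lexmin_ex x : distinct x -> exists a, forall b, b <> a -> lexlt x a b.
Proof.
move=> dx.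
have H (s : seq 'I_k.+1) : s <> [::] -> exists2 a, a \in s & forall b, b \in s -> b <> a -> lexlt x a b.
  elim: s => // a s IH _; case: s IH => [_|c s IH].
    by exists a => [|b]; rewrite !inE // => /eqP.
  have [//|d ds dm] := IH.
  case: (a =P d) => [ad|ad].
    exists a => [|b]; rewrite in_cons ?eqxx // => /predU1P[-> //|bs] ba.
    by rewrite ad; apply: dm; rewrite -?ad.
  case: (lexlt_total dx ad) => lt.
    exists a => [|b]; rewrite in_cons ?eqxx // => /predU1P[-> //|bs] ba.
    case: (b =P d) => [-> //|bd]; apply: lexlt_trans lt _; exact: dm.
  exists d => [|b]; rewrite in_cons ?ds ?orbT // => /predU1P[-> //|bs]; exact: dm.
have [|a _ am] := H (enum 'I_k.+1).
  by move/(congr1 size); rewrite size_enum_ord.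
by exists a => b ba; apply: am; rewrite ?mem_enum.
Qed.

Definition lexmin x : 'I_k.+1 :=
  epsilon (inhabits ord0) (fun a => forall b, b <> a -> lexlt x a b).

Lemma lexminP x b : distinct x -> b <> lexmin x -> lexlt x (lexmin x) b.
Proof. by move=> dx; apply: (epsilon_spec (inhabits ord0) _ (lexmin_ex dx)). Qed.

Lemma lexmin_unique x a : distinct x -> (forall b, b <> a -> lexlt x a b) -> lexmin x = a.
Proof.
move=> dx am; apply: NNPP => ne.
by apply: (@lexlt_asym x (lexmin x) a); [apply: lexminP => // /esym|apply: am].
Qed.

Lemma distinct_act t x : distinct x -> distinct (act_pt t x).
Proof.
move=> dx a b ab; have [|i ne] := dx (t^-1%g a) (t^-1%g b); last by exists i.
by move/perm_inj.
Qed.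

Lemma lexmin_act t x : distinct x -> lexmin (act_pt t x) = t (lexmin x).
Proof.
move=> dx; apply: lexmin_unique; first exact: distinct_act.
move=> b bne; have [|i [h1 h2]] := @lexminP x (t^-1%g b) dx.
  by move=> e; apply: bne; rewrite -e permKV.
by exists i; rewrite /act_pt /= permK.
Qed.

Lemma bary_act t l : bary (map (act_pt t) l) = act_pt t (bary l).
Proof.
apply: functional_extensionality => u; rewrite /act_pt /bary /avg size_map; congr (_ / _).
by elim: l => //= x l ->.
Qed.

End Configurations.

Section Core.
Variables (p e k m' : nat).
Hypotheses (pp : prime p) (kpe : k.+1 = (p ^ e)%N) (k0 : (0 < k)%N).
Notation m := m'.+1.
Notation D := (m * k)%N.
Notation pnt := ('I_k.+1 * 'I_m.+1 -> R).
Notation sigT := {ffun 'I_m -> 'S_k.+1}.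
Notation Fp := 'F_p.

(** If p did not divide the binomial, the identity [e1] would make p^e divide [i], which is
    smaller. *)
Lemma bin_pexp i : (0 < i < k.+1)%N -> (('C(k.+1, i))%:R = 0 :> Fp)%R.
Proof.
move=> /andP[i0 ik]; apply/eqP; rewrite -(GRing.dvdn_pcharf (pchar_Fp pp)).
have e1 : (k.+1 * 'C(k, i.-1) = i * 'C(k.+1, i))%N.
  by have := mul_bin_diag k.+1 i.-1; rewrite prednK.
apply/negPn/negP => nd.
have cp : coprime (p ^ e) 'C(k.+1, i) by rewrite coprimeXl // prime_coprime.
have : (p ^ e %| i)%N by rewrite -(Gauss_dvdl _ cp) -e1 kpe dvdn_mulr.
by move/(dvdn_leq i0); rewrite -kpe leqNgt ik.
Qed.

Definition vertex (s : sigT) (A : {set 'I_D}) : pnt := fun u => INR (vcoord s A u.1 u.2).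

Lemma vertex_ext (s s' : sigT) (A : {set 'I_D}) :
  (forall (j : 'I_D) a, j \in A -> below s' j a = below s j a) -> vertex s' A = vertex s A.
Proof.
by move=> h; apply: functional_extensionality => u; rewrite /vertex (vcoord_ext _ _ h).
Qed.

Lemma vertex_relabel t (s : sigT) (A : {set 'I_D}) (j : 'I_D) : j \in A -> monotone_on t [set a | below s j a] ->
  vertex (relabel t s) A = act_pt t (vertex s A).
Proof.
move=> jA mt; apply: functional_extensionality => u; rewrite /act_pt /vertex /=.
by rewrite -(vcoord_relabel _ _ jA mt) permKV.
Qed.

Definition dirsign (s : sigT) (r : nat) (a b : 'I_k.+1) : R :=
  if (frank s r a < frank s r b)%N then 1 else -1.
Definition coord (i : nat) : 'I_m.+1 := inord i.
(** At a vertex where a ray separates the two points, some difference among the first m coordinates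
    is at least 1, while the last difference is at least -(k + 1): this weight leaves a total of at
    least 1. *)
Definition sepweight := locked (INR k + 2).
(* Each point of a simplex is separated by a linear form that is at least 1 at the vertices, so
   that barycenters and limits of subdivisions remain configurations. *)
Definition sepform s a b (x : pnt) : R :=
  foldr (fun r acc => sepweight * (dirsign s r a b * (x (b, coord r) - x (a, coord r))) + acc)
    (x (b, coord m) - x (a, coord m)) (iota 0 m).
Definition sepcell s (x : pnt) := forall a b : 'I_k.+1, (a < b)%N -> 1 <= sepform s a b x.

Lemma avgD (T : Type) (f g : (T -> R) -> R) l :
  avg (fun x => f x + g x) l = avg f l + avg g l.
Proof.
rewrite /avg /Rdiv -Rmult_plus_distr_r; congr (_ * _).
by elim: l => [|x l /= ->] /=; lra.
Qed.

Lemma avgZ (T : Type) (f : (T -> R) -> R) c l : avg (fun x => c * f x) l = c * avg f l.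
Proof.
rewrite /avg /Rdiv -Rmult_assoc; congr (_ * _).
by elim: l => [|x l /= ->] /=; lra.
Qed.

Lemma avg_sub (T : Type) (u v : T) l :
  avg (fun x : T -> R => x u - x v) l = bary l u - bary l v.
Proof. by rewrite /Rminus (avgD (fun x => x u) (fun x => - x v)) avgN. Qed.

Lemma sepform_bary s a b l : sepform s a b (bary l) = avg (sepform s a b) l.
Proof.
rewrite /sepform; elim: (iota 0 m) => [|r rs IH] /=; first by rewrite avg_sub.
rewrite (avgD (fun x => sepweight * (dirsign s r a b * (x (b, coord r) - x (a, coord r))))
  (fun x => foldr _ _ rs)) -IH; congr (_ + _).
by rewrite avgZ avgZ avg_sub.
Qed.

Lemma sepcell_convex s : barconvex (@bary _) (sepcell s).
Proof.
move=> l l0 H a b ab; rewrite sepform_bary; apply: avg_ge => //.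
by apply: Forall_impl H => x; apply.
Qed.

Lemma sepform_eq0 s a b x : (forall i, x (a, i) = x (b, i)) -> sepform s a b x = 0.
Proof.
move=> h; rewrite /sepform h Rminus_diag; elim: (iota 0 m) => //= r rs ->.
by rewrite h Rminus_diag !Rmult_0_r; lra.
Qed.

Lemma sepcell_distinct s x : sepcell s x -> distinct x.
Proof.
move=> rx a b ab; apply: NNPP => nE.
have h i : x (a, i) = x (b, i) by apply: NNPP => ne; apply: nE; exists i.
case: (ltngtP a b) => lt; last by apply: ab; apply: val_inj.
- by have := rx a b lt; rewrite sepform_eq0 //; lra.
- by have := rx b a lt; rewrite sepform_eq0 //; lra.
Qed.

(** The rays of one coordinate are indicators of nested sets: the point of higher rank lies on every
    ray that contains the other one, and on one more if a ray of [A] separates them. *)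
Lemma vertex_step (s : sigT) (A : {set 'I_D}) r (a b : 'I_k.+1) : (r < m)%N ->
  0 <= dirsign s r a b * (vertex s A (b, coord r) - vertex s A (a, coord r)) /\
  forall j : 'I_D, j \in A -> j %/ k = r -> below s j a <> below s j b ->
  1 <= dirsign s r a b * (vertex s A (b, coord r) - vertex s A (a, coord r)).
Proof.
move=> rm; rewrite /vertex /= /coord inordK; last exact: ltnW.
rewrite /vcoord rm /dirsign.
have gen (u v : 'I_k.+1) : (frank s r u <= frank s r v)%N ->
  0 <= INR #|[set j in A | (j %/ k == r) && ~~ below s j v]| - INR #|[set j in A | (j %/ k == r) && ~~ below s j u]| /\
  forall j : 'I_D, j \in A -> j %/ k = r -> below s j u <> below s j v ->
  1 <= INR #|[set j in A | (j %/ k == r) && ~~ below s j v]| - INR #|[set j in A | (j %/ k == r) && ~~ below s j u]|.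
  move=> uv.
  have imp (j : 'I_D) : j %/ k = r -> below s j v -> below s j u.
    by rewrite /below => ->; apply: leq_trans.
  have sub : [set j in A | (j %/ k == r) && ~~ below s j u] \subset [set j in A | (j %/ k == r) && ~~ below s j v].
    apply/subsetP => j; rewrite !inE => /and3P[-> /eqP jr nu]; rewrite jr eqxx /=.
    by apply: contra nu; apply: imp.
  split.
    by have /leP/le_INR := subset_leq_card sub; lra.
  move=> j jA jr ne.
  have : (#|[set j in A | (j %/ k == r) && ~~ below s j u]| < #|[set j in A | (j %/ k == r) && ~~ below s j v]|)%N.
    apply: proper_card; apply/properP; split=> //; exists j; rewrite !inE jA jr eqxx /=.
      by apply/negP => h; apply: ne; rewrite h (imp _ jr h).
    rewrite negbK; apply/negPn/negP => nu; apply: ne; apply/esym.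
    by rewrite (negPf nu); apply: contraNF nu; apply: imp.
  by move/leP/le_INR; rewrite S_INR; lra.
case: ltnP => h.
  by have [g1 g2] := gen a b (ltnW h); split=> [|j jA jr ne]; [lra|have := g2 j jA jr ne; lra].
have [g1 g2] := gen b a h; split=> [|j jA jr ne]; first lra.
by have := g2 j jA jr (fun e => ne (esym e)); lra.
Qed.

Lemma vertex_sepcell s A : sepcell s (vertex s A).
Proof.
move=> a b ab; rewrite /sepform.
set last := vertex s A (b, coord m) - vertex s A (a, coord m).
have lastE c : vertex s A (c, coord m) = INR #|[set d : 'I_k.+1 | (d < c)%N && unsep s A c d]|.
  by rewrite /vertex /coord inordK // /vcoord ltnn.
have wtE : sepweight = INR k + 2 by rewrite /sepweight -lock.
have kp : 0 <= sepweight by have := pos_INR k; lra.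
have base rs : (forall r, r \in rs -> (r < m)%N) -> last <= foldr (fun r acc => sepweight * (dirsign s r a b * (vertex s A (b, coord r) - vertex s A (a, coord r))) + acc) last rs.
  elim: rs => [_|r rs IH h] /=; first lra.
  have [g _] := vertex_step s A a b (h r (mem_head _ _)).
  have := IH (fun r' rr => h r' (mem_behead (s := r :: rs) rr)).
  have := Rmult_le_pos _ _ kp g; lra.
have lastb : - INR k.+1 <= last.
  rewrite /last !lastE.
  have h1 : INR #|[set d : 'I_k.+1 | (d < a)%N && unsep s A a d]| <= INR k.+1.
    by apply/le_INR/leP; rewrite -[X in (_ <= X)%N](card_ord k.+1) max_card.
  have := pos_INR #|[set d : 'I_k.+1 | (d < b)%N && unsep s A b d]|; lra.
case sab : (unsep s A a b).
  apply: Rle_trans (base _ _); last by move=> r; rewrite mem_iota.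
  have := @vcoord_unsep_lt k m' s A a b sab ab; rewrite /last !lastE /vcoord ltnn => /leP/le_INR.
  by rewrite S_INR; lra.
move/negbT: sab; rewrite negb_forall => /existsP[j].
rewrite negb_imply => /andP[jA /eqP jne].
have rm : (j %/ k < m)%N by rewrite ltn_divLR.
have aux rs : (forall r, r \in rs -> (r < m)%N) -> (j %/ k)%N \in rs ->
   sepweight + last <= foldr (fun r acc => sepweight * (dirsign s r a b * (vertex s A (b, coord r) - vertex s A (a, coord r))) + acc) last rs.
  elim: rs => [//|r rs IH h] /=; rewrite in_cons.
  have [g1 g2] := vertex_step s A a b (h r (mem_head _ _)).
  have hb r' : r' \in rs -> (r' < m)%N by move=> rr; apply: h; rewrite in_cons rr orbT.
  case/orP => [/eqP jr|jr].
    have := base rs hb; have := g2 j jA jr jne.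
    by move=> g3; have := Rmult_le_compat_l _ _ _ kp g3; lra.
  have := IH hb jr; have := Rmult_le_pos _ _ kp g1; lra.
suff : sepweight + last <= foldr (fun r acc => sepweight * (dirsign s r a b * (vertex s A (b, coord r) - vertex s A (a, coord r))) + acc) last (iota 0 m).
  by rewrite S_INR in lastb; lra.
by apply: aux => [r|]; rewrite mem_iota //= add0n.
Qed.


(** One point [x] serves all slots: a simplex with a nonzero value shows a jump in every slot, and
    such simplices shrink to [x]. *)
Theorem no_local_labels (E : pnt -> nat -> 'I_k.+1) :
  (forall t x j, distinct x -> E (act_pt t x) j = t (E x j)) ->
  exists2 x : pnt, distinct x & forall eta j, 0 < eta -> (j < D)%N ->
    exists y y' : pnt, [/\ distinct y, distinct y', forall u, Rabs (y u - x u) <= eta,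
      forall u, Rabs (y' u - x u) <= eta & E y j <> E y' j].
Proof.
move=> eE.
pose aLk t := act_lab (k := k) (fun=> t).
pose chik t := lsign Fp m (fun=> t : 'S_k.+1).
have actE (E' : pnt -> nat -> 'I_k.+1) : (forall t x j, distinct x -> E' (act_pt t x) j = t (E' x j)) ->
    label_act (@distinct k m) (@act_pt k m) aLk E'.
  by move=> h t x dx; apply: functional_extensionality => j; rewrite h.
pose E0 (x : pnt) (j : nat) := lexmin x.
have aE := actE E eE.
have aE0 : label_act (@distinct k m) (@act_pt k m) aLk E0.
  by apply: actE => t x j dx; apply: lexmin_act.
pose z := flagcycle Fp vertex.
have size_z t : List.In t z -> size t.2 = D.+1.
  rewrite /z /flagcycle; elim: (enum _) => //= u us IH [<-|//].
  by rewrite /flag size_map size_iota.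
have z_cycle c : equivariant (@bary _) (@distinct k m) (@act_pt k m) chik D c -> ceval z (cobd c) = 0%R.
  move=> ec; apply: (@ceval_flagcycle_cobd k m' Fp pnt vertex vertex_ext (@act_pt k m) vertex_relabel bin_pexp) => // t s rho l le.
  apply: (ec (sepcell s)) => //; first exact: sepcell_convex.
  - exact: sepcell_distinct.
  - by rewrite le size_map size_iota.
  by rewrite le; elim: (iota 0 D) => //= i us IH; constructor => //; apply: vertex_sepcell.
have nz : ceval z (fun l => lcochain Fp m (map E0 l)) <> 0%R.
  rewrite ceval_flagcycle.
  have hP s A b : b != lexmin (vertex s A) -> lexltn s A (lexmin (vertex s A)) b.
    move=> /eqP bn; have [i [lt eq]] := lexminP (sepcell_distinct (vertex_sepcell s A)) bn.
    exists i; first by rewrite -ltnS.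
    split; first by apply/ltP/INR_lt.
    move=> i' ii; have im : (i' < m.+1)%N by apply: ltn_trans (ltn_ord i).
    by apply: INR_eq; have := eq (Ordinal im) ii.
  have := @sum_flag_labels_neq0 k m' k0 (fun s A => lexmin (vertex s A)) hP Fp.
  apply: contra_not => h; rewrite -[RHS]h; apply: eq_bigr => s _; apply: eq_bigr => rho _.
  by congr (_ * lcochain _ _ _)%R; rewrite /flag -map_comp.
have [t tz often_t] := @often_subdivision Fp pnt (nat -> 'I_k.+1) 'S_k.+1 (@bary _) (@distinct k m) (@act_pt k m) aLk chik
   (fun t l _ => @bary_act k m t l) D (lcochain Fp m) (@lcochain_cocycle Fp k m) (fun g => @lcochain_act Fp k m (fun=> g)) z size_z z_cycle E E0 aE aE0 nz.
have [s regt] : exists s, List.Forall (sepcell s) t.2.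
  move: tz; rewrite /z /flagcycle; elim: (enum _) => //= u us IH [<-|//].
  exists u.1; rewrite /flag /=; constructor; first exact: vertex_sepcell.
  by elim: (iota 1 _) => //= i us' IH'; constructor => //; apply: vertex_sepcell.
have [d dt] : exists d, diam d t.2.
  have bnd (x : pnt) : exists M, forall u, Rabs (x u) <= M.
    have H (us : seq ('I_k.+1 * 'I_m.+1)) : exists M, forall u, u \in us -> Rabs (x u) <= M.
      elim: us => [|u us [M hM]]; first by exists 0.
      exists (Rmax M (Rabs (x u))) => v; rewrite in_cons => /predU1P[->|/hM h].
        exact: Rmax_r.
      by apply: Rle_trans h _; apply: Rmax_l.
    have [M hM] := H (enum predT); exists M => u; apply: hM.
    by rewrite mem_enum.
  have [M hM] : exists M, forall x u, List.In x t.2 -> Rabs (x u) <= M.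
    elim: (t.2) => [|x l [M hM]]; first by exists 0.
    have [M' hM'] := bnd x; exists (Rmax M M') => y u [<-|/hM h].
      by apply: Rle_trans (hM' u) _; apply: Rmax_r.
    by apply: Rle_trans (h u) _; apply: Rmax_l.
  exists (M + M) => x y u xt yt.
  have := Rabs_triang (x u) (- y u); rewrite Rabs_Ropp /Rminus.
  have := hM x u xt; have := hM y u yt; lra.
have al : alive (fun l => lcochain Fp m (map E l)) D t.2.
  by split=> //; apply: size_z.
have [x hx] := limit_point al dt.
exists x.
  move=> a b ab; apply: NNPP => nE.
  have h i : x (a, i) = x (b, i) by apply: NNPP => ne; apply: nE; exists i.
  wlog lt : a b ab nE h / (a < b)%N.
    move=> W; case: (ltngtP a b) => lt; last by apply: ab; apply: val_inj.
      exact: (W a b).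
    have nE' : ~ exists i, x (b, i) <> x (a, i) by move=> [i ne]; apply: nE; exists i; apply: nesym.
    exact: (W b a (nesym ab) nE' (fun i => esym (h i)) lt).
  have wp : 0 <= sepweight by rewrite /sepweight -lock; have := pos_INR k; lra.
  (* [K] adds up the absolute values of the coefficients of [sepform]. If the points [a] and [b] of
     [x] coincided, the form would be at most 1/2 at a vertex within 1/(4K) of [x], against the
     lower bound 1. *)
  pose K := sepweight * INR m + 1.
  have Kp : 0 < K by rewrite /K; have := Rmult_le_pos _ _ wp (pos_INR m); lra.
  have [|l [sl _ nl Cl]] := hx (/ (4 * K)); first by apply: Rinv_0_lt_compat; lra.
  have /Forall_forall regl := Cl _ (@sepcell_convex s) regt.
  case: l sl nl {Cl} regl => // y l _ nl regl.
  have ry := regl y (or_introl erefl) a b lt.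
  pose eta := / (4 * K).
  have near i : Rabs (y (b, i) - y (a, i)) <= 2 * eta.
    have h1 := nl y (b, i) (or_introl erefl); have h2 := nl y (a, i) (or_introl erefl).
    have -> : y (b, i) - y (a, i) = (y (b, i) - x (b, i)) + - (y (a, i) - x (a, i)) by rewrite h; ring.
    apply: Rle_trans (Rabs_triang _ _) _; rewrite Rabs_Ropp /eta; lra.
  have up rs : foldr (fun r acc => sepweight * (dirsign s r a b * (y (b, coord r) - y (a, coord r))) + acc) (y (b, coord m) - y (a, coord m)) rs <= (sepweight * INR (size rs) + 1) * (2 * eta).
    elim: rs => [|r rs IH]; first by have /Rabs_le_bounds := near (coord m); rewrite /=; lra.
    have st : dirsign s r a b * (y (b, coord r) - y (a, coord r)) <= 2 * eta.
      by have /Rabs_le_bounds := near (coord r); rewrite /dirsign; case: ifP => _; lra.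
    have := Rmult_le_compat_l _ _ _ wp st.
    change (size (r :: rs)) with (S (size rs)); rewrite [INR (S (size rs))]S_INR [foldr _ _ _]/=; lra.
  have := up (iota 0 m); rewrite size_iota -/K.
  have -> : K * (2 * eta) = / 2 by rewrite /eta; field; lra.
  by move: ry; rewrite /sepform; lra.
move=> eta j e0 jD; have [l [sl nzl nl Cl]] := hx eta e0.
have /Forall_forall regl := Cl _ (@sepcell_convex s) regt.
have := lcochain_neq0 nzl jD.
have nIn i : (i < size l)%N -> List.In (nth x l i) l.
  elim: (l) i => // y l' IH [|i] /=; first by left.
  by move=> h; right; apply: IH.
have j1 : (j.+1 < size l)%N by rewrite sl.
rewrite !(nth_map x) //; last exact: ltnW.
move=> ne; exists (nth x l j.+1), (nth x l j).
have i1 := nIn _ j1; have i2 := nIn j (ltnW j1).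
by split=> //; [apply: sepcell_distinct (regl _ i1)|apply: sepcell_distinct (regl _ i2)|move=> u; apply: nl|move=> u; apply: nl].
Qed.
End Core.

End PointLabels.

(** * Configuration spaces in coordinates *)

Module ConfigurationSpaces.

Import Reals Lra.
Import ClassicalEpsilon FunctionalExtensionality PropExtensionality.
Import all_boot all_fingroup.
Import PointLabels.
Set Implicit Arguments. Unset Strict Implicit.
Local Open Scope R_scope.

Definition toI m (i : idx m) : 'I_m := Ordinal (introT ltP (proj2_sig i)).
Definition ofI m (i : 'I_m) : idx m := exist _ (i : nat) (elimT ltP (ltn_ord i)).

Lemma toIK m : cancel (@toI m) (@ofI m).
Proof. by case=> i h; rewrite /ofI; congr exist; apply: proof_irrelevance. Qed.

Lemma ofIK m : cancel (@ofI m) (@toI m).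
Proof. by move=> i; apply: val_inj. Qed.

Lemma config_eq n k (c d : config n k) : proj1_sig c = proj1_sig d -> c = d.
Proof.
case: c d => [c hc] [d hd] /= e; rewrite -{}e in hd *.
by rewrite (proof_irrelevance _ hc hd).
Qed.

Lemma same_orbit_refl n k (c : config n k) : same_orbit n k c c.
Proof. by exists id; split=> //; exists id. Qed.

Lemma same_orbit_sym n k (c d : config n k) : same_orbit n k c d -> same_orbit n k d c.
Proof.
move=> [s [[g [gs sg]] e]]; exists g; split; first by exists s.
by move=> j; rewrite e sg.
Qed.

Lemma same_orbit_trans n k (c d f : config n k) :
  same_orbit n k c d -> same_orbit n k d f -> same_orbit n k c f.
Proof.
move=> [s [[g [gs sg]] e]] [s' [[g' [gs' sg']] e']].
exists (fun i => s (s' i)); split; last by move=> j; rewrite e' e.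
by exists (fun i => g' (g i)); split=> i; rewrite ?gs ?gs' ?sg' ?sg.
Qed.

Lemma pi_eq n k (c d : config n k) : pi_conf n k c = pi_conf n k d <-> same_orbit n k c d.
Proof.
split=> [/(f_equal (@proj1_sig _ _)) /= e|cd].
  by rewrite e; apply: same_orbit_refl.
have e : same_orbit n k c = same_orbit n k d.
  apply: functional_extensionality => f; apply: propositional_extensionality; split.
    by apply: same_orbit_trans; apply: same_orbit_sym.
  exact: same_orbit_trans.
rewrite /pi_conf; move: (ex_intro _ c _) (ex_intro _ d _); rewrite e => h1 h2.
by rewrite (proof_irrelevance _ h1 h2).
Qed.

Lemma pi_surj n k (b : unordered n k) : exists c, b = pi_conf n k c.
Proof.
case: b => P [c e]; exists c; subst P.
by rewrite /pi_conf; congr exist; apply: proof_irrelevance.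
Qed.

Section Coordinates.
Variables (k m : nat).
Notation n := m.+1.
Notation pnt := ('I_k.+1 * 'I_m.+1 -> R).
Notation cfgT := (config n k.+1).
Implicit Types (c d : cfgT) (x y : pnt).

Definition coords c : pnt := fun u => proj1_sig c (ofI u.1) (ofI u.2).

Lemma coords_distinct c : distinct (coords c).
Proof.
move=> a b ab; apply: NNPP => nE; apply: ab.
rewrite -(ofIK a) -(ofIK b); congr toI; apply: (proj2_sig c).
apply: functional_extensionality => i; rewrite -(toIK i).
by apply: NNPP => ne; apply: nE; exists (toI i).
Qed.

Lemma coords_inj c d : coords c = coords d -> c = d.
Proof.
move=> e; apply: config_eq; apply: functional_extensionality => j.
apply: functional_extensionality => i; rewrite -(toIK i) -(toIK j).
exact: (f_equal (fun f => f (toI j, toI i)) e).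
Qed.

Lemma coords_surj x : distinct x -> exists c, coords c = x.
Proof.
move=> dx.
have inj (i j : idx k.+1) : (fun l : idx n => x (toI i, toI l)) = (fun l => x (toI j, toI l)) -> i = j.
  move=> e; rewrite -(toIK i) -(toIK j); congr ofI; apply: NNPP => /dx [l]; apply.
  by rewrite -(ofIK l); apply: (f_equal (fun f => f (ofI l)) e).
exists (exist _ (fun i l => x (toI i, toI l)) inj).
by apply: functional_extensionality => -[a i]; rewrite /coords /= !ofIK.
Qed.

Lemma F_openP (O : cfgT -> Prop) c : F_open n k.+1 O -> O c ->
  exists2 eps, 0 < eps & forall d, (forall u, Rabs (coords d u - coords c u) < eps) -> O d.
Proof.
move=> Oo Oc; have [eps [e0 h]] := Oo c Oc; exists eps => // d hd.
apply: h => j i; have := hd (toI j, toI i); rewrite /coords /= !toIK; exact.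
Qed.

Lemma F_open_intro (O : cfgT -> Prop) :
  (forall c, O c -> exists2 eps, 0 < eps & forall d, (forall u, Rabs (coords d u - coords c u) < eps) -> O d) ->
  F_open n k.+1 O.
Proof.
move=> h c /h [eps e0 hd]; exists eps; split=> // d dc; apply: hd => u; exact: dc.
Qed.

Lemma same_orbit_perm c d : same_orbit n k.+1 c d <-> exists t : 'S_k.+1, coords d = act_pt t (coords c).
Proof.
split=> [[s [[g [gs sg]] e]]|[t e]].
  have inj : injective (fun a : 'I_k.+1 => toI (g (ofI a))).
    move=> a b /(can_inj (@toIK _)) e'.
    by rewrite -(ofIK a) -(ofIK b) -(sg (ofI a)) e' sg.
  exists (perm inj); apply: functional_extensionality => -[a i]; rewrite /coords /act_pt /= e.
  set b := ((perm inj)^-1)%g a.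
  have -> : a = perm inj b by rewrite permKV.
  by rewrite permE toIK sg.
exists (fun i => ofI ((t^-1)%g (toI i))); split.
  by exists (fun i => ofI (t (toI i))); split=> i; rewrite ofIK ?permKV ?permK toIK.
move=> j; apply: functional_extensionality => i.
have := f_equal (fun f => f (toI j, toI i)) e.
by rewrite /coords /act_pt /= !toIK.
Qed.

Lemma pi_act c d t : coords d = act_pt t (coords c) -> pi_conf n k.+1 d = pi_conf n k.+1 c.
Proof. by move=> e; apply/esym/pi_eq/same_orbit_perm; exists t. Qed.

End Coordinates.

Lemma pos_bound (T : finType) (f : T -> R) : (forall u, 0 < f u) ->
  exists2 e, 0 < e & forall u, e <= f u.
Proof.
move=> fp.
have H (us : seq T) : exists2 e, 0 < e & forall u, u \in us -> e <= f u.
  elim: us => [|u us [e e0 h]]; first by exists 1; first lra.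
  exists (Rmin e (f u)); first exact: Rmin_glb_lt.
  move=> v; rewrite in_cons => /predU1P[->|/h hv]; first exact: Rmin_r.
  by apply: Rle_trans hv; apply: Rmin_l.
have [e e0 h] := H (enum T); exists e => // u; apply: h.
by rewrite mem_enum.
Qed.

Lemma distinct_sep k m (x : 'I_k.+1 * 'I_m.+1 -> R) : distinct x -> exists2 e, 0 < e &
  forall a b, a <> b -> exists i, e <= Rabs (x (a, i) - x (b, i)).
Proof.
move=> dx.
have P (u : 'I_k.+1 * 'I_k.+1) : exists e, 0 < e /\ (u.1 <> u.2 -> exists i, e <= Rabs (x (u.1, i) - x (u.2, i))).
  case: (u.1 =P u.2) => ne; first by exists 1; split=> //; lra.
  have [i hi] := dx _ _ ne; exists (Rabs (x (u.1, i) - x (u.2, i))); split.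
    by apply: Rabs_pos_lt; lra.
  by move=> _; exists i; lra.
pose f u := proj1_sig (constructive_indefinite_description _ (P u)).
have fP u : 0 < f u /\ (u.1 <> u.2 -> exists i, f u <= Rabs (x (u.1, i) - x (u.2, i))).
  exact: (proj2_sig (constructive_indefinite_description _ (P u))).
have [e e0 he] := pos_bound (fun u => (fP u).1).
exists e => // a b ab; have [i hi] := (fP (a, b)).2 ab; exists i.
exact: Rle_trans (he (a, b)) hi.
Qed.

(** * The lower bound for secat *)

Section SecatLower.
Variables (p e k m' : nat).
Hypotheses (pp : prime p) (kpe : k.+1 = (p ^ e)%N) (k0 : (0 < k)%N).
Notation m := m'.+1.
Notation D := (m * k)%N.
Notation pnt := ('I_k.+1 * 'I_m.+1 -> R).
Notation cfgT := (config m.+1 k.+1).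
Notation pi := (pi_conf m.+1 k.+1).

(** With fewer than D + 1 sets every set owns a slot, and the slots after [M] repeat the last set.
    The point given by [no_local_labels] lies over one of the sets, and continuity of its section
    fixes the label of that slot nearby. *)
Lemma secat_lower M : secat_le (F_space m.+1 k.+1) (B_space m.+1 k.+1) pi M -> (D <= M)%N.
Proof.
move=> [U [Uo [Uc Us]]]; rewrite leqNgt; apply/negP => MD.
pose jj j := minn j M.
have jjM j : (jj j <= M)%coq_nat by apply/leP; rewrite geq_minr.
pose s j := proj1_sig (constructive_indefinite_description _ (Us (jj j) (jjM j))).
have sP j : cont_on (B_space m.+1 k.+1) (F_space m.+1 k.+1) (U (jj j)) (s j) /\
    forall b, U (jj j) b -> pi (s j b) = b.
  exact: (proj2_sig (constructive_indefinite_description _ (Us (jj j) (jjM j)))).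
(* The label is the point that the section lists first; outside its set any equivariant default
   would do, and [lexmin] is one. *)
pose spec x j a := forall c : cfgT, coords c = x ->
   (U (jj j) (pi c) -> forall i, coords (s j (pi c)) (ord0, i) = x (a, i)) /\
   (~ U (jj j) (pi c) -> a = lexmin x).
have spec_ex x j : distinct x -> exists a, spec x j a.
  move=> dx; have [c cx] := coords_surj dx.
  case: (classic (U (jj j) (pi c))) => [h|h].
    have /pi_eq/same_orbit_perm [t et] := (sP j).2 _ h.
    exists (t ord0) => c' c'x; have -> : c' = c by apply: coords_inj; rewrite cx.
    split=> // _ i; rewrite -cx et /act_pt /= permK //.
  exists (lexmin x) => c' c'x; have -> : c' = c by apply: coords_inj; rewrite cx.
  by split.
have spec_un x j a b : distinct x -> spec x j a -> spec x j b -> a = b.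
  move=> dx ha hb; have [c cx] := coords_surj dx.
  case: (classic (U (jj j) (pi c))) => h.
    apply: NNPP => ab; have [i] := dx a b ab; apply.
    by rewrite -(ha c cx).1 // (hb c cx).1.
  by rewrite (ha c cx).2 // (hb c cx).2.
pose E x j := epsilon (inhabits ord0) (spec x j).
have EP x j : distinct x -> spec x j (E x j) by move=> dx; apply: epsilon_spec (spec_ex x j dx).
have [|x dx hx] := @no_local_labels p e k m' pp kpe k0 E.
  move=> t x j dx; apply: (@spec_un (act_pt t x) j); [exact: distinct_act| exact/EP/distinct_act |].
  move=> c cx; have [c0 c0x] := coords_surj dx.
  rewrite (pi_act (c := c0) (t := t)); last by rewrite c0x.
  have [h1 h2] := EP x j dx c0 c0x; split=> [h i|h].
    by rewrite h1 // /act_pt /= permK.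
  by rewrite (h2 h) lexmin_act.
have [c cx] := coords_surj dx.
have [i [iM Ui]] := Uc (pi c).
have iD : (i < D)%N by apply: leq_ltn_trans MD; apply/leP.
have ji : jj i = i by apply/minn_idPl/leP.
set a := E x i.
have ha : forall l, coords (s i (pi c)) (ord0, l) = x (a, l).
  by apply: (EP x i dx c cx).1; rewrite ji.
have [dl dl0 sep] := distinct_sep dx.
(* Distinct points of [x] are [dl] apart in some coordinate. With another [dl / 4] for moving [x] to
   [y], no label other than [a] is compatible with this bound. *)
pose O (d : cfgT) := forall l, Rabs (coords d (ord0, l) - x (a, l)) < dl / 4.
have Oo : is_open (F_space m.+1 k.+1) O.
  apply: F_open_intro => d Od.
  have [|eps e0 he] := @pos_bound _ (fun l => dl / 4 - Rabs (coords d (ord0, l) - x (a, l))).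
    by move=> l /=; have := Od l; lra.
  exists eps => // d' hd l.
  have h1 := hd (ord0, l); have /= h2 := he l.
  have -> : coords d' (ord0, l) - x (a, l) = (coords d' (ord0, l) - coords d (ord0, l)) + (coords d (ord0, l) - x (a, l)) by ring.
  by apply: Rle_lt_trans (Rabs_triang _ _) _; lra.
have [O' [O'o O'P]] := (sP i).1 O Oo; rewrite ji in O'P.
have Ui' : O' (pi c).
  by apply/(O'P _ Ui) => l; rewrite ha Rminus_diag Rabs_R0; lra.
have [e1 e10 h1] := F_openP (Uo i iM) Ui.
have [e2 e20 h2] := F_openP O'o Ui'.
pose eta := Rmin (Rmin e1 e2) dl / 4.
have etab : 0 < eta /\ eta < e1 /\ eta < e2 /\ eta <= dl / 4.
  have := Rmin_l (Rmin e1 e2) dl; have := Rmin_r (Rmin e1 e2) dl.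
  have := Rmin_l e1 e2; have := Rmin_r e1 e2.
  have : 0 < Rmin (Rmin e1 e2) dl by do 2?apply: Rmin_glb_lt.
  by rewrite /eta; lra.
have lab y : distinct y -> (forall u, Rabs (y u - x u) <= eta) -> E y i = a.
  move=> dy ny; have [d dyE] := coords_surj dy.
  have Ud : U i (pi d) by apply: h1 => u; rewrite cx dyE; have := ny u; lra.
  have Od : O' (pi d) by apply: h2 => u; rewrite cx dyE; have := ny u; lra.
  have /(O'P _ Ud) Od' := Od.
  have hy : forall l, coords (s i (pi d)) (ord0, l) = y (E y i, l).
    by apply: (EP y i dy d dyE).1; rewrite ji.
  apply: NNPP => ne; have [l hl] := sep _ _ ne.
  have := Od' l; rewrite hy; have := ny (E y i, l).
  have := Rabs_triang (y (E y i, l) - x (a, l)) (- (y (E y i, l) - x (E y i, l))); rewrite Rabs_Ropp.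
  have -> : y (E y i, l) - x (a, l) + - (y (E y i, l) - x (E y i, l)) = x (E y i, l) - x (a, l) by ring.
  lra.
have [y [y' [dy dy' ny ny' ne]]] := hx eta i etab.1 iD.
by apply: ne; rewrite !lab.
Qed.
End SecatLower.

End ConfigurationSpaces.

(** * Lifting a contraction through a covering *)

Module Lifting.

Import Reals Lra.
Import ClassicalEpsilon FunctionalExtensionality.
Import all_boot all_fingroup.
Import PointLabels ConfigurationSpaces.
Set Implicit Arguments. Unset Strict Implicit.
Local Open Scope R_scope.

(** Compactness of [a, b] by a supremum argument; it spares the cutting of a path into finitely many
    pieces. *)
Lemma interval_induction (P : R -> R -> Prop) a b : a <= b ->
  (forall c d f, a <= c -> c <= d -> d <= f -> f <= b -> P c d -> P d f -> P c f) ->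
  (forall t, a <= t <= b -> exists2 dl, 0 < dl & forall c d, a <= c -> c <= d -> d <= b ->
     Rabs (c - t) < dl -> Rabs (d - t) < dl -> P c d) -> P a b.
Proof.
move=> ab tr loc.
pose S t := a <= t <= b /\ P a t.
have Sa : S a.
  have [dl d0 h] := loc a ltac:(lra); split; first lra.
  by apply: h; rewrite ?Rminus_diag ?Rabs_R0; lra.
have [T [ub lub]] := completeness S (ex_intro _ b (fun t (h : S t) => proj2 (proj1 h))) (ex_intro _ a Sa).
have aT : a <= T by apply: ub.
have Tb : T <= b by apply: lub => t [[]].
have [dl d0 h] := loc T ltac:(lra).
have [t0 [St0 tT]] : exists t0, S t0 /\ T - dl < t0.
  apply: NNPP => nE; have : T <= T - dl; last lra.
  apply: lub => t St; apply: Rnot_lt_le => lt; apply: nE; by exists t.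
have t0T : t0 <= T by apply: ub.
have [[t0a t0b] Pt0] := St0.
pose d := Rmin b (T + dl / 2).
have db : d <= b by apply: Rmin_l.
have dT : d <= T + dl / 2 by apply: Rmin_r.
have Td : T <= d by apply: Rmin_glb; lra.
have Sd : S d.
  split; first lra.
  apply: (tr a t0 d) => //; try lra.
  apply: h; try lra; apply: Rabs_def1; lra.
have dT' : d <= T by apply: ub.
have -> : b = d by rewrite /d in dT' *; move: dT'; rewrite /Rmin; case: Rle_dec => ?; lra.
by case: Sd.
Qed.

Definition near (J : Type) (x y : J -> R) e := forall u, Rabs (x u - y u) < e.

Lemma near_sym (J : Type) (x y : J -> R) e : near x y e -> near y x e.
Proof. by move=> h u; rewrite Rabs_minus_sym. Qed.

Lemma near_refl (J : Type) (x : J -> R) e : 0 < e -> near x x e.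
Proof. by move=> h u; rewrite Rminus_diag Rabs_R0. Qed.

Lemma near_trans (J : Type) (x y z : J -> R) e f : near x y e -> near y z f -> near x z (e + f).
Proof.
move=> h1 h2 u; have -> : x u - z u = (x u - y u) + (y u - z u) by ring.
by apply: Rle_lt_trans (Rabs_triang _ _) _; have := h1 u; have := h2 u; lra.
Qed.

Lemma near_le (J : Type) (x y : J -> R) e f : near x y e -> e <= f -> near x y f.
Proof. by move=> h ef u; have := h u; lra. Qed.

Lemma B_open_and n k (O O' : unordered n k -> Prop) :
  is_open (B_space n k) O -> is_open (B_space n k) O' -> is_open (B_space n k) (fun b => O b /\ O' b).
Proof.
move=> o o' c [/o [e [e0 h]] /o' [e' [e0' h']]].
exists (Rmin e e'); split; first exact: Rmin_glb_lt.
move=> d hd; split; [apply: h|apply: h'] => j i; apply: Rlt_le_trans (hd j i) _.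
  exact: Rmin_l.
exact: Rmin_r.
Qed.

Section Lifting.
Variables (n k : nat) (E : Type) (J : Type) (co : E -> J -> R) (q : E -> unordered n k).
Notation B := (B_space n k).
Notation opn := (is_open B).

Definition sec_cont (C : unordered n k -> Prop) (f : unordered n k -> E) :=
  forall b, C b -> forall e, 0 < e -> exists O, [/\ opn O, O b &
    forall b', O b' -> C b' -> near (co (f b')) (co (f b)) e].

(** This and the next two hypotheses describe a covering given by real coordinates. They hold for
    ordered configurations and also for the choices of square roots in the planar case. *)
Hypothesis co_inj : forall e e', co e = co e' -> e = e'.
Hypothesis local_sections : forall b0, exists C, [/\ opn C, C b0 &
  forall e, C (q e) -> exists f, [/\ sec_cont C f, forall b, C b -> q (f b) = b & f (q e) = e]].
Hypothesis local_inj : forall e, exists2 r, 0 < r & forall e1 e2,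
  near (co e1) (co e) r -> near (co e2) (co e) r -> q e1 = q e2 -> e1 = e2.

Variables (U : unordered n k -> Prop) (G : unordered n k -> R -> unordered n k).
Hypothesis G_cont : forall x t, U x -> 0 <= t <= 1 -> forall C, opn C -> C (G x t) ->
  exists O dl, [/\ opn O, O x, 0 < dl &
    forall x' s, O x' -> U x' -> 0 <= s <= 1 -> Rabs (s - t) < dl -> C (G x' s)].

Definition pcont a b (p : R -> E) := forall t, a <= t <= b -> forall e, 0 < e ->
  exists2 dl, 0 < dl & forall s, a <= s <= b -> Rabs (s - t) < dl -> near (co (p s)) (co (p t)) e.

Definition lift x a b e e' := exists p, [/\ forall t, a <= t <= b -> q (p t) = G x t,
  pcont a b p, p a = e & p b = e'].

Lemma lift_trans x a b c e e' e'' : a <= b -> b <= c ->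
  lift x a b e e' -> lift x b c e' e'' -> lift x a c e e''.
Proof.
move=> ab bc [p [p1 p2 p3 p4]] [p' [p1' p2' p3' p4']].
pose r t := if Rle_dec t b then p t else p' t.
have rl t : t <= b -> r t = p t by rewrite /r; case: Rle_dec.
have rr t : b <= t -> r t = p' t.
  move=> bt; rewrite /r; case: Rle_dec => //= tb.
  by have -> : t = b by [lra]; rewrite p4 p3'.
exists r; split.
- move=> t ht; case: (Rle_dec t b) => tb; first by rewrite rl // p1 //; lra.
  by rewrite rr ?p1' //; lra.
- move=> t ht eps e0; case: (Rtotal_order t b) => [tb|[tb|tb]].
  + have [dl d0 h] := p2 t ltac:(lra) eps e0.
    exists (Rmin dl (b - t)); first by apply: Rmin_glb_lt; lra.
    move=> s hs st; have := Rmin_l dl (b - t); have := Rmin_r dl (b - t) => m1 m2.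
    have := Rle_abs (s - t) => m3.
    by rewrite !rl; try lra; apply: h; lra.
  + have [dl d0 h] := p2 t ltac:(lra) eps e0.
    have [dl' d0' h'] := p2' t ltac:(lra) eps e0.
    exists (Rmin dl dl'); first exact: Rmin_glb_lt.
    move=> s hs st; have := Rmin_l dl dl'; have := Rmin_r dl dl' => m1 m2.
    case: (Rle_dec s b) => sb.
      by rewrite !rl; try lra; apply: h; lra.
    by rewrite !rr; try lra; apply: h'; lra.
  + have [dl d0 h] := p2' t ltac:(lra) eps e0.
    exists (Rmin dl (t - b)); first by apply: Rmin_glb_lt; lra.
    move=> s hs st; have := Rmin_l dl (t - b); have := Rmin_r dl (t - b) => m1 m2.
    have := Rle_abs (- (s - t)); rewrite Rabs_Ropp => m3.
    by rewrite !rr; try lra; apply: h; lra.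
- by rewrite rl.
- by rewrite rr.
Qed.

(** Equality propagates in time: near a common value by local injectivity, and near a time where the
    lifts differ because they keep differing by continuity. *)
Lemma lift_unique x a b e e1 e2 : a <= b -> lift x a b e e1 -> lift x a b e e2 -> e1 = e2.
Proof.
move=> ab [p [p1 p2 p3 p4]] [p' [p1' p2' p3' p4']].
suff : p a = p' a -> p b = p' b by rewrite p3 p3' p4 p4'; apply.
apply: (@interval_induction (fun c d => p c = p' c -> p d = p' d)) => //.
  by move=> c d f _ _ _ _ h1 h2 /h1/h2.
move=> t ht; case: (classic (p t = p' t)) => [pp|pp].
  have [r r0 hr] := local_inj (p t).
  have [d1 d10 h1] := p2 t ht r r0.
  have [d2 d20 h2] := p2' t ht r r0.
  exists (Rmin d1 d2); first exact: Rmin_glb_lt.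
  move=> c d ac cd db ct dt _; apply: hr.
  - by apply: h1; [lra|have := Rmin_l d1 d2; lra].
  - by rewrite pp; apply: h2; [lra|have := Rmin_r d1 d2; lra].
  - by rewrite p1 ?p1' //; lra.
have [u hu] : exists u, co (p t) u <> co (p' t) u.
  apply: NNPP => nE; apply: pp; apply: co_inj; apply: functional_extensionality => u.
  by apply: NNPP => ne; apply: nE; exists u.
pose eps := Rabs (co (p t) u - co (p' t) u) / 2.
have eps0 : 0 < eps by have := Rabs_pos_lt (co (p t) u - co (p' t) u) ltac:(lra); rewrite /eps; lra.
have [d1 d10 h1] := p2 t ht eps eps0.
have [d2 d20 h2] := p2' t ht eps eps0.
exists (Rmin d1 d2); first exact: Rmin_glb_lt.
move=> c d ac cd db ct dt pc.
have m1 := h1 c ltac:(lra) ltac:(have := Rmin_l d1 d2; lra) u.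
have m2 := h2 c ltac:(lra) ltac:(have := Rmin_r d1 d2; lra) u.
rewrite -pc in m2.
have := Rabs_triang (co (p t) u - co (p c) u) (co (p c) u - co (p' t) u).
have -> : co (p t) u - co (p c) u + (co (p c) u - co (p' t) u) = co (p t) u - co (p' t) u by ring.
rewrite Rabs_minus_sym in m1; rewrite /eps in m1 m2; lra.
Qed.

(* Lifting over [a, b] for the point [x0], together with its continuous dependence on nearby
   points. *)
Definition tube x0 a b := forall e, q e = G x0 a -> exists e', lift x0 a b e e' /\
  forall eps', 0 < eps' -> exists eps O, [/\ 0 < eps, opn O, O x0 & forall x, O x -> U x ->
    forall e1, q e1 = G x a -> near (co e1) (co e) eps ->
    exists e1', lift x a b e1 e1' /\ near (co e1') (co e') eps'].

Lemma tube_trans x0 a b c : a <= b -> b <= c -> tube x0 a b -> tube x0 b c -> tube x0 a c.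
Proof.
move=> ab bc t1 t2 e qe; have [e' [l1 h1]] := t1 e qe.
have qe' : q e' = G x0 b by case: l1 => p [p1 _ _ <-]; rewrite p1 //; lra.
have [e'' [l2 h2]] := t2 e' qe'.
exists e''; split; first exact: lift_trans l1 l2.
move=> eps'' e0; have [eps' [O2 [e0' o2 O2x h2']]] := h2 _ e0.
have [eps [O1 [e1 o1 O1x h1']]] := h1 _ e0'.
exists eps, (fun x => O1 x /\ O2 x); split=> //; first exact: B_open_and.
move=> x [O1x' O2x'] Ux w qw nw.
have [w' [lw nw']] := h1' x O1x' Ux w qw nw.
have qw' : q w' = G x b by case: lw => p [p1 _ _ <-]; rewrite p1 //; lra.
have [w'' [lw' nw'']] := h2' x O2x' Ux w' qw' nw'.
by exists w''; split=> //; apply: lift_trans lw lw'.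
Qed.

Lemma lift_section x C f c d : U x -> 0 <= c -> c <= d -> d <= 1 -> sec_cont C f ->
  (forall b, C b -> q (f b) = b) -> (forall s, c <= s <= d -> C (G x s)) ->
  lift x c d (f (G x c)) (f (G x d)).
Proof.
move=> Ux c0 cd d1 fc fq hC; exists (fun s => f (G x s)); split=> //.
  by move=> t ht; apply: fq; apply: hC.
move=> t ht eps e0; have [O [o Ob h]] := fc _ (hC t ht) eps e0.
have [O' [dl [_ O'x d0 h']]] := G_cont Ux (ltac:(lra) : 0 <= t <= 1) o Ob.
exists dl => // s hs st; apply: h; last exact: hC.
by apply: h' => //; lra.
Qed.

Lemma tube_total x0 : U x0 -> tube x0 0 1.
Proof.
move=> Ux; apply: interval_induction; first lra.
  by move=> c d f _ cd df _; apply: tube_trans.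
move=> t ht; have [C [oC Cb sC]] := local_sections (G x0 t).
have [O0 [dl [o0 O0x d0 h0]]] := G_cont Ux ht oC Cb.
exists dl => // c d c0 cd d1 ct dt.
have bt s : c <= s <= d -> Rabs (s - t) < dl.
  move=> hs; apply: Rabs_def1; have := Rle_abs (d - t); have := Rle_abs (- (c - t)); rewrite Rabs_Ropp; lra.
have inC x s : O0 x -> U x -> c <= s <= d -> C (G x s).
  by move=> Ox Ux' hs; apply: h0 => //; [lra|apply: bt].
move=> e qe; have [|f [fc fq fe]] := sC e; first by rewrite qe; apply: inC; lra || done.
rewrite qe in fe.
exists (f (G x0 d)); split.
  by rewrite -fe; apply: (@lift_section _ C) => // s hs; apply: inC.
move=> eps' e0'; have [r r0 hr] := local_inj e.
have [O1 [o1 O1b h1]] := fc (G x0 c) (inC x0 c O0x Ux ltac:(lra)) r r0.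
have [O2 [o2 O2b h2]] := fc (G x0 d) (inC x0 d O0x Ux ltac:(lra)) eps' e0'.
have [P1 [dl1 [op1 P1x dl10 hp1]]] := G_cont Ux (ltac:(lra) : 0 <= c <= 1) o1 O1b.
have [P2 [dl2 [op2 P2x dl20 hp2]]] := G_cont Ux (ltac:(lra) : 0 <= d <= 1) o2 O2b.
exists r, (fun x => O0 x /\ (P1 x /\ P2 x)); split=> //.
  by apply: B_open_and => //; apply: B_open_and.
move=> x [O0x' [P1x' P2x']] Ux' e1 qe1 ne1.
have Cc : C (G x c) by apply: inC; lra || done.
have Cd : C (G x d) by apply: inC; lra || done.
have ee : f (G x c) = e1.
  apply: hr => //; last by rewrite fq ?qe1.
  rewrite -fe; apply: h1 => //; apply: hp1; rewrite ?Rminus_diag ?Rabs_R0 //; lra.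
exists (f (G x d)); split.
  by rewrite -ee; apply: (@lift_section _ C) => // s hs; apply: inC.
apply: h2 => //; apply: hp2; rewrite ?Rminus_diag ?Rabs_R0 //; lra.
Qed.

Variables (e0 : E).
Hypothesis G0 : forall x, U x -> G x 0 = q e0.
Hypothesis G1 : forall x, U x -> G x 1 = x.

Theorem lifted_section : exists f, sec_cont U f /\ forall x, U x -> q (f x) = x.
Proof.
pose f x := epsilon (inhabits e0) (fun e => lift x 0 1 e0 e).
have fP x : U x -> lift x 0 1 e0 (f x).
  move=> Ux; apply: epsilon_spec.
  have [|e' [l _]] := @tube_total x Ux e0; first by rewrite G0.
  by exists e'.
exists f; split; last first.
  by move=> x Ux; have [p [p1 _ _ <-]] := fP x Ux; rewrite p1 ?G1 //; lra.
move=> x Ux eps eps0.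
have [|e' [l h]] := @tube_total x Ux e0; first by rewrite G0.
have -> : f x = e' by apply: lift_unique l; [lra|apply: fP].
have [dl [O [dl0 o Ox h']]] := h eps eps0.
exists O; split=> // x' Ox' Ux'.
have [e1 [l1 n1]] := h' x' Ox' Ux' e0 (esym (G0 Ux')) (near_refl _ dl0).
by have -> : f x' = e1 by apply: lift_unique l1; [lra|apply: fP].
Qed.
End Lifting.

(* The contraction is run backwards: the lift then starts at a constant, and its end is a
   section. *)
Lemma contractible_path n k (U : unordered n k -> Prop) :
  contractible_in (B_space n k) U ->
  exists (G : unordered n k -> R -> unordered n k) b0,
   [/\ forall x, U x -> G x 0 = b0, forall x, U x -> G x 1 = x &
    forall x t, U x -> 0 <= t <= 1 -> forall C, is_open (B_space n k) C -> C (G x t) ->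
    exists O dl, [/\ is_open (B_space n k) O, O x, 0 < dl &
    forall x' s, O x' -> U x' -> 0 <= s <= 1 -> Rabs (s - t) < dl -> C (G x' s)]].
Proof.
move=> [H [b0 [Hc H01]]].
exists (fun x t => H (x, 1 - t)), b0; split.
- by move=> x /H01 [_]; rewrite Rminus_0_r.
- by move=> x /H01 [h _]; rewrite Rminus_diag.
move=> x t Ux ht C oC CG.
have [W [oW hW]] := Hc C oC.
have Wx : W (x, 1 - t) by apply/hW => //=; split=> //; lra.
have [O [V [oO [oV [Ox [Vt OV]]]]]] := oW _ Wx.
have [dl [d0 hd]] := oV _ Vt.
exists O, dl; split=> // x' s Ox' Ux' hs st.
apply/hW => /=; first by split=> //; lra.
apply: OV => //; apply: hd => /=.
by have -> : 1 - s - (1 - t) = - (s - t) by [ring]; rewrite Rabs_Ropp.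
Qed.

Lemma sec_cont_cont_on n k (X : Defs.space) (J : Type) (co : pt X -> J -> R)
   (U : unordered n k -> Prop) (f : unordered n k -> pt X) :
  (forall O e, is_open X O -> O e -> exists2 eps, 0 < eps & forall e', near (co e') (co e) eps -> O e') ->
  sec_cont co U f -> cont_on (B_space n k) X U f.
Proof.
move=> opX fc O oO.
exists (fun b => exists W, [/\ is_open (B_space n k) W, W b & forall b', W b' -> U b' -> O (f b')]).
split.
  move=> c [W [oW Wc hW]]; have [e [e0 h]] := oW _ Wc.
  by exists e; split=> // d hd; exists W; split=> //; apply: h.
move=> x Ux; split=> [Ofx|[W [_ Wx hW]]]; last exact: hW.
have [eps e0 h] := opX O _ oO Ofx.
have [W [oW Wx hW]] := fc x Ux eps e0.
by exists W; split=> // b' Wb Ub; apply: h; apply: hW.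
Qed.

(** * Charts of the quotient covering, and secat at most cat *)

Section Charts.
Variables (k m : nat).
Notation n := m.+1.
Notation pnt := ('I_k.+1 * 'I_m.+1 -> R).
Notation cfgT := (config n k.+1).
Notation pi := (pi_conf n k.+1).
Notation opn := (is_open (B_space n k.+1)).

Lemma near_act t (x y : pnt) e : near x y e -> near (act_pt t x) (act_pt t y) e.
Proof. by move=> h [a i]; apply: h. Qed.

Lemma act_cfg t (c : cfgT) : exists d : cfgT, coords d = act_pt t (coords c).
Proof. by apply: coords_surj; apply: distinct_act; apply: coords_distinct. Qed.

Lemma act_ptK t (x : pnt) : act_pt t^-1%g (act_pt t x) = x.
Proof. by apply: functional_extensionality => -[a i]; rewrite /act_pt /= invgK permK. Qed.

Lemma pi_open (O : pnt -> Prop) :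
  (forall y, O y -> exists2 r, 0 < r & forall z, near z y r -> O z) ->
  opn (fun b : unordered n k.+1 => exists2 d, pi d = b & O (coords d)).
Proof.
move=> oO; apply: F_open_intro => f [d /pi_eq/same_orbit_perm [t et] Od].
have [r r0 hr] := oO _ Od.
exists r => // f' nf; have [d' ed'] := act_cfg t^-1%g f'.
exists d'; first exact: pi_act ed'.
by apply: hr; rewrite ed' -(act_ptK t (coords d)) -et; apply: near_act.
Qed.

Lemma ball_open (c : cfgT) e : opn (fun b => exists2 d, pi d = b & near (coords d) (coords c) e).
Proof.
apply: (pi_open (O := fun y => near y (coords c) e)) => y ny.
have [|eps e0 he] := @pos_bound _ (fun u => e - Rabs (y u - coords c u)).
  by move=> u /=; have := ny u; lra.
exists eps => // z nz u; have h1 := nz u; have /= h2 := he u.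
have -> : z u - coords c u = (z u - y u) + (y u - coords c u) by ring.
by apply: Rle_lt_trans (Rabs_triang _ _) _; lra.
Qed.

(** A permutation relating two configurations that are both within [dl / 4] of [c] would, if not
    trivial, bring two distinct points of [c] within [dl / 2] of each other. *)
Lemma orbit_sep (c : cfgT) : exists2 r, 0 < r & forall d d' : cfgT, pi d = pi d' ->
  near (coords d) (coords c) r -> near (coords d') (coords c) r -> d = d'.
Proof.
have [dl dl0 sep] := distinct_sep (coords_distinct c).
exists (dl / 4) => [|d d' /pi_eq/same_orbit_perm [t et] nd nd']; first lra.
apply: coords_inj; rewrite et; apply: functional_extensionality => -[a i]; rewrite /act_pt /=.
suff -> : (t^-1)%g a = a by [].
apply: NNPP => ne; have [l hl] := sep _ _ ne.
have h1 := nd (t^-1%g a, l).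
have h2 : Rabs (coords d (t^-1%g a, l) - coords c (a, l)) < dl / 4 by have := nd' (a, l); rewrite et.
have := Rabs_triang (coords d (t^-1%g a, l) - coords c (a, l)) (- (coords d (t^-1%g a, l) - coords c (t^-1%g a, l))).
rewrite Rabs_Ropp.
have -> : coords d (t^-1%g a, l) - coords c (a, l) + - (coords d (t^-1%g a, l) - coords c (t^-1%g a, l)) = coords c (t^-1%g a, l) - coords c (a, l) by ring.
move=> h3; apply: (Rlt_irrefl dl); apply: Rle_lt_trans hl _; apply: Rle_lt_trans h3 _.
by apply: Rlt_le_trans (Rplus_lt_compat _ _ _ _ h2 h1) _; lra.
Qed.

Lemma chart (c : cfgT) r1 : 0 < r1 -> exists r C (f : unordered n k.+1 -> cfgT),
  [/\ 0 < r <= r1, opn C /\ C (pi c), sec_cont (@coords k m) C f,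
      forall b, C b -> pi (f b) = b /\ near (coords (f b)) (coords c) r &
      forall d, near (coords d) (coords c) r -> f (pi d) = d].
Proof.
move=> r10; have [r r0 hr] := orbit_sep c.
pose r2 := Rmin r r1.
have r20 : 0 < r2 by apply: Rmin_glb_lt.
have r2r : r2 <= r by apply: Rmin_l.
pose C b := exists2 d, pi d = b & near (coords d) (coords c) r2.
pose f b := epsilon (inhabits c) (fun d => pi d = b /\ near (coords d) (coords c) r2).
have fP b : C b -> pi (f b) = b /\ near (coords (f b)) (coords c) r2.
  by move=> [d d1 d2]; apply: (epsilon_spec (inhabits c) (fun d => pi d = b /\ near (coords d) (coords c) r2)); exists d.
have fd d : near (coords d) (coords c) r2 -> f (pi d) = d.
  move=> nd; have [h1 h2] := fP (pi d) (ex_intro2 _ _ d erefl nd).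
  by apply: hr => //; [exact: near_le h2 r2r|exact: near_le nd r2r].
exists r2, C, f; split=> //.
- by split=> //; apply: Rmin_r.
- by split; [apply: ball_open|exists c => //; apply: near_refl].
move=> b Cb e e0; have [h1 h2] := fP b Cb.
have [|eps eps0 he] := @pos_bound _ (fun u => r2 - Rabs (coords (f b) u - coords c u)).
  by move=> u /=; have := h2 u; lra.
exists (fun b' => exists2 d, pi d = b' & near (coords d) (coords (f b)) (Rmin e eps)); split.
- exact: ball_open.
- by exists (f b) => //; apply: near_refl; apply: Rmin_glb_lt.
move=> b' [d <- nd] _; rewrite fd; first by apply: near_le nd _; apply: Rmin_l.
move=> u; have h3 := nd u; have /= h4 := he u.
have -> : coords d u - coords c u = (coords d u - coords (f b) u) + (coords (f b) u - coords c u) by ring.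
apply: Rle_lt_trans (Rabs_triang _ _) _; have := Rmin_r e eps; lra.
Qed.

(** A chart is one sheet; the permutation that carries its value over [pi e] to [e] carries the
    sheet to the one through [e]. *)
Lemma conf_local_sections b0 : exists C, [/\ opn C, C b0 &
  forall e : cfgT, C (pi e) -> exists f, [/\ sec_cont (@coords k m) C f, forall b, C b -> pi (f b) = b & f (pi e) = e]].
Proof.
have [c ->] := pi_surj b0.
have [r [C [f [_ [oC Cc] fc fP fd]]]] := @chart c 1 ltac:(lra).
exists C; split=> // e Ce.
have [h1 h2] := fP _ Ce.
have /pi_eq/same_orbit_perm [t et] := h1.
pose g b := proj1_sig (constructive_indefinite_description _ (act_cfg t (f b))).
have gP b : coords (g b) = act_pt t (coords (f b)).
  exact: (proj2_sig (constructive_indefinite_description _ (act_cfg t (f b)))).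
exists g; split.
- move=> b Cb eps e0; have [O [oO Ob h]] := fc b Cb eps e0.
  by exists O; split=> // b' Ob' Cb'; rewrite !gP; apply: near_act; apply: h.
- by move=> b Cb; rewrite (pi_act (gP b)); case: (fP b Cb).
- by apply: coords_inj; rewrite gP et.
Qed.

Lemma conf_local_inj (c : cfgT) : exists2 r, 0 < r & forall e1 e2 : cfgT,
  near (coords e1) (coords c) r -> near (coords e2) (coords c) r -> pi e1 = pi e2 -> e1 = e2.
Proof.
by have [r r0 h] := orbit_sep c; exists r => // e1 e2 n1 n2 e12; apply: h.
Qed.

Lemma contractible_section U : contractible_in (B_space n k.+1) U ->
  exists s, cont_on (B_space n k.+1) (F_space n k.+1) U s /\ forall b, U b -> pi (s b) = b.
Proof.
move=> /contractible_path [G [b0 [G0 G1 Gc]]].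
have [e0 eb0] := pi_surj b0; rewrite {}eb0 in G0.
have [f [fc fq]] := @lifted_section n k.+1 cfgT _ (@coords k m) pi (@coords_inj k m) conf_local_sections conf_local_inj U G Gc e0 G0 G1.
exists f; split=> //.
apply: (@sec_cont_cont_on _ _ (F_space n k.+1) _ (@coords k m)) fc => O e oO Oe.
have [eps eps0 h] := F_openP oO Oe.
by exists eps.
Qed.

Lemma cat_secat M : cat_le (B_space n k.+1) M ->
  secat_le (F_space n k.+1) (B_space n k.+1) pi M.
Proof.
move=> [U [Uo [Uc Ux]]]; exists U; split=> //; split=> // i iM.
exact: contractible_section (Ux i iM).
Qed.
End Charts.

End Lifting.

(** * The upper bound by Fox-Neuwirth strata *)

Module Strata.

Import Reals Lra.
Import ClassicalEpsilon FunctionalExtensionality.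
Import all_boot all_fingroup zify.
Import PointLabels ConfigurationSpaces Lifting.
Set Implicit Arguments. Unset Strict Implicit.
Local Open Scope R_scope.

(** The minimal elements are in bijection with the classes, so the count does not depend on the
    numbering of the elements. *)
Lemma card_nonminimal (N : nat) (e e' : rel 'I_N) (t : 'S_N) :
  equivalence_rel e -> equivalence_rel e' -> (forall a b, e' (t a) (t b) = e a b) ->
  #|[set a : 'I_N | [exists b : 'I_N, (b < a)%N && e' a b]]| =
  #|[set a : 'I_N | [exists b : 'I_N, (b < a)%N && e a b]]|.
Proof.
pose cls (r : rel 'I_N) a : {set 'I_N} := [set b | r a b].
have main (r : rel 'I_N) : equivalence_rel r ->
    #|~: [set a : 'I_N | [exists b : 'I_N, (b < a)%N && r a b]]| = #|[set cls r a | a : 'I_N]|.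
  move=> /equivalence_relP [rr rt].
  have rs a b : r a b -> r b a by move=> /rt; rewrite /left_transitive => /(_ a) <-; apply: rr.
  rewrite -(@card_in_imset _ _ (cls r)); last first.
    move=> a b; rewrite !inE => /existsPn ha /existsPn hb /setP h.
    have rab : r a b by have := h b; rewrite !inE rr.
    apply: val_inj; case: (ltngtP a b) => // lt.
      by have := hb a; rewrite lt rs.
    by have := ha b; rewrite lt rab.
  congr #|pred_of_set _|; apply/setP => S; apply/imsetP/imsetP => [[a _ ->]|[a _ ->]]; first by exists a.
  case: (arg_minnP (P := fun b => r a b) (fun b : 'I_N => b : nat) (rr a)) => b rab mn.
  exists b.
    rewrite !inE; apply/existsPn => c; apply/negP => /andP[cb rbc].
    have : r a c by rewrite (rt _ _ rab).
    by move/mn; rewrite leqNgt cb.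
  by apply/setP => c; rewrite !inE (rt _ _ rab).
move=> eqe eqe' h.
have : #|[set cls e' a | a : 'I_N]| = #|[set cls e a | a : 'I_N]|.
  rewrite -[RHS](card_imset _ (imset_inj (@perm_inj _ t))).
  congr #|pred_of_set _|.
  have ct a : cls e' (t a) = t @: cls e a.
    by apply/setP => b; rewrite -[b](permKV t) mem_imset ?inE ?h //; apply: perm_inj.
  apply/setP => S; apply/imsetP/imsetP => [[a _ ->]|[S' /imsetP[a _ ->] ->]].
    by exists (cls e (t^-1%g a)); rewrite ?imset_f // -ct permKV.
  by exists (t a); rewrite ?ct.
rewrite -!main // => hc.
by have := cardsC [set a : 'I_N | [exists b : 'I_N, (b < a)%N && e' a b]];
   have := cardsC [set a : 'I_N | [exists b : 'I_N, (b < a)%N && e a b]]; lia.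
Qed.

Lemma increasing_perm N (t : 'S_N) : (forall a b : 'I_N, (a < b)%N -> (t a < t b)%N) -> t = 1%g.
Proof.
move=> inc; apply/permP => a; rewrite perm1.
have [l] := ubnP (a : nat); elim: l a => // l IH a; rewrite ltnS => al.
apply: val_inj => /=; case: (ltngtP (t a) a) => // lt.
  have := IH (t a); move/(_ ltac:(lia)) => /perm_inj e.
  by move: lt; rewrite e ltnn.
set b := t^-1%g a.
have tb : t b = a by rewrite permKV.
have ba : (b < a)%N.
  rewrite ltnNge leq_eqVlt; apply/negP => /predU1P[/val_inj ab|ab].
    by move: lt; rewrite -ab in tb; rewrite tb ltnn.
  by have := inc _ _ ab; rewrite tb; lia.
by have := IH b; move/(_ ltac:(lia)); rewrite tb => ab; move: ba; rewrite ab ltnn.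
Qed.

Section Upper.
Variables (k m : nat).
Notation n := m.+1.
Notation pnt := ('I_k.+1 * 'I_m.+1 -> R).
Notation cfgT := (config n k.+1).
Notation pi := (pi_conf n k.+1).
Notation opn := (is_open (B_space n k.+1)).
Implicit Types (x y z : pnt) (a b : 'I_k.+1) (t : 'S_k.+1).

Definition agree x (l : nat) a b :=
  [forall i : 'I_m.+1, (i < l)%N ==> (Req_dec_T (x (a, i)) (x (b, i)) : bool)].

Lemma agreeP x l a b : reflect (forall i : 'I_m.+1, (i < l)%N -> x (a, i) = x (b, i)) (agree x l a b).
Proof.
apply: (iffP forallP) => h i; last by apply/implyP => /h e; case: Req_dec_T.
by move/implyP: (h i) => h' /h'; case: Req_dec_T.
Qed.

Lemma agree_equiv x l : equivalence_rel (agree x l).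
Proof.
apply/equivalence_relP; split=> [a|a b /agreeP ab c]; first exact/agreeP.
by apply/agreeP/agreeP => h i il; rewrite -?h ?ab //.
Qed.

(* The codimension of the Fox-Neuwirth stratum: each level [l] contributes [k + 1] minus the
   number of classes of points that share their first [l + 1] coordinates. *)
Definition codim x : nat :=
  (\sum_(l < m) #|[set a : 'I_k.+1 | [exists b : 'I_k.+1, (b < a)%N && agree x l.+1 a b]]|)%N.

Lemma codim_act t x : codim (act_pt t x) = codim x.
Proof.
apply: eq_bigr => l _; apply: (card_nonminimal (t := t)) => [||a b]; try exact: agree_equiv.
by apply/agreeP/agreeP => h i il; have := h i il; rewrite /act_pt /= !permK.
Qed.

Lemma codim_le x : (codim x <= k * m)%N.
Proof.
rewrite /codim; apply: (@leq_trans (\sum_(l < m) k)%N); last by rewrite sum_nat_const card_ord mulnC.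
apply: leq_sum => l _; rewrite -ltnS -[X in (_ < X)%N](card_ord k.+1) -[X in (_ < X)%N]cardsT.
apply: proper_card; apply/properP; split; first exact: subsetT.
by exists ord0; rewrite ?inE //; apply/existsPn.
Qed.

Definition sorted_conf x := forall a b, (a < b)%N -> lexlt x a b.

(** The coordinate [i] is determined by [x]; the condition on [z] is thus a system of strict linear
    inequalities, preserved along segments. *)
Definition adapted x z := forall a b, (a < b)%N -> exists i : 'I_m.+1,
  agree x i a b /\ ~ agree x i.+1 a b /\ z (a, i) < z (b, i).

Lemma adapted_distinct x z : adapted x z -> distinct z.
Proof.
move=> V a b ab; case: (ltngtP a b) => lt; last by case: ab; apply: val_inj.
  by have [i [_ [_ h]]] := V _ _ lt; exists i; lra.
by have [i [_ [_ h]]] := V _ _ lt; exists i; lra.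
Qed.

Lemma agree_le x (i j : nat) a b : (i <= j)%N -> agree x j a b -> agree x i a b.
Proof. by move=> ij /agreeP h; apply/agreeP => u ui; apply: h; apply: leq_trans ij. Qed.

Lemma adapted_agree x z l a b : adapted x z -> agree z l a b -> agree x l a b.
Proof.
move=> V; wlog ab : a b / (a < b)%N.
  move=> W h; case: (ltngtP a b) => lt; first exact: W.
    have sym w : agree w l a b = agree w l b a by apply/agreeP/agreeP => h' i il; rewrite h'.
    by rewrite sym; apply: W => //; rewrite -sym.
  by rewrite (val_inj lt); apply/agreeP.
move=> /agreeP h; have [i [h1 [h2 h3]]] := V a b ab.
case: (ltnP i l) => il; first by have := h i il; lra.
exact: agree_le il h1.
Qed.

(** Points that agree up to a level in [z] do so in [x]. Equal codimensions force the same
    nonminimal points at every level, then, by induction on the larger point of a pair, the same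
    classes. *)
Lemma adapted_sorted x z : adapted x z -> codim x = codim z -> sorted_conf z.
Proof.
move=> V cE.
pose S w l := [set a : 'I_k.+1 | [exists b : 'I_k.+1, (b < a)%N && agree w l a b]].
have sub l : S z l \subset S x l.
  apply/subsetP => a; rewrite !inE => /existsP[b /andP[ba h]].
  by apply/existsP; exists b; rewrite ba (adapted_agree V h).
have Seq (l : 'I_m) : S z l.+1 = S x l.+1.
  apply/eqP; rewrite eqEcard sub /= leqNgt; apply/negP => lt.
  suff : (codim z < codim x)%N by rewrite cE ltnn.
  rewrite /codim (bigD1 l) //= [X in (_ < X)%N](bigD1 l) //= -addSn.
  apply: leq_add => //; apply: leq_sum => i _; exact: (subset_leq_card (sub i.+1)).
have agrS (l : 'I_m) a b : agree x l.+1 a b -> agree z l.+1 a b.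
  have sym w c d : agree w l.+1 c d = agree w l.+1 d c by apply/agreeP/agreeP => h' i il; rewrite h'.
  have tr w c d f : agree w l.+1 c d -> agree w l.+1 d f -> agree w l.+1 c f.
    by move=> /agreeP h1 /agreeP h2; apply/agreeP => i il; rewrite h1 ?h2.
  suff main N (c d : 'I_k.+1) : (c < N)%N -> (d < c)%N -> agree x l.+1 c d -> agree z l.+1 c d.
    case: (ltngtP a b) => lt h.
    - by rewrite sym; apply: (main b.+1) => //; rewrite sym.
    - exact: (main a.+1).
    - by rewrite (val_inj lt); apply/agreeP.
  elim: N c d => // N IH c d; rewrite ltnS => cN dc h.
  have : c \in S z l.+1 by rewrite Seq inE; apply/existsP; exists d; rewrite dc.
  rewrite inE => /existsP[d' /andP[d'c h']].
  apply: (tr _ _ _ _ h').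
  have hx : agree x l.+1 d' d by apply: tr h; rewrite sym; apply: adapted_agree h'.
  case: (ltngtP d' d) => lt.
  - by rewrite sym; apply: IH; rewrite ?(sym _ d d') //; lia.
  - by apply: IH => //; lia.
  - by rewrite (val_inj lt); apply/agreeP.
move=> a b ab; have [i [h1 [h2 h3]]] := V a b ab.
exists i; split=> //; case: i h1 h2 h3 => -[|i] im h1 h2 h3 i' //= i'i.
have im' : (i < m)%N by [].
by have /agreeP := agrS (Ordinal im') a b h1; apply.
Qed.

Lemma sorted_adapted x : sorted_conf x -> adapted x x.
Proof.
move=> sx a b ab; have [i [h1 h2]] := sx a b ab; exists i; split; first exact/agreeP.
split=> // /agreeP /(_ i (ltnSn _)); lra.
Qed.

Lemma adapted_open x : sorted_conf x -> exists2 r, 0 < r & forall z, near z x r -> adapted x z.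
Proof.
move=> sx; have V := sorted_adapted sx.
have P (u : 'I_k.+1 * 'I_k.+1) : exists e, 0 < e /\ ((u.1 < u.2)%N -> exists i : 'I_m.+1,
    agree x i u.1 u.2 /\ ~ agree x i.+1 u.1 u.2 /\ e <= x (u.2, i) - x (u.1, i)).
  case: (ltnP u.1 u.2) => lt; last by exists 1; split=> //; lra.
  have [i [h1 [h2 h3]]] := V _ _ lt; exists (x (u.2, i) - x (u.1, i)); split; first lra.
  by move=> _; exists i; split=> //; split=> //; lra.
pose f u := proj1_sig (constructive_indefinite_description _ (P u)).
have fP u := proj2_sig (constructive_indefinite_description _ (P u)).
have [e e0 he] := @pos_bound _ f (fun u => (fP u).1).
exists (e / 2) => [|z nz a b ab]; first lra.
have [i [h1 [h2 h3]]] := (fP (a, b)).2 ab; exists i; split=> //; split=> //.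
have h4 : e <= x (b, i) - x (a, i) := Rle_trans _ _ _ (he (a, b)) h3.
have [g1 g2] := Rabs_def2 _ _ (nz (a, i)); have [g3 g4] := Rabs_def2 _ _ (nz (b, i)); lra.
Qed.

(* This configuration is adapted to every sorted one, so all strata contract to it along
   straight lines. *)
Definition base : pnt := fun u => INR u.1.

Lemma base_adapted x z s : adapted x z -> 0 <= s <= 1 ->
  adapted x (fun u => (1 - s) * z u + s * base u).
Proof.
move=> V hs a b ab; have [i [h1 [h2 h3]]] := V a b ab; exists i; split=> //; split=> //.
rewrite /base /=.
have lt : INR a < INR b by apply: lt_INR; apply/ltP.
case: (Rle_lt_dec s (1 / 2)) => s2; nra.
Qed.

Lemma base_distinct : distinct base.
Proof.
move=> a b ab; exists ord0; rewrite /base /= => /INR_eq e; apply: ab; exact: val_inj.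
Qed.

(** The factor 2 leaves room for two balls: if balls around two centres meet, the centre of the
    smaller one is still adapted to the other centre. *)
Definition near_stratum (c : nat) y := exists x r, [/\ sorted_conf x, codim x = c, 0 < r,
  (forall z, near z x (2 * r) -> adapted x z) & near y x r].

Lemma near_stratum_open c y : near_stratum c y ->
  exists2 r, 0 < r & forall z, near z y r -> near_stratum c z.
Proof.
move=> [x [r [h1 h2 h3 h4 h5]]].
have [|eps e0 he] := @pos_bound _ (fun u => r - Rabs (y u - x u)).
  by move=> u /=; have := h5 u; lra.
exists eps => // z nz; exists x, r; split=> // u.
have /= h6 := he u; have h7 := nz u.
have -> : z u - x u = (z u - y u) + (y u - x u) by ring.
by apply: Rle_lt_trans (Rabs_triang _ _) _; lra.
Qed.

(** After moving the centre of the smaller ball back by [t], it is adapted to the other centre and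
    has the same codimension, hence is sorted. A permutation from a sorted configuration to a sorted
    one is increasing. *)
Lemma near_stratum_free c y t : near_stratum c y -> near_stratum c (act_pt t y) -> t = 1%g.
Proof.
have main y' t' x r x' r' : sorted_conf x -> sorted_conf x' -> codim x = codim x' ->
  (forall z, near z x (2 * r) -> adapted x z) -> near y' x r -> near (act_pt t' y') x' r' ->
  r' <= r -> t' = 1%g.
  move=> sx sx' cxx V ny ny' rr.
  pose z := act_pt t'^-1%g x'.
  have zx : near z x (2 * r).
    have : near z y' r'.
      by apply: near_sym; rewrite -(act_ptK t' y'); apply: near_act.
    by move=> /near_trans /(_ ny) /near_le; apply; lra.
  have sz : sorted_conf z by apply: adapted_sorted (V z zx) _; rewrite codim_act.
  have x'E : x' = act_pt t' z by rewrite /z -{1}(invgK t') act_ptK.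
  apply: increasing_perm => a b ab; case: (ltngtP (t' a) (t' b)) => // lt.
    have := sx' _ _ lt; rewrite x'E => -[i [h1 h2]].
    have : lexlt z b a.
      by exists i; split=> [|i' ii]; [move: h1|have := h2 i' ii]; rewrite /act_pt /= !permK.
    by move/lexlt_asym; case; apply: sz.
  by move: ab; rewrite (perm_inj (val_inj lt)) ltnn.
move=> [x [r [s1 c1 r1 V1 n1]]] [x' [r' [s2 c2 r2 V2 n2]]].
case: (Rle_lt_dec r' r) => rr.
  by apply: (main y t x r x' r') => //; rewrite c1 c2.
have : (t^-1)%g = 1%g.
  apply: (main (act_pt t y) _ x' r' x r) => //; first by rewrite c1 c2.
    by rewrite act_ptK.
  lra.
by move/(congr1 (fun g => g^-1)%g); rewrite invgK invg1.
Qed.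

Lemma near_stratum_adapted c y : near_stratum c y -> exists x, adapted x y.
Proof.
move=> [x [r [_ _ r0 V ny]]]; exists x; apply: V; apply: near_le ny _; lra.
Qed.

Lemma exists_sorted x : distinct x -> exists t, sorted_conf (act_pt t x).
Proof.
move=> dx.
pose lb u v : bool := excluded_middle_informative (lexlt x u v).
have lbP u v : reflect (lexlt x u v) (lb u v).
  by rewrite /lb; case: excluded_middle_informative => h; constructor.
have irr u : ~ lexlt x u u by move=> h; apply: (lexlt_asym h).
have cb u : (#|[set v | lb v u]| < k.+1)%N.
  rewrite -[X in (_ < X)%N](card_ord k.+1) -[X in (_ < X)%N]cardsT; apply: proper_card.
  apply/properP; split; first exact: subsetT.
  by exists u => //; rewrite inE; apply/lbP/irr.
pose rk u : 'I_k.+1 := Ordinal (cb u).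
have mon u v : lexlt x u v -> (rk u < rk v)%N.
  move=> uv; apply: proper_card; apply/properP; split.
    by apply/subsetP => w; rewrite !inE => /lbP wu; apply/lbP; apply: lexlt_trans uv.
  by exists u; rewrite inE; [apply/lbP|apply/lbP/irr].
have inj : injective rk.
  move=> u v e; apply: NNPP => ne; case: (lexlt_total dx ne) => /mon; rewrite e ltnn //.
exists (perm inj) => a b ab.
set u := (perm inj)^-1%g a; set v := (perm inj)^-1%g b.
have ua : rk u = a by rewrite -[RHS](permKV (perm inj)) permE.
have vb : rk v = b by rewrite -[RHS](permKV (perm inj)) permE.
have ne : u <> v by move=> uv; move: ab; rewrite -ua -vb uv ltnn.
case: (lexlt_total dx ne) => [[i h]|/mon]; first by exists i.
by rewrite ua vb; lia.
Qed.

Definition mkconf (x : pnt) : cfgT := epsilon (inhabits (proj1_sig (constructive_indefinite_description _ (coords_surj base_distinct)))) (fun c => coords c = x).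

Lemma mkconfP x : distinct x -> coords (mkconf x) = x.
Proof. by move=> dx; apply: (epsilon_spec _ (fun c => coords c = x)); apply: coords_surj. Qed.

Theorem cat_upper : cat_le (B_space n k.+1) (k * m).
Proof.
pose U c (b : unordered n k.+1) := exists2 d, pi d = b & near_stratum c (coords d).
have Uo c : opn (U c) by apply: pi_open; apply: near_stratum_open.
exists U; split; first by [].
split.
  move=> b; have [c0 ->] := pi_surj b.
  have [t st] := exists_sorted (coords_distinct c0).
  have [d dE] := act_cfg t c0; rewrite -dE in st.
  exists (codim (coords d)); split; first by apply/leP; apply: codim_le.
  exists d; first exact: pi_act dE.
  have [r r0 hr] := adapted_open st.
  exists (coords d), (r / 2); split=> //; first lra.
    by move=> z nz; apply: hr; apply: near_le nz _; lra.
  by apply: near_refl; lra.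
move=> c _.
pose f (b : unordered n k.+1) := epsilon (inhabits (mkconf base)) (fun d => pi d = b /\ near_stratum c (coords d)).
have fP (b : unordered n k.+1) : U c b -> pi (f b) = b /\ near_stratum c (coords (f b)).
  by move=> [d d1 d2]; apply: (epsilon_spec _ (fun d => pi d = b /\ near_stratum c (coords d))); exists d.
have fd d : near_stratum c (coords d) -> f (pi d) = d.
  move=> nd; have [|h1 h2] := fP (pi d); first by exists d.
  have /pi_eq/same_orbit_perm [t et] := esym h1.
  have t1 : t = 1%g by apply: near_stratum_free nd _; rewrite -et.
  apply: coords_inj; rewrite et t1; apply: functional_extensionality => -[a i].
  by rewrite /act_pt /= invg1 perm1.
pose h d s : pnt := fun u => (1 - s) * coords d u + s * base u.
have hdom d s : near_stratum c (coords d) -> 0 <= s <= 1 -> distinct (h d s).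
  move=> /near_stratum_adapted [x V] hs; exact: (adapted_distinct (base_adapted V hs)).
exists (fun z : unordered n k.+1 * R => pi (mkconf (h (f z.1) z.2))), (pi (mkconf base)); split; last first.
  move=> b /fP [h1 h2]; split.
    rewrite -[RHS]h1; congr pi; apply: coords_inj; rewrite mkconfP /=; last by apply: hdom => //; lra.
    by apply: functional_extensionality => u; rewrite /h; lra.
  congr pi; congr mkconf; apply: functional_extensionality => u; rewrite /h /=; lra.
move=> O oO.
exists (fun z : unordered n k.+1 * R => exists W V, [/\ opn W, is_open R_space V, W z.1, V z.2 &
  forall (b : unordered n k.+1) s, W b -> V s -> U c b -> 0 <= s <= 1 -> O (pi (mkconf (h (f b) s)))]).
split.
  move=> [b s] [W [V [oW oV Wb Vs hWV]]]; exists W, V; do 4 (split=> //).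
  by move=> b' s' Wb' Vs'; exists W, V.
move=> [b s] [/= Ub hs]; split; last by move=> [W [V [_ _ Wb Vs hWV]]]; apply: hWV.
move=> Ob; have [h1 h2] := fP b Ub.
have [eps e0 he] := F_openP oO Ob.
set d := f b in h1 h2 Ob he.
(* [M] bounds the speed of the straight line: moving [d] by [eps / 4] and the time by
   [eps / (4 * M)] moves the image by less than [eps]. *)
have [M M0 hM] : exists2 M, 0 < M & forall u, Rabs (base u - coords d u) <= M.
  have [|e e0' h'] := @pos_bound _ (fun u => / (1 + Rabs (base u - coords d u))).
    by move=> u; apply: Rinv_0_lt_compat; have := Rabs_pos (base u - coords d u); lra.
  exists (/ e); first exact: Rinv_0_lt_compat.
  move=> u; have p := Rabs_pos (base u - coords d u).
  have := Rinv_le_contravar _ _ e0' (h' u); rewrite Rinv_inv; lra.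
exists (fun b' : unordered n k.+1 => exists2 d', pi d' = b' & near_stratum c (coords d') /\ near (coords d') (coords d) (eps / 4)),
  (fun s' : R => Rabs (s' - s) < eps / (4 * M)); split.
- apply: (pi_open (O := fun y => near_stratum c y /\ near y (coords d) (eps / 4))) => y [ny nyd].
  have [r r0 hr] := near_stratum_open ny.
  have [|r' r0' hr'] := @pos_bound _ (fun u => eps / 4 - Rabs (y u - coords d u)).
    by move=> u /=; have := nyd u; lra.
  exists (Rmin r r'); first exact: Rmin_glb_lt.
  move=> z nz; split; first by apply: hr; apply: near_le nz _; apply: Rmin_l.
  move=> u; have g1 := nz u; have /= g2 := hr' u; have := Rmin_r r r'.
  have -> : z u - coords d u = (z u - y u) + (y u - coords d u) by ring.
  by move=> g3; apply: Rle_lt_trans (Rabs_triang _ _) _; lra.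
- move=> s1 /= hs1; exists (eps / (4 * M) - Rabs (s1 - s)); split; first lra.
  move=> s2 hs2; have -> : s2 - s = (s2 - s1) + (s1 - s) by ring.
  by apply: Rle_lt_trans (Rabs_triang _ _) _; lra.
- by exists d => //; split=> //; apply: near_refl; lra.
- by rewrite /= Rminus_diag Rabs_R0; apply: Rdiv_lt_0_compat; lra.
move=> b' s' [d' d'b [nd' ndd]] hs' Ub' hs01; apply: he => u.
rewrite -d'b fd // !mkconfP; [|exact: hdom|exact: hdom].
have -> : h d' s' u - h d s u = (1 - s') * (coords d' u - coords d u) + (s' - s) * (base u - coords d u).
  by rewrite /h; ring.
apply: Rle_lt_trans (Rabs_triang _ _) _; rewrite !Rabs_mult.
have g1 : Rabs (1 - s') <= 1 by apply: Rabs_le; lra.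
have g2 : Rabs (1 - s') * Rabs (coords d' u - coords d u) <= eps / 4.
  have := ndd u; have := Rabs_pos (coords d' u - coords d u); have := Rabs_pos (1 - s'); nra.
have g3 : Rabs (s' - s) * Rabs (base u - coords d u) <= eps / (4 * M) * M.
  apply: Rmult_le_compat; try exact: Rabs_pos; [exact: Rlt_le|exact: hM].
have : eps / (4 * M) * M = eps / 4 by field; lra.
lra.
Qed.

End Upper.

End Strata.

(** * Parity labels on R^k and the fundamental class of the torus mod 2 *)

Module CubeLabels.

Import Reals Lra.
Import ClassicalEpsilon FunctionalExtensionality.
Import all_boot all_algebra all_fingroup zify.
Import Cochains Barycenters LabelCocycle.
Set Implicit Arguments. Unset Strict Implicit.
Local Open Scope R_scope.

Section Cube.
Variable k' : nat.
Notation k := k'.+1.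
Notation pnt := ('I_k -> R).
Notation F2 := 'F_2.
Notation lab := (nat -> 'I_2).
Implicit Types (p : 'S_k) (x y : pnt).

Definition shift (i : 'I_k) x : pnt := fun u => x u + (if u == i then 1 else 0).
Definition flip : 'S_2 := tperm (inord 0) (inord 1).
Definition flipat (i : 'I_k) (r : nat) : 'S_2 := if r == i :> nat then flip else 1%g.
Definition corner p (l : nat) : pnt := fun u => if ((p^-1)%g u < l)%N then 1 else 0.
(** The simplices of the Kuhn triangulation of the unit cube, as monotone edge paths from the origin
    to the opposite corner. *)
Definition cubepath p := [seq corner p l | l <- iota 0 k.+1].
Definition cubecycle : seq (F2 * seq pnt) := [seq (1%R, cubepath p) | p <- enum {: 'S_k}].

Lemma F2_opp (a : F2) : (- a = a)%R.
Proof. by apply/eqP; rewrite eq_sym -GRing.addr_eq0; case: a => -[|[|]]. Qed.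

Lemma F2_add (a : F2) : (a + a = 0)%R.
Proof. by rewrite -{2}(F2_opp a) GRing.addrN. Qed.

Lemma lsign_F2 m (g : nat -> 'S_2) : lsign F2 m g = 1%R.
Proof. by rewrite /lsign big1 // => r _; rewrite F2_opp GRing.expr1n. Qed.

Lemma shift_bary i l : l <> [::] -> bary (map (shift i) l) = shift i (bary l).
Proof.
move=> l0; apply: functional_extensionality => u; rewrite /shift /bary /avg size_map.
have p := INR_size_gt0 l0.
set a := if _ then _ else _.
have -> : foldr (fun x s => x u + s) 0 [seq (fun u => x u + (if u == i then 1 else 0)) | x <- l] =
   foldr (fun x s => x u + s) 0 l + INR (size l) * a.
  elim: (l) => [|y l' IH]; first by rewrite /=; lra.
  change (INR (size (y :: l'))) with (INR (S (size l'))); rewrite S_INR /= IH -/a; lra.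
by field; lra.
Qed.

Lemma ceval_cubecycle c : ceval cubecycle c = (\sum_(p : 'S_k) c (cubepath p))%R.
Proof.
by rewrite /ceval big_map big_enum /=; apply: eq_bigr => p _; rewrite GRing.mul1r.
Qed.

Lemma sum_swap0 (a b : 'I_k) (G : 'S_k -> F2) : a != b ->
  (forall p, G (tperm a b * p)%g = G p) -> (\sum_(p : 'S_k) G p = 0)%R.
Proof.
move=> ab e; rewrite (bigID (fun p : 'S_k => odd_perm p)) /=.
rewrite [X in (X + _)%R](reindex_inj (mulgI (tperm a b))) /=.
rewrite [X in (X + _)%R](eq_bigl (fun p : 'S_k => ~~ odd_perm p)); last first.
  by move=> p; rewrite odd_permM odd_tperm ab.
rewrite -big_split big1 //= => p _.
by rewrite e F2_add.
Qed.

Definition cyc : 'S_k := perm (@ordS_inj k).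

(** [cyc * p] takes the first edge of [p] last. The face of [p] opposite to the origin is thus a
    translate of the face of [cyc * p] opposite to the far corner, and the outer faces are glued in
    pairs. *)
Lemma corner_cyc p l : (l < k)%N -> corner p l.+1 = shift (p ord0) (corner (cyc * p)%g l).
Proof.
move=> lk; apply: functional_extensionality => u; rewrite /shift /corner invMg permM.
set v := (p^-1)%g u.
have -> : (u == p ord0) = (v == ord0) by rewrite /v (can2_eq (permKV p) (permK p)).
set w := (cyc^-1)%g v.
have vw : v = cyc w by rewrite permKV.
have vE : (v : nat) = (w.+1 %% k)%N by rewrite vw permE.
have wk := ltn_ord w.
have e0 : (v == ord0) = (v == 0%N :> nat) by [].
case: (ltnP w.+1 k) => h.
  have v1 : (v : nat) = w.+1 by rewrite vE modn_small.
  by rewrite e0 v1 ltnS /=; case: ifP => _; lra.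
have wE : w.+1 = k by lia.
have v0 : (v : nat) = 0%N by rewrite vE wE modnn.
rewrite e0 v0 /=.
by have -> : (w < l)%N = false by [lia]; lra.
Qed.

Lemma cubecycle_closed c :
  (forall i l, c (map (shift i) l) = c l) -> ceval cubecycle (cobd c) = 0%R.
Proof.
move=> ec; rewrite ceval_cubecycle.
under eq_bigr => p _ do rewrite cobd_sum size_map size_iota.
rewrite exchange_big /= big_ord_recl big_ord_recr /= GRing.addrCA big1 ?GRing.add0r; last first.
  move=> i _; have ik : (i.+1 <= k)%N by have := ltn_ord i; lia.
  have h0 : (i < k)%N by have := ltn_ord i; lia.
  have h1 : (i.+1 < k)%N by have := ltn_ord i; lia.
  apply: (@sum_swap0 (Ordinal h0) (Ordinal h1)); first by apply/eqP => /(congr1 val) /=; lia.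
  move=> p; rewrite !del_map_iota //.
  congr (_ * c _)%R; apply/eq_in_map => l; rewrite mem_cat !mem_iota /bump leq0n add1n => hl.
  apply: functional_extensionality => u; rewrite /corner invMg tpermV permM.
  have hl' : l <> i.+1 by lia.
  by case: tpermP => [->|->|//] /=; congr (if _ then _ else _); lia.
have sgF i (a : F2) : ((-1) ^+ i * a = a)%R by rewrite F2_opp GRing.expr1n GRing.mul1r.
under eq_bigr => p _ do rewrite sgF del_map_iota //.
under [X in (_ + X)%R]eq_bigr => p _ do rewrite sgF del_map_iota ?/bump //=.
rewrite [X in (_ + X)%R](reindex_inj (mulgI cyc)) /= -big_split big1 //= => p _.
have e : [seq corner p l | l <- iota 1 k] = map (shift (p ord0)) [seq corner (cyc * p)%g l | l <- iota 0 k].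
  rewrite -[iota 1 k]/(iota (1 + 0) k) iotaDl -!map_comp; apply/eq_in_map => l.
  by rewrite mem_iota /= => hl; rewrite corner_cyc.
rewrite -[corner p 1 :: _]/[seq corner p l | l <- iota 1 k] e ec add0n add1n subnn cats0.
exact: F2_add.
Qed.

Definition parity (r : R) : 'I_2 := if Z.odd (Int_part r) then inord 1 else inord 0.

Lemma parity_add1 r : parity (r + 1) = flip (parity r).
Proof.
have e : Int_part (r + 1) = Z.add (Int_part r) (Zpos xH).
  apply/esym/Int_part_spec; rewrite plus_IZR; have := base_Int_part r; lra.
rewrite /parity e Z.odd_add /=; case: (Z.odd _) => /=; rewrite /flip ?tpermL ?tpermR //.
Qed.

Lemma parity_0 : parity 0 = inord 0.
Proof. by rewrite /parity -(Int_part_spec 0 0) //; lra. Qed.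

Lemma parity_1 : parity 1 = inord 1.
Proof. by rewrite /parity -(Int_part_spec 1 1) //; lra. Qed.

Definition parlab x (j : nat) : 'I_2 := if (j < k)%N then parity (x (inord j)) else inord 0.

Definition parity_act (E : pnt -> lab) := forall i x j, E (shift i x) j = flipat i j (E x j).

Lemma parlab_act : parity_act parlab.
Proof.
move=> i x j; rewrite /parlab /flipat; case: ltnP => jk; last first.
  by rewrite ifN ?perm1 //; apply/eqP => e; have := ltn_ord i; lia.
rewrite /shift; case: eqP => e; first by rewrite -e inordK // eqxx parity_add1.
rewrite ifN ?Rplus_0_r ?perm1 //; apply/eqP => e'; apply: e.
by apply: val_inj; rewrite /= inordK.
Qed.

(** Slot j sees a jump between the vertices j and j + 1 only if this edge of the path has direction
    j. *)
Lemma lcochain_cubepath_neq0 p : (lcochain F2 k (map parlab (cubepath p)) <> 0)%R <-> p = 1%g.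
Proof.
have k1 : (k * 1)%N = k by rewrite muln1.
have nthE l j : (l <= k)%N -> (j < k)%N -> nth (@lab0 1) (map parlab (cubepath p)) l j =
    (if ((p^-1)%g (inord j) < l)%N then inord 1 else inord 0).
  move=> lk jk; rewrite (nth_map (fun=> 0)); last by rewrite size_map size_iota.
  rewrite (nth_map 0%N) ?size_iota // nth_iota // add0n /parlab jk /corner.
  by case: ifP => _; rewrite ?parity_0 ?parity_1.
have ne01 : inord 1 <> inord 0 :> 'I_2 by move/(congr1 (@nat_of_ord _)); rewrite !inordK.
split.
  move=> nz; suff h : (p^-1)%g = 1%g by rewrite -(invgK p) h invg1.
  apply/permP => u; rewrite perm1; apply: val_inj => /=.
  have uk := ltn_ord u.
  have := lcochain_neq0 nz; rewrite k1 => /(_ u uk).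
  rewrite !nthE //; last exact: ltnW.
  rewrite inord_val; case: (ltngtP ((p^-1)%g u) u) => h //.
    by rewrite ltnS (ltnW h).
  by rewrite ltnS leqNgt h.
move=> p1; rewrite {}p1 in nthE *.
rewrite /lcochain /blockdet; apply/eqP/GRing.Theory.prodf_neq0 => r _; apply/eqP.
have rk := ltn_ord r.
pose h i := nth (@lab0 1) (map parlab (cubepath 1%g)) (r + i)%N r.
have -> : lblock (lstep F2 (map parlab (cubepath 1%g))) r = stepmx F2 h.
  apply/matrixP => i j; rewrite !mxE; case: ltnP => // i1.
  have -> : (i : nat) = 0%N by lia.
  by rewrite muln1 /lstep /h !addn0 addn1.
apply: stepmx_neq0 => a b ab b1.
have [-> ->] : a = 0%N /\ b = 1%N by lia.
rewrite /h addn0 addn1 !nthE //; last exact: ltnW.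
by rewrite invg1 perm1 inordK // ltnn ltnSn; apply: nesym.
Qed.

(** The label cochain is taken with [k] blocks of one slot each and two labels, and the acting type
    is ['I_k], the generators of the translation group Z^k. *)
Theorem no_local_parity (E : pnt -> lab) : parity_act E ->
  exists x : pnt, forall eta j, 0 < eta -> (j < k)%N ->
    exists y y' : pnt, [/\ forall u, Rabs (y u - x u) <= eta,
      forall u, Rabs (y' u - x u) <= eta & E y j <> E y' j].
Proof.
move=> eE.
pose aLk (i : 'I_k) := act_lab (k := 1) (flipat i).
have actE (E' : pnt -> lab) : parity_act E' -> label_act (fun=> True) shift aLk E'.
  by move=> h i x _; apply: functional_extensionality => j; rewrite h /aLk /act_lab divn1.
have size_z t : List.In t cubecycle -> size t.2 = (k * 1).+1.
  rewrite /cubecycle; elim: (enum _) => //= u us IH [<-|//].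
  by rewrite /cubepath size_map size_iota muln1.
have z_cycle c : equivariant (@bary _) (fun=> True) shift (fun=> 1%R) (k * 1) c -> ceval cubecycle (cobd c) = 0%R.
  move=> ec.
  (* [ec] gives invariance in one size, [cubecycle_closed] asks for it in all sizes: the other sizes
     are cut off. *)
  pose c' l := if size l == (k * 1)%N then c l else 0%R.
  rewrite (@eq_ceval F2 pnt (k * 1) cubecycle size_z _ (cobd c')).
    apply: cubecycle_closed => i l; rewrite /c' size_map; case: eqP => // sl.
    rewrite (ec (fun=> True)) ?GRing.mul1r //.
    by elim: (l) => // y l' IH; constructor.
  move=> l sl; apply: (eq_cobd_size sl) => t st; by rewrite /c' st eqxx.
have nz : ceval cubecycle (fun l => lcochain F2 k (map parlab l)) <> 0%R.
  rewrite ceval_cubecycle (bigD1 1%g) //= big1 ?GRing.addr0; first by apply/lcochain_cubepath_neq0.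
  move=> p /eqP p1; apply: NNPP => /lcochain_cubepath_neq0; exact: p1.
have actL (i : 'I_k) l : size l = (k * 1).+1 -> lcochain F2 k (map (aLk i) l) = (1 * lcochain F2 k l)%R.
  by move=> sl; rewrite /aLk lcochain_act // lsign_F2.
have [t tz often_t] := @often_subdivision F2 pnt lab 'I_k (@bary _) (fun=> True) shift aLk (fun=> 1%R)
   shift_bary (k * 1)%N (lcochain F2 k) (@lcochain_cocycle F2 1 k) actL cubecycle size_z z_cycle E parlab (actE _ eE) (actE _ parlab_act) nz.
have dt : diam 1 t.2.
  have [p ->] : exists p, t.2 = cubepath p.
    by move: tz; rewrite /cubecycle; elim: (enum _) => //= u us IH [<-|//]; exists u.
  move=> x y u.
  have b01 z : List.In z (cubepath p) -> 0 <= z u <= 1.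
    rewrite /cubepath; elim: (iota _ _) => //= l ls IH [<-|//].
    by rewrite /corner; case: ifP => _; lra.
  by move=> /b01 h1 /b01 h2; apply: Rabs_le; lra.
have al : alive (fun l => lcochain F2 k (map E l)) (k * 1) t.2.
  by split=> //; apply: size_z.
have [x hx] := limit_point al dt.
exists x => eta j e0 jk; have [l [sl nzl nl _]] := hx eta e0.
have jk1 : (j < k * 1)%N by rewrite muln1.
have := lcochain_neq0 nzl jk1.
have nIn i : (i < size l)%N -> List.In (nth x l i) l.
  elim: (l) i => // y l' IH [|i] /=; first by left.
  by move=> h; right; apply: IH.
have j1 : (j.+1 < size l)%N by rewrite sl.
rewrite !(nth_map x) //; last exact: ltnW.
move=> ne; exists (nth x l j.+1), (nth x l j).
by split=> // u; apply: nl; apply: nIn => //; apply: ltnW.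
Qed.

End Cube.

End CubeLabels.

(** * The covering of planar configurations by square roots of differences *)

Module SquareRoots.

Import Reals Psatz.
Import ClassicalEpsilon FunctionalExtensionality.
Import all_boot all_fingroup.
Import Barycenters PointLabels ConfigurationSpaces Lifting.
Set Implicit Arguments. Unset Strict Implicit.
Local Open Scope R_scope.

Notation C2 := (R * R)%type.
Definition csq (u : C2) : C2 := (u.1 * u.1 - u.2 * u.2, 2 * u.1 * u.2).
Definition nrm (u : C2) := u.1 * u.1 + u.2 * u.2.
Definition dot (u v : C2) := u.1 * v.1 + u.2 * v.2.
Definition csub (u v : C2) : C2 := (u.1 - v.1, u.2 - v.2).
Definition cadd (u v : C2) : C2 := (u.1 + v.1, u.2 + v.2).
Definition copp (u : C2) : C2 := (- u.1, - u.2).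

Lemma nrm_ge0 u : 0 <= nrm u. Proof. rewrite /nrm; nra. Qed.

Lemma nrm_eq0 u : nrm u = 0 -> u = (0, 0).
Proof. case: u => a b; rewrite /nrm /= => h; congr (_, _); nra. Qed.

Lemma nrm_csq u : nrm (csq u) = nrm u * nrm u.
Proof. rewrite /nrm /csq /=; ring. Qed.

(** The factorization of u^2 - v^2, [nrm] being the squared modulus; the estimates on roots rest on
    it. *)
Lemma nrm_diff u v : nrm (csub u v) * nrm (cadd u v) = nrm (csub (csq u) (csq v)).
Proof. rewrite /nrm /csub /cadd /csq /=; ring. Qed.

Lemma csq_copp u : csq (copp u) = csq u.
Proof. by rewrite /csq /copp /=; congr (_, _); ring. Qed.

Lemma csq_eq u v : csq u = csq v -> u = v \/ u = copp v.
Proof.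
move=> e; have := nrm_diff u v; rewrite e.
have -> : nrm (csub (csq v) (csq v)) = 0 by rewrite /nrm /csub /=; ring.
case/Rmult_integral => /nrm_eq0; case: u v {e} => a b [c d] [h1 h2].
  by left; congr (_, _); lra.
by right; rewrite /copp /=; congr (_, _); lra.
Qed.

Lemma csq_ex w : exists u, csq u = w.
Proof.
case: w => x y; pose s := sqrt (x * x + y * y).
have ss : s * s = x * x + y * y by apply: sqrt_sqrt; nra.
have s0 : 0 <= s by apply: sqrt_pos.
have sx : Rabs x <= s by apply: Rsqr_incr_0_var => //; rewrite -Rsqr_abs /Rsqr; nra.
have [b1 b2] := Rabs_le_bounds sx.
pose p := sqrt ((s + x) / 2); pose q := sqrt ((s - x) / 2).
have pp : p * p = (s + x) / 2 by apply: sqrt_sqrt; lra.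
have qq : q * q = (s - x) / 2 by apply: sqrt_sqrt; lra.
have p0 : 0 <= p by apply: sqrt_pos.
have q0 : 0 <= q by apply: sqrt_pos.
have pq : (2 * p * q) * (2 * p * q) = y * y.
  have -> : 2 * p * q * (2 * p * q) = 4 * (p * p) * (q * q) by ring.
  by rewrite pp qq; nra.
case: (Rle_dec 0 y) => y0.
  exists (p, q); rewrite /csq /=; congr (_, _); first lra.
  have : 0 <= 2 * p * q by apply: Rmult_le_pos => //; lra.
  by nra.
exists (p, - q); rewrite /csq /=; congr (_, _); first nra.
have : 0 <= 2 * p * q by apply: Rmult_le_pos => //; lra.
by nra.
Qed.

Lemma nrm_cadd_ge u r : 0 <= dot u r -> nrm r <= nrm (cadd u r).
Proof. rewrite /dot /nrm /cadd /=; nra. Qed.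

(** Of two opposite roots one lies on the side of [r], unless they are orthogonal to [r]; then both
    u - r and u + r are at least as long as [r], and [w] is too far from [csq r]. *)
Lemma root_near r w : 0 < nrm (csq r) -> nrm (csub w (csq r)) < nrm (csq r) / 16 ->
  exists u, csq u = w /\ 0 < dot u r.
Proof.
move=> r0 near; have [u uw] := csq_ex w.
case: (Rtotal_order (dot u r) 0) => [lt|[eq|gt]].
- exists (copp u); rewrite csq_copp; split=> //; rewrite /dot /copp /=; move: lt; rewrite /dot; lra.
- exfalso; have := nrm_diff u r; rewrite uw => e.
  have h1 : nrm r <= nrm (cadd u r) by apply: nrm_cadd_ge; lra.
  have h2 : nrm r <= nrm (csub u r) by move: eq; rewrite /dot /nrm /csub /=; nra.
  have := nrm_ge0 r; rewrite nrm_csq in near r0; nra.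
- by exists u.
Qed.

Lemma root_uniq r u v : csq u = csq v -> 0 < dot u r -> 0 < dot v r -> u = v.
Proof.
move=> /csq_eq [//|->]; rewrite /dot /copp /=; lra.
Qed.

Lemma root_close r u : 0 < nrm r -> nrm (csub (csq u) (csq r)) < nrm (csq r) / 16 -> 0 < dot u r ->
  nrm (csub u r) <= nrm r / 16.
Proof.
move=> r0 near d0; have := nrm_diff u r.
have h1 : nrm r <= nrm (cadd u r) by apply: nrm_cadd_ge; lra.
have := nrm_ge0 (csub u r); rewrite nrm_csq in near; nra.
Qed.

(** Both roots are within |r|/4 of [r], so the factor u + v is at least as long as [r]. *)
Lemma root_cont r u v : nrm (csub u r) <= nrm r / 16 -> nrm (csub v r) <= nrm r / 16 ->
  nrm (csub u v) * nrm r <= nrm (csub (csq u) (csq v)).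
Proof.
move=> h1 h2; rewrite -nrm_diff.
have h3 : 4 * nrm r <= 2 * nrm (cadd u v) + 4 * nrm (csub u r) + 4 * nrm (csub v r).
  have one a b c : 4 * (c * c) <= 2 * ((a + b) * (a + b)) + 4 * ((a - c) * (a - c)) + 4 * ((b - c) * (b - c)).
    by have := Rle_0_sqr (a + b - c); have := Rle_0_sqr (a - b); rewrite /Rsqr; lra.
  rewrite /nrm /cadd /csub /=.
  have := one u.1 v.1 r.1; have := one u.2 v.2 r.2; lra.
have := nrm_ge0 (csub u v); have := nrm_ge0 r; nra.
Qed.

Section SquareRootCover.
Variable k : nat.
Notation cfgT := (config 2 k.+1).
Notation pi := (pi_conf 2 k.+1).
Notation opn := (is_open (B_space 2 k.+1)).
Notation pnt := ('I_k.+1 * 'I_2 -> R).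

Definition i1 : 'I_2 := ord_max.
Definition dif (x : pnt) (p : 'I_k.+1 * 'I_k.+1) : C2 :=
  (x (p.1, ord0) - x (p.2, ord0), x (p.1, i1) - x (p.2, i1)).

(* The covering of ordered configurations by a choice of a complex square root of every
   difference of two points. *)
Record rootconf := RootConf { rootpts : cfgT; rootof : 'I_k.+1 * 'I_k.+1 -> C2;
                    rootofP : forall p, csq (rootof p) = dif (coords rootpts) p }.

Definition rootcoords (e : rootconf) (u : 'I_k.+1 * 'I_2 + ('I_k.+1 * 'I_k.+1) * bool) : R :=
  match u with
  | inl v => coords (rootpts e) v
  | inr (p, b) => if b then (rootof e p).1 else (rootof e p).2
  end.

(** Both the roots and the order are forgotten. Roots are kept for all ordered pairs because a lift
    may order the points in any way. *)
Definition q (e : rootconf) := pi (rootpts e).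

Lemma rootconf_eq e e' : rootpts e = rootpts e' -> rootof e = rootof e' -> e = e'.
Proof.
case: e e' => [c r h] [c' r' h'] /= ec er; subst c' r'.
by rewrite (proof_irrelevance _ h h').
Qed.

Lemma rootcoords_inj e e' : rootcoords e = rootcoords e' -> e = e'.
Proof.
move=> h; apply: rootconf_eq.
  apply: coords_inj; apply: functional_extensionality => u; exact: (f_equal (fun f => f (inl u)) h).
apply: functional_extensionality => p; rewrite [LHS]surjective_pairing [RHS]surjective_pairing.
congr (_, _); first exact: (f_equal (fun f => f (inr (p, true))) h).
exact: (f_equal (fun f => f (inr (p, false))) h).
Qed.

Lemma ord2 (i : 'I_2) : i = ord0 \/ i = i1.
Proof. by case: i => -[|[|//]] h; [left|right]; apply: val_inj. Qed.

Lemma sq_le a b : Rabs a <= b -> a * a <= b * b.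
Proof. by move=> /Rabs_le_bounds; nra. Qed.

Lemma dif_near (x y : pnt) p e : near x y e -> nrm (csub (dif x p) (dif y p)) <= 8 * (e * e).
Proof.
move=> h; rewrite /nrm /csub /dif /=.
have g i : (x (p.1, i) - x (p.2, i) - (y (p.1, i) - y (p.2, i))) * (x (p.1, i) - x (p.2, i) - (y (p.1, i) - y (p.2, i))) <= 2 * e * (2 * e).
  apply: sq_le.
  have -> : x (p.1, i) - x (p.2, i) - (y (p.1, i) - y (p.2, i)) = (x (p.1, i) - y (p.1, i)) + - (x (p.2, i) - y (p.2, i)) by ring.
  apply: Rle_trans (Rabs_triang _ _) _; rewrite Rabs_Ropp.
  by have := h (p.1, i); have := h (p.2, i); lra.
by have := g ord0; have := g i1; lra.
Qed.

Lemma dif_ge (x : pnt) p i d : 0 <= d -> d <= Rabs (x (p.1, i) - x (p.2, i)) -> d * d <= nrm (dif x p).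
Proof.
move=> d0 h.
have g : d * d <= (x (p.1, i) - x (p.2, i)) * (x (p.1, i) - x (p.2, i)).
  have : Rabs (x (p.1, i) - x (p.2, i)) * Rabs (x (p.1, i) - x (p.2, i)) = (x (p.1, i) - x (p.2, i)) * (x (p.1, i) - x (p.2, i)).
    by rewrite -Rabs_mult Rabs_pos_eq //; apply: Rle_0_sqr.
  nra.
have s0 := Rle_0_sqr (x (p.1, ord0) - x (p.2, ord0)).
have s1 := Rle_0_sqr (x (p.1, i1) - x (p.2, i1)).
by rewrite /nrm /dif /=; rewrite /Rsqr in s0 s1; case: (ord2 i) g => -> g; lra.
Qed.

Lemma dif_neq0 (c : cfgT) p : p.1 <> p.2 -> 0 < nrm (dif (coords c) p).
Proof.
move=> ne; have [d d0 sep] := distinct_sep (coords_distinct c); have [i hi] := sep _ _ ne.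
by apply: Rlt_le_trans (dif_ge (Rlt_le _ _ d0) hi); nra.
Qed.

Lemma rootof_pos e p : p.1 <> p.2 -> 0 < nrm (rootof e p).
Proof.
move=> /(dif_neq0 (rootpts e)); rewrite -rootofP nrm_csq; have := nrm_ge0 (rootof e p); nra.
Qed.

(** The bound [d <= 1] allows squares of distances proportional to [d] to be compared with the
    squared moduli. *)
Lemma rootof_min e : exists2 d, 0 < d <= 1 & forall p, p.1 <> p.2 -> d <= nrm (rootof e p).
Proof.
have [|d d0 h] := @pos_bound _ (fun p : 'I_k.+1 * 'I_k.+1 => if p.1 == p.2 then 1 else nrm (rootof e p)).
  by move=> p; case: eqP => ne; [lra|apply: rootof_pos].
exists (Rmin d 1); first by split; [apply: Rmin_glb_lt; lra|apply: Rmin_r].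
move=> p ne; have := h p; case: eqP => // _; apply: Rle_trans; exact: Rmin_l.
Qed.

Lemma csq0 u : csq u = (0, 0) -> u = (0, 0).
Proof.
move=> e; apply: nrm_eq0; have := nrm_csq u; rewrite e /nrm /=; have := nrm_ge0 u; rewrite /nrm; nra.
Qed.

Lemma dif_diag (x : pnt) p : p.1 = p.2 -> dif x p = (0, 0).
Proof. by move=> e; rewrite /dif e !Rminus_diag. Qed.

Lemma rootof_diag e p : p.1 = p.2 -> rootof e p = (0, 0).
Proof. by move=> ne; apply: csq0; rewrite rootofP dif_diag. Qed.

Lemma root_local_inj e : exists2 r, 0 < r & forall e1 e2,
  near (rootcoords e1) (rootcoords e) r -> near (rootcoords e2) (rootcoords e) r -> q e1 = q e2 -> e1 = e2.
Proof.
have [r r0 hr] := orbit_sep (rootpts e).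
have [d [d0 d1] hd] := rootof_min e.
exists (Rmin r (d / 2)); first by apply: Rmin_glb_lt; lra.
move=> e1 e2 n1 n2 q12.
have ec : rootpts e1 = rootpts e2.
  by apply: hr => // u; [have := n1 (inl u)|have := n2 (inl u)]; have := Rmin_l r (d / 2); rewrite /rootcoords; lra.
apply: rootconf_eq => //; apply: functional_extensionality => p.
have es : csq (rootof e1 p) = csq (rootof e2 p) by rewrite !rootofP ec.
case: (p.1 =P p.2) => ne.
  by rewrite (rootof_diag e1 ne) (rootof_diag e2 ne).
case: (csq_eq es) => // eo; exfalso.
have m := Rmin_r r (d / 2).
have a1 := n1 (inr (p, true)); have a2 := n1 (inr (p, false)).
have b1 := n2 (inr (p, true)); have b2 := n2 (inr (p, false)).
have := hd p ne; rewrite /rootcoords /= eo /copp /= in a1 a2 b1 b2 *.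
move: (Rabs_def2 _ _ a1) (Rabs_def2 _ _ a2) (Rabs_def2 _ _ b1) (Rabs_def2 _ _ b2).
rewrite /nrm.
set x := (rootof e p).1; set y := (rootof e p).2; set x' := (rootof e2 p).1; set y' := (rootof e2 p).2.
move=> [h1 h2] [h3 h4] [h5 h6] [h7 h8].
have hx : x * x <= d / 2 * (d / 2) by apply: sq_le; apply: Rabs_le; lra.
have hy : y * y <= d / 2 * (d / 2) by apply: sq_le; apply: Rabs_le; lra.
nra.
Qed.

Lemma root_local_sections b0 : exists C, [/\ opn C, C b0 &
  forall e, C (q e) -> exists f, [/\ sec_cont rootcoords C f, forall b, C b -> q (f b) = b & f (q e) = e]].
Proof.
have [c ->] := pi_surj b0.
have [dl dl0 sep] := distinct_sep (coords_distinct c).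
(* Within [dl / 32] of [c] the differences keep a coordinate of size 15/16 [dl], and they vary
   little enough for the ratio 1/16 required by [root_near]. *)
have [r [C [f [[r0 rdl] [oC Cc] fc fP fd]]]] := @chart k 1 c (dl / 32) ltac:(lra).
exists C; split=> // e Ce.
have [h1 h2] := fP _ Ce.
have /pi_eq/same_orbit_perm [t et] := h1.
pose spec b e' := coords (rootpts e') = act_pt t (coords (f b)) /\
   forall p, p.1 <> p.2 -> 0 < dot (rootof e' p) (rootof e p).
have nearb b : C b -> near (act_pt t (coords (f b))) (coords (rootpts e)) (2 * r).
  move=> Cb; rewrite et; apply: near_act.
  have [_ nb] := fP b Cb; have := near_trans nb (near_sym h2); move/near_le; apply; lra.
have big p : p.1 <> p.2 -> 15 / 16 * dl * (15 / 16 * dl) <= nrm (csq (rootof e p)).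
  move=> ne; rewrite rootofP.
  have [|i hi] := sep (t^-1%g p.1) (t^-1%g p.2); first by move=> /perm_inj.
  apply: (dif_ge (i := i)); first lra.
  have g1 := h2 (t^-1%g p.1, i); have g2 := h2 (t^-1%g p.2, i).
  rewrite et /act_pt [X in X - _]/= .
  set A := coords (f (q e)) (t^-1%g p.1, i) in g1; set B := coords (f (q e)) (t^-1%g p.2, i) in g2.
  set A0 := coords c (t^-1%g p.1, i) in hi g1; set B0 := coords c (t^-1%g p.2, i) in hi g2.
  change (15 / 16 * dl <= Rabs (A - B)).
  have : Rabs (A0 - B0) <= Rabs (A - B) + (Rabs (A - A0) + Rabs (B - B0)).
    have -> : A0 - B0 = (A - B) + (- (A - A0) + (B - B0)) by ring.
    apply: Rle_trans (Rabs_triang _ _) _; apply: Rplus_le_compat_l.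
    by apply: Rle_trans (Rabs_triang _ _) _; rewrite Rabs_Ropp; lra.
  lra.
have close b p : C b -> p.1 <> p.2 ->
    nrm (csub (dif (act_pt t (coords (f b))) p) (csq (rootof e p))) < nrm (csq (rootof e p)) / 16.
  move=> Cb ne; rewrite {1}rootofP.
  have := dif_near p (nearb b Cb); have := big p ne; nra.
have spec_ex b : C b -> exists e', spec b e'.
  move=> Cb; have [cb ecb] := act_cfg t (f b).
  have P p : exists u, csq u = dif (coords cb) p /\ (p.1 <> p.2 -> 0 < dot u (rootof e p)).
    case: (p.1 =P p.2) => ne; first by exists (0, 0); rewrite dif_diag // /csq /=; split=> //; congr (_, _); ring.
    have [||u [u1 u2]] := @root_near (rootof e p) (dif (coords cb) p).
    - by have := big p ne; nra.
    - by rewrite ecb; apply: close.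
    by exists u.
  pose u p := proj1_sig (constructive_indefinite_description _ (P p)).
  have uP p := proj2_sig (constructive_indefinite_description _ (P p)).
  exists (@RootConf cb u (fun p => proj1 (uP p))); split=> //= p ne.
  exact: (proj2 (uP p) ne).
have spec_un b e1 e2 : spec b e1 -> spec b e2 -> e1 = e2.
  move=> [s1 s2] [s3 s4].
  have ec : rootpts e1 = rootpts e2 by apply: coords_inj; rewrite s1.
  apply: rootconf_eq => //; apply: functional_extensionality => p.
  have es : csq (rootof e1 p) = csq (rootof e2 p) by rewrite !rootofP ec.
  case: (p.1 =P p.2) => ne; last exact: root_uniq es (s2 p ne) (s4 p ne).
  by rewrite (rootof_diag e1 ne) (rootof_diag e2 ne).
pose g b := epsilon (inhabits e) (spec b).
have gP b : C b -> spec b (g b) by move=> Cb; apply: (epsilon_spec _ (spec b)); apply: spec_ex.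
exists g; split.
- move=> b Cb eps eps0.
  have [d [d0 d1] hd] := rootof_min e.
  (* Chosen so that 8 eta^2 = eps^2 d^2 / 2, which is less than eps^2 d. *)
  pose eta := eps * d / 4.
  have eta0 : 0 < eta by rewrite /eta; nra.
  have [O [oO Ob hO]] := fc b Cb eta eta0.
  exists O; split=> // b' Ob' Cb'.
  have nb : near (act_pt t (coords (f b'))) (act_pt t (coords (f b))) eta by apply: near_act; apply: hO.
  have [s1 s2] := gP b Cb; have [s3 s4] := gP b' Cb'.
  case=> [u|[p tf]]; first by rewrite /rootcoords s1 s3; have := nb u; rewrite /eta; nra.
  case: (p.1 =P p.2) => ne.
    rewrite /rootcoords (rootof_diag (g b) ne) (rootof_diag (g b') ne).
    by case: tf; rewrite Rminus_diag Rabs_R0.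
  have rp := rootof_pos e ne.
  have c1 : nrm (csub (rootof (g b') p) (rootof e p)) <= nrm (rootof e p) / 16.
    by apply: root_close (s4 p ne) => //; rewrite [csq (rootof (g b') p)]rootofP s3; apply: close.
  have c2 : nrm (csub (rootof (g b) p) (rootof e p)) <= nrm (rootof e p) / 16.
    by apply: root_close (s2 p ne) => //; rewrite [csq (rootof (g b) p)]rootofP s1; apply: close.
  have := root_cont c1 c2; rewrite !rootofP s1 s3 => h3.
  have h4 := dif_near p nb.
  have h5 := hd p ne.
  have h6 : nrm (csub (rootof (g b') p) (rootof (g b) p)) * d <= 8 * (eta * eta).
    have := nrm_ge0 (csub (rootof (g b') p) (rootof (g b) p)); nra.
  have h7 : nrm (csub (rootof (g b') p) (rootof (g b) p)) < eps * eps.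
    have e1 : 8 * (eta * eta) = eps * eps * d * d / 2 by rewrite /eta; field.
    apply: Rnot_le_lt => h8.
    have : eps * eps * d <= eps * eps * d * d / 2 by rewrite -e1; nra.
    have : 0 < eps * eps * d by do 2 apply: Rmult_lt_0_compat => //.
    nra.
  have fin v : v * v <= nrm (csub (rootof (g b') p) (rootof (g b) p)) -> Rabs v < eps.
    move=> hv; apply: Rabs_def1; nra.
  have := Rle_0_sqr ((rootof (g b') p).1 - (rootof (g b) p).1); have := Rle_0_sqr ((rootof (g b') p).2 - (rootof (g b) p).2).
  by rewrite /rootcoords /Rsqr; case: tf => p1 p2; apply: fin; rewrite /nrm /csub /=; lra.
- move=> b Cb; have [s1 _] := gP b Cb; rewrite /q (pi_act s1); by case: (fP b Cb).
- apply: (spec_un (q e)); first exact: gP.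
  by split=> [|p ne]; [rewrite et|have := rootof_pos e ne; rewrite /dot /nrm].
Qed.
End SquareRootCover.

End SquareRoots.

(** * The lower bound for cat in the plane *)

Module Torus.

Import Reals Psatz.
Import ClassicalEpsilon FunctionalExtensionality.
Import all_boot all_fingroup.
Import PointLabels ConfigurationSpaces Lifting Strata CubeLabels SquareRoots.
Set Implicit Arguments. Unset Strict Implicit.
Local Open Scope R_scope.

Section Torus.
Variable k' : nat.
Notation k := k'.+1.
Notation tor := ('I_k -> R).
Notation pnt := ('I_k.+1 * 'I_2 -> R).
Notation cfgT := (config 2 k.+1).
Notation pi := (pi_conf 2 k.+1).
Implicit Types (x y : tor).

(** The coordinates of [x] are angles in turns, the j-th one for point j + 1. Point 0 has radius 0,
    so the angle it reads through the truncated predecessor has no effect. *)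
Definition torconf x : pnt := fun u =>
  INR u.1 * (if u.2 == ord0 then cos (2 * PI * x (inord u.1.-1)) else sin (2 * PI * x (inord u.1.-1))).
Definition halfang x (j : nat) : C2 := (cos (PI * x (inord j)), sin (PI * x (inord j))).

Lemma torconf_distinct x : distinct (torconf x).
Proof.
move=> a b ab; apply: NNPP => nE; apply: ab; apply: val_inj => /=; apply: INR_eq.
have e i : torconf x (a, i) = torconf x (b, i) by apply: NNPP => ne; apply: nE; exists i.
have := e ord0; have := e ord_max; rewrite /torconf /=.
set A := 2 * PI * x _; set B := 2 * PI * x _ => h1 h2.
have := sin2_cos2 A; have := sin2_cos2 B; rewrite /Rsqr => sb sa.
have h : INR a * INR a = INR b * INR b.
  have -> : INR a * INR a = (INR a * sin A) * (INR a * sin A) + (INR a * cos A) * (INR a * cos A) by have : INR a * INR a * (sin A * sin A + cos A * cos A) = INR a * INR a by [rewrite sa; ring]; lra.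
  have : INR b * INR b * (sin B * sin B + cos B * cos B) = INR b * INR b by rewrite sb; ring.
  by rewrite h1 h2; lra.
have := pos_INR a; have := pos_INR b; nra.
Qed.

Lemma torconf_shift i x : torconf (shift i x) = torconf x.
Proof.
apply: functional_extensionality => -[a l]; rewrite /torconf /shift /=.
case: (inord a.-1 == i); last by rewrite Rplus_0_r.
have -> : 2 * PI * (x (inord a.-1) + 1) = 2 * PI * x (inord a.-1) + 2 * INR 1 * PI by rewrite /=; ring.
by rewrite cos_period sin_period.
Qed.

Lemma halfang_shift i x j : (j < k)%N ->
  halfang (shift i x) j = if j == i :> nat then copp (halfang x j) else halfang x j.
Proof.
move=> jk; rewrite /halfang /shift.
have -> : (inord j == i) = (j == i :> nat) by apply/eqP/eqP => [<-|->]; rewrite ?inordK ?inord_val.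
case: eqP => _; last by rewrite Rplus_0_r.
have -> : PI * (x (inord j) + 1) = PI * x (inord j) + PI by ring.
by rewrite neg_cos neg_sin.
Qed.

Lemma dif_torconf x j : (j < k)%N ->
  dif (torconf x) (inord j.+1, ord0) = (INR j.+1 * (csq (halfang x j)).1, INR j.+1 * (csq (halfang x j)).2).
Proof.
move=> jk; rewrite /dif /torconf [LHS]/= inordK // [j.+1.-1]/=.
have -> : 2 * PI * x (inord j) = 2 * (PI * x (inord j)) by ring.
rewrite cos_2a sin_2a /csq /halfang [in RHS]/=.
rewrite !Rmult_0_l !Rminus_0_r. change (match j with O => 1 | S _ => INR j + 1 end) with (INR j.+1); congr (_, _); ring.
Qed.

(** In 2 (u.v)^2 = |u|^2 |v|^2 + u^2.v^2, with v the half-angle vector, the last term is j + 1. *)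
Lemma dot_neq0 x j u : (j < k)%N -> csq u = dif (torconf x) (inord j.+1, ord0) -> dot u (halfang x j) <> 0.
Proof.
move=> jk; rewrite dif_torconf //.
have J0 : 0 < INR j.+1 by rewrite S_INR; have := pos_INR j; lra.
move: (INR j.+1) J0 => J J0 e d0.
have h : 2 * (dot u (halfang x j) * dot u (halfang x j)) = nrm u * nrm (halfang x j) + dot (csq u) (csq (halfang x j)).
  by rewrite /dot /nrm /csq /=; ring.
have n1 : nrm (halfang x j) = 1.
  by have := sin2_cos2 (PI * x (inord j)); rewrite /nrm /halfang /Rsqr /=; lra.
rewrite e d0 n1 in h.
have e2 : dot (J * (csq (halfang x j)).1, J * (csq (halfang x j)).2) (csq (halfang x j)) = J.
  have : nrm (csq (halfang x j)) = 1 by rewrite nrm_csq n1; ring.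
  rewrite /dot /nrm [in X in _ -> X]/= => n2.
  have -> : J * (csq (halfang x j)).1 * (csq (halfang x j)).1 + J * (csq (halfang x j)).2 * (csq (halfang x j)).2 = J * ((csq (halfang x j)).1 * (csq (halfang x j)).1 + (csq (halfang x j)).2 * (csq (halfang x j)).2) by ring.
  by rewrite n2; ring.
rewrite e2 in h; have := nrm_ge0 u; lra.
Qed.

Lemma cont_delta (f : R -> R) t e : continuity_pt f t -> 0 < e ->
  exists2 d, 0 < d & forall s, Rabs (s - t) <= d -> Rabs (f s - f t) < e.
Proof.
move=> fc e0; have [d [d0 h]] := fc e e0.
exists (d / 2) => [|s hs]; first lra.
case: (Req_dec s t) => [->|ne]; first by rewrite Rminus_diag Rabs_R0.
by apply: h; split; [split=> //; apply: nesym|rewrite /= /Rdist; lra].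
Qed.

Lemma torconf_cont x e : 0 < e -> exists2 d, 0 < d & forall y, (forall u, Rabs (y u - x u) <= d) ->
  near (torconf y) (torconf x) e /\ forall j, Rabs ((halfang y j).1 - (halfang x j).1) < e /\ Rabs ((halfang y j).2 - (halfang x j).2) < e.
Proof.
move=> e0.
have P1 (u : 'I_k.+1 * 'I_2) : exists d, 0 < d /\ forall s, Rabs (s - x (inord u.1.-1)) <= d ->
   Rabs (INR u.1 * (if u.2 == ord0 then cos (2 * PI * s) else sin (2 * PI * s)) - torconf x u) < e.
  have [|d d0 h] := @cont_delta (fun s => INR u.1 * (if u.2 == ord0 then cos (2 * PI * s) else sin (2 * PI * s))) (x (inord u.1.-1)) e _ e0.
    by case: (u.2 == ord0); reg.
  by exists d.
have P2 (j : 'I_k) : exists d, 0 < d /\ forall s, Rabs (s - x j) <= d ->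
   Rabs (cos (PI * s) - cos (PI * x j)) < e /\ Rabs (sin (PI * s) - sin (PI * x j)) < e.
  have [|d d0 h] := @cont_delta (fun s => cos (PI * s)) (x j) e _ e0; first by reg.
  have [|d' d0' h'] := @cont_delta (fun s => sin (PI * s)) (x j) e _ e0; first by reg.
  exists (Rmin d d'); split; first exact: Rmin_glb_lt.
  by move=> s hs; split; [apply: h|apply: h']; apply: Rle_trans hs _; [apply: Rmin_l|apply: Rmin_r].
pose f1 u := proj1_sig (constructive_indefinite_description _ (P1 u)).
have f1P u := proj2_sig (constructive_indefinite_description _ (P1 u)).
pose f2 u := proj1_sig (constructive_indefinite_description _ (P2 u)).
have f2P u := proj2_sig (constructive_indefinite_description _ (P2 u)).
have [d1 d10 h1] := @pos_bound _ f1 (fun u => proj1 (f1P u)).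
have [d2 d20 h2] := @pos_bound _ f2 (fun u => proj1 (f2P u)).
exists (Rmin d1 d2); first exact: Rmin_glb_lt.
move=> y ny; split.
  move=> u; apply: (proj2 (f1P u)); apply: Rle_trans (ny _) _.
  by apply: Rle_trans (h1 u); apply: Rmin_l.
move=> j; apply: (proj2 (f2P (inord j))); apply: Rle_trans (ny _) _.
by apply: Rle_trans (h2 (inord j)); apply: Rmin_r.
Qed.

(* On the torus of configurations the section over the [j]-th set gives a square root of the
   [j]-th difference, which is compared with the root [halfang x j] that changes sign along the
   [j]-th circle. *)
Theorem cat_lower2 M : cat_le (B_space 2 k.+1) M -> (k <= M)%N.
Proof.
move=> [U [Uo [Uc Ux]]]; rewrite leqNgt; apply/negP => Mk.
pose jj j := minn j M.
have jjM j : (jj j <= M)%coq_nat by apply/leP; rewrite geq_minr.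
have lifts j : exists f, sec_cont (@rootcoords k) (U (jj j)) f /\ forall b, U (jj j) b -> q (f b) = b.
  have [G [b0 [G0 G1 Gc]]] := contractible_path (Ux (jj j) (jjM j)).
  have [e0 eb0] : exists e0 : rootconf k, b0 = q e0.
    have [c ->] := pi_surj b0.
    have P p : exists u, csq u = dif (coords c) p by apply: csq_ex.
    pose u p := proj1_sig (constructive_indefinite_description _ (P p)).
    have uP p := proj2_sig (constructive_indefinite_description _ (P p)).
    by exists (@RootConf k c u uP).
  rewrite {}eb0 in G0.
  exact: (@lifted_section 2 k.+1 (rootconf k) _ (@rootcoords k) (@q k) (@rootcoords_inj k) (@root_local_sections k) (@root_local_inj k) (U (jj j)) G Gc e0 G0 G1).
pose f j := proj1_sig (constructive_indefinite_description _ (lifts j)).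
have fP j : sec_cont (@rootcoords k) (U (jj j)) (f j) /\ forall b, U (jj j) b -> q (f j b) = b.
  exact: (proj2_sig (constructive_indefinite_description _ (lifts j))).
pose bt x := pi (mkconf (torconf x)).
(* The lift orders the points in its own way; [tt] matches this order with the numbering of the
   torus and is locally constant. *)
pose tt j x : 'S_k.+1 := epsilon (inhabits 1%g) (fun t => coords (rootpts (f j (bt x))) = act_pt t (torconf x)).
have ttP j x : U (jj j) (bt x) -> coords (rootpts (f j (bt x))) = act_pt (tt j x) (torconf x).
  move=> Ub; apply: (epsilon_spec _ (fun t => coords (rootpts (f j (bt x))) = act_pt t (torconf x))).
  have /esym/pi_eq/same_orbit_perm [t et] := (fP j).2 _ Ub.
  by exists t; rewrite et mkconfP //; apply: torconf_distinct.
pose rt j x := rootof (f j (bt x)) (tt j x (inord j.+1), tt j x ord0).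
have rtP j x : U (jj j) (bt x) -> csq (rt j x) = dif (torconf x) (inord j.+1, ord0).
  move=> Ub; rewrite /rt rootofP ttP // /dif /act_pt /= !permK //.
pose in_ j x : bool := excluded_middle_informative ((j < k)%N /\ U (jj j) (bt x)).
pose sgl (d : R) : 'I_2 := if Rlt_dec 0 d then inord 1 else inord 0.
(* A full turn of point j + 1 changes the sign of the half-angle vector and leaves the
   configuration, hence its root, unchanged. Elsewhere [parlab] supplies a default with the same
   flips. *)
pose E x (j : nat) : 'I_2 := if in_ j x then sgl (dot (rt j x) (halfang x j)) else parlab x j.
have act : parity_act E.
  move=> i x j.
  have eb : bt (shift i x) = bt x by rewrite /bt torconf_shift.
  have ein : in_ j (shift i x) = in_ j x by rewrite /in_ eb.
  rewrite /E ein; case hin: (in_ j x); last exact: parlab_act.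
  have [jk Ub] : (j < k)%N /\ U (jj j) (bt x).
    by move: hin; rewrite /in_; case: excluded_middle_informative.
  have ert : rt j (shift i x) = rt j x by rewrite /rt /tt eb torconf_shift.
  rewrite ert halfang_shift // /flipat; case: eqP => ji; last by rewrite perm1.
  have := dot_neq0 jk (rtP j x Ub) => d0.
  have -> : dot (rt j x) (copp (halfang x j)) = - dot (rt j x) (halfang x j) by rewrite /dot /copp /=; ring.
  rewrite /sgl; case: Rlt_dec => h1; case: Rlt_dec => h2 //=; try lra.
    by rewrite /flip tpermL.
  by rewrite /flip tpermR.
have [x hx] := no_local_parity act.
have [j [jM Uj]] := Uc (bt x).
have jk : (j < k)%N by apply: leq_ltn_trans Mk; apply/leP.
have jjE : jj j = j by apply/minn_idPl/leP.
have Ub : U (jj j) (bt x) by rewrite jjE.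
have [dl dl0 sep] := distinct_sep (torconf_distinct x).
set r0 := rt j x; set u0 := halfang x j.
have d0 : dot r0 u0 <> 0 by apply: dot_neq0 (rtP j x Ub).
(* Moving both vectors by [eps] changes their product by at most (2 + |r0.1| + |r0.2|) eps, which is
   then too small to change its sign. *)
pose K := 4 + Rabs r0.1 + Rabs r0.2.
have K0 : 0 < K by have := Rabs_pos r0.1; have := Rabs_pos r0.2; rewrite /K; lra.
pose eps := Rmin (dl / 4) (Rabs (dot r0 u0) / (2 * K)).
have ad : 0 < Rabs (dot r0 u0) by apply: Rabs_pos_lt.
have eps0 : 0 < eps by apply: Rmin_glb_lt; [lra|apply: Rdiv_lt_0_compat; lra].
have eps1 : eps <= dl / 4 by apply: Rmin_l.
have eps2 : eps * K < Rabs (dot r0 u0).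
  have : eps * K <= Rabs (dot r0 u0) / (2 * K) * K by apply: Rmult_le_compat_r; [lra|apply: Rmin_r].
  have -> : Rabs (dot r0 u0) / (2 * K) * K = Rabs (dot r0 u0) / 2 by field; lra.
  lra.
have [O [oO Ob hO]] := (fP j).1 _ Ub eps eps0.
have [e1 e10 h1] := F_openP (B_open_and oO (Uo j jM)) (conj Ob Uj).
have [d dp hd] := @torconf_cont x (Rmin eps e1) ltac:(apply: Rmin_glb_lt; lra).
have lab y : (forall u, Rabs (y u - x u) <= d) -> E y j = sgl (dot r0 u0).
  move=> ny; have [g1 g2] := hd y ny.
  have m1 := Rmin_l eps e1; have m2 := Rmin_r eps e1.
  have [Oy Uy] : O (bt y) /\ U j (bt y).
    by apply: h1 => u; rewrite !mkconfP; try exact: torconf_distinct; have := g1 u; lra.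
  have Uby : U (jj j) (bt y) by rewrite jjE.
  have nf := hO _ Oy Uby.
  have tE : tt j y = tt j x.
    apply: invg_inj; apply/permP => a; apply: NNPP => ne.
    have [i hi] := sep _ _ ne.
    have k1 := nf (inl (a, i)); rewrite /rootcoords !ttP // /act_pt in k1.
    have k2 := g1 ((tt j y)^-1%g a, i).
    set A := torconf x ((tt j y)^-1%g a, i) in hi k2; set B := torconf x ((tt j x)^-1%g a, i) in hi.
    set A' := torconf y ((tt j y)^-1%g a, i) in k2.
    have k3 : Rabs (A' - B) < eps := k1.
    have : Rabs (A - B) <= Rabs (A' - B) + Rabs (A' - A).
      have -> : A - B = (A' - B) + - (A' - A) by ring.
      by apply: Rle_trans (Rabs_triang _ _) _; rewrite Rabs_Ropp; lra.
    lra.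
  have k1 : Rabs ((rt j y).1 - r0.1) < eps.
    by rewrite /rt tE; apply: (nf (inr ((tt j x (inord j.+1), tt j x ord0), true))).
  have k2 : Rabs ((rt j y).2 - r0.2) < eps.
    by rewrite /rt tE; apply: (nf (inr ((tt j x (inord j.+1), tt j x ord0), false))).
  have [k3 k4] := g2 j.
  have Ey : E y j = sgl (dot (rt j y) (halfang y j)).
    by rewrite /E /in_; case: excluded_middle_informative => // nin; case: nin.
  rewrite Ey.
  have diff : Rabs (dot (rt j y) (halfang y j) - dot r0 u0) < Rabs (dot r0 u0).
    have -> : dot (rt j y) (halfang y j) - dot r0 u0 =
      ((rt j y).1 - r0.1) * (halfang y j).1 + ((rt j y).2 - r0.2) * (halfang y j).2 +
      (r0.1 * ((halfang y j).1 - u0.1) + r0.2 * ((halfang y j).2 - u0.2)) by rewrite /dot; ring.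
    have b1 : Rabs (halfang y j).1 <= 1 by apply: Rabs_le; have := COS_bound (PI * y (inord j)); rewrite /halfang /=; lra.
    have b2 : Rabs (halfang y j).2 <= 1 by apply: Rabs_le; have := SIN_bound (PI * y (inord j)); rewrite /halfang /=; lra.
    have t1 : Rabs (((rt j y).1 - r0.1) * (halfang y j).1) <= eps.
      rewrite Rabs_mult; have := Rabs_pos ((rt j y).1 - r0.1); have := Rabs_pos (halfang y j).1; nra.
    have t2 : Rabs (((rt j y).2 - r0.2) * (halfang y j).2) <= eps.
      rewrite Rabs_mult; have := Rabs_pos ((rt j y).2 - r0.2); have := Rabs_pos (halfang y j).2; nra.
    have t3 : Rabs (r0.1 * ((halfang y j).1 - u0.1)) <= Rabs r0.1 * eps.
      by rewrite Rabs_mult; apply: Rmult_le_compat_l; [apply: Rabs_pos|rewrite /u0; lra].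
    have t4 : Rabs (r0.2 * ((halfang y j).2 - u0.2)) <= Rabs r0.2 * eps.
      by rewrite Rabs_mult; apply: Rmult_le_compat_l; [apply: Rabs_pos|rewrite /u0; lra].
    apply: Rle_lt_trans eps2.
    apply: Rle_trans (Rabs_triang _ _) _.
    have := Rabs_triang (((rt j y).1 - r0.1) * (halfang y j).1) (((rt j y).2 - r0.2) * (halfang y j).2).
    have := Rabs_triang (r0.1 * ((halfang y j).1 - u0.1)) (r0.2 * ((halfang y j).2 - u0.2)).
    rewrite /K; lra.
  move: diff; rewrite /sgl; set D := dot (rt j y) (halfang y j); set D0 := dot r0 u0.
  move=> diff; have {}diff := Rabs_def2 _ _ diff; have sgn : 0 < D0 \/ D0 < 0 by rewrite /D0 in d0 *; lra.
  case: sgn => sgn; [rewrite Rabs_pos_eq in diff; last lra | rewrite Rabs_left in diff => //];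
    by case: Rlt_dec => c1; case: Rlt_dec => c2 //=; lra.
have [y [y' [ny ny' ne]]] := hx d j dp jk.
by apply: ne; rewrite !lab.
Qed.
End Torus.

End Torus.

(** * Arithmetic hypotheses and degenerate cases *)

Module Bounds.

Import ZArith.
Import all_boot zify.
Import ConfigurationSpaces Lifting Strata Torus.
Set Implicit Arguments. Unset Strict Implicit.
Local Open Scope nat_scope.

Lemma prime_of_Zprime k : Znumtheory.prime (Z.of_nat k) -> prime k.
Proof.
move=> [k1 h]; apply/primeP; split; first by apply/ltP; lia.
move=> d dk; have [->|dne] := eqVneq d k; first by rewrite orbT.
have k0 : (0 < k)%N by apply/ltP; lia.
have dlt : (d < k)%N by rewrite ltn_neqAle dne dvdn_leq.
have d0 : (0 < d)%N by apply: dvdn_gt0 dk.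
have [_ _ rel] := h (Z.of_nat d) ltac:(lia).
have dvd : Z.divide (Z.of_nat d) (Z.of_nat k).
  by move/dvdnP: dk => [c ->]; exists (Z.of_nat c); lia.
have /Z.divide_1_r_nonneg := rel _ (Z.divide_refl _) dvd.
by move=> /(_ ltac:(lia)) e; rewrite orbF; apply/eqP; lia.
Qed.

Lemma prime_power_of_hyp n k : (1 <= k)%coq_nat ->
  (exists j, k = Nat.pow 2 j) \/ k = 3 \/ (Nat.Odd n /\ Znumtheory.prime (Z.of_nat k)) ->
  exists p e, prime p /\ k = (p ^ e)%N.
Proof.
move=> k1 [[j ->]|[->|[_ /prime_of_Zprime pk]]].
- exists 2, j; split=> //; elim: j {k1} => //= j ->; rewrite expnS; lia.
- by exists 3, 1.
- by exists k, 1; rewrite expn1.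
Qed.

(** [secat_lower] covers at least two points in dimension at least two; otherwise the bound is 0. *)
Lemma secat_ge_dim n k M : (1 <= n)%coq_nat -> (1 <= k)%coq_nat ->
  (exists p e, prime p /\ k = (p ^ e)%N) ->
  secat_le (F_space n k) (B_space n k) (pi_conf n k) M ->
  (Nat.mul (Nat.sub k 1) (Nat.sub n 1) <= M)%coq_nat.
Proof.
case: n k => [|[|n]] [|[|k]] n1 k1 [p [e [pp ke]]] H; try lia.
by have := secat_lower pp ke (ltn0Sn _) H; lia.
Qed.

Lemma cat_le_dim n k : (1 <= n)%coq_nat -> (1 <= k)%coq_nat ->
  cat_le (B_space n k) (Nat.mul (Nat.sub k 1) (Nat.sub n 1)).
Proof.
case: n k => [|n] [|k] n1 k1; try lia.
have -> : Nat.mul (Nat.sub k.+1 1) (Nat.sub n.+1 1) = (k * n)%N by lia.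
exact: cat_upper.
Qed.

Lemma secat_le_of_cat_le n k M : (1 <= n)%coq_nat -> (1 <= k)%coq_nat ->
  cat_le (B_space n k) M -> secat_le (F_space n k) (B_space n k) (pi_conf n k) M.
Proof. case: n k => [|n] [|k] n1 k1; try lia; exact: cat_secat. Qed.

Lemma cat_plane_ge k M : (1 <= k)%coq_nat -> cat_le (B_space 2 k) M -> (Nat.sub k 1 <= M)%coq_nat.
Proof.
case: k => [|[|k]] k1 H; try lia.
by have := cat_lower2 H; lia.
Qed.

End Bounds.

Theorem theorem4 :
  (forall n k : nat, (1 <= n)%nat -> (1 <= k)%nat ->
     ((exists j : nat, k = (2 ^ j)%nat) \/ k = 3%nat \/
      (Nat.Odd n /\ prime (Z.of_nat k))) ->
     is_least (secat_le (F_space n k) (B_space n k) (pi_conf n k))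
              ((k - 1) * (n - 1))%nat /\
     is_least (cat_le (B_space n k)) ((k - 1) * (n - 1))%nat)
  /\
  (forall k : nat, (1 <= k)%nat -> is_least (cat_le (B_space 2 k)) (k - 1)%nat).
Proof.
  split.
  - intros n k Hn Hk H.
    assert (P := Bounds.prime_power_of_hyp Hk H).
    assert (C := Bounds.cat_le_dim Hn Hk).
    assert (S : forall M, cat_le (B_space n k) M ->
              secat_le (F_space n k) (B_space n k) (pi_conf n k) M)
      by (intro M; apply Bounds.secat_le_of_cat_le; assumption).
    assert (L : forall M, secat_le (F_space n k) (B_space n k) (pi_conf n k) M ->
              ((k - 1) * (n - 1) <= M)%nat)
      by (intros M HM; exact (Bounds.secat_ge_dim Hn Hk P HM)).
    split; split; auto.
  - intros k Hk; split.
    + assert (C := Bounds.cat_le_dim (le_S 1 1 (le_n 1)) Hk).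
      change (2 - 1)%nat with 1%nat in C; rewrite Nat.mul_1_r in C; exact C.
    + intros M HM; exact (Bounds.cat_plane_ge Hk HM).
Qed.
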